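(* Let $I\subset\mathbb{R}$ be a closed interval and $\phi\in C^\infty(I,(0,\infty))$. Assume that $n=1$, $0\in I$, $\phi$ is even, and $\phi''(0)>0$. Then for any $\sigma\in(0,1/2)$ and $\lambda>0$, there exists $\rho_0\in C^\infty(\mathbb{S}^1,I)$ such that $$\omega_{\rho_0}(\theta)\le\lambda\,\theta^{\sigma}\qquad\text{for all }\theta\in[0,\pi]$$ and the solution $\rho$ of the initial value problem $$\left\{\begin{aligned}&\partial_t\rho=\partial_x\left(\frac{\partial_x\rho}{\sqrt{\phi(\rho)^2+(\partial_x\rho)^2}}\right)+\frac{\phi'(\rho)}{\phi(\rho)}\,\frac{(\partial_x\rho)^2}{\sqrt{\phi(\rho)^2+(\partial_x\rho)^2}}&&\text{in }\mathbb{S}^1\times(0,T),\\ &\rho(\cdot,0)=\rho_0&&\text{on }\mathbb{S}^1\end{aligned}\right.$$ is such that $\partial_x\rho$ blows up in finite time, i.e. for some $T\in(0,\infty)$ the solution exists (smoothly) on $\mathbb{S}^1\times[0,T)$ and $\sup_{\mathbb{S}^1\times(0,t)}|\partial_x\rho|\to\infty$ as $t\to T$.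
   Context: $\mathbb{S}^1$ is the standard unit circle, $x$ denotes its arc-length (angle) coordinate, and $\operatorname{dist}_{\mathbb{S}^1}$ is the arc-length distance. For $\rho_0:\mathbb{S}^1\to\mathbb{R}$ the optimal modulus of continuity is $$\omega_{\rho_0}(\theta):=\sup\{|\rho_0(y)-\rho_0(x)|\,:\,x,y\in\mathbb{S}^1,\ \operatorname{dist}_{\mathbb{S}^1}(x,y)=\theta\},\qquad\theta\in[0,\pi].$$ That $\phi$ is even means that $I$ is symmetric about $0$ and $\phi(-s)=\phi(s)$ for all $s\in I$; $I$ has nonempty interior. For every $\rho_0\in C^\infty(\mathbb{S}^1,I)$ the initial value problem has, for small $T>0$, a unique solution $\rho\in C^\infty(\mathbb{S}^1\times[0,T])$, and it takes values in $I$; ''the solution'' means the maximal smooth extension in time of this solution. (The displayed equation is the case $n=1$ of $\partial_t\rho=\operatorname{div}\big(\nabla\rho/\sqrt{\phi(\rho)^2+|\nabla\rho|^2}\big)+n\frac{\phi'(\rho)}{\phi(\rho)}|\nabla\rho|^2/\sqrt{\phi(\rho)^2+|\nabla\rho|^2}$ on $\mathbb{S}^n$.) *)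

(* Defs.v *)
From HB Require Import structures.
From mathcomp Require Import all_boot all_order all_algebra.
From mathcomp Require Import all_classical all_reals all_analysis.

Set Implicit Arguments.
Unset Strict Implicit.
Unset Printing Implicit Defensive.

Import Order.TTheory GRing.Theory Num.Theory.
Import numFieldNormedType.Exports.
Local Open Scope classical_set_scope.
Local Open Scope ring_scope.

(* The derivative of f relative to the set A: difference quotients are taken
   inside A only, so at an endpoint of an interval this is the one-sided
   derivative, and values of f outside A play no role. *)
Definition quotient_within (R : realType) (f : R -> R) (x : R) : R -> R :=
  fun y => (f y - f x) / (y - x).

Definition derivable_within (R : realType) (A : set R) (f : R -> R) (x : R)
    : Prop :=
  cvg (quotient_within f x y @[y --> within A x^']).

Definition derive_within (R : realType) (A : set R) (f : R -> R) : R -> R :=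
  fun x => lim (quotient_within f x y @[y --> within A x^']).

Definition smooth_on (R : realType) (A : set R) (f : R -> R) : Prop :=
  forall n x, A x -> derivable_within A (iter n (derive_within A) f) x.

(* Functions on the circle are (2 pi)-periodic functions of the angle. *)
Definition dist_S1 (R : realType) (x y : R) : R :=
  inf [set `|x - y + k%:~R * (pi *+ 2)| | k in [set: int]].

Definition smooth_S1 (R : realType) (f : R -> R) : Prop :=
  periodic f (pi *+ 2) /\ forall n x, derivable (derive1n n f) x 1.

Definition modulus_S1 (R : realType) (f : R -> R) (theta : R) : R :=
  sup [set r | exists x y, dist_S1 x y = theta /\ r = `|f y - f x|].

Definition partial_x (R : realType) (f : R -> R -> R) : R -> R -> R :=
  fun x t => derive1 (f^~ t) x.

Definition partial_t (R : realType) (J : set R) (f : R -> R -> R)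
    : R -> R -> R :=
  fun x t => derive_within J (f x) t.

(* The iterated partial derivative coded by the word w
   (true for the time variable, false for the space variable). *)
Definition partials (R : realType) (J : set R) (w : seq bool)
    (f : R -> R -> R) : R -> R -> R :=
  foldr (fun b g => if b then partial_t J g else partial_x g) f w.

(* Smoothness of f on (circle) x J, up to the endpoints of J that lie in J. *)
Definition smooth_S1_time (R : realType) (J : set R) (f : R -> R -> R)
    : Prop :=
  (forall t, J t -> periodic (f^~ t) (pi *+ 2)) /\
  forall w : seq bool,
    {within [set p : R * R | J p.2],
       continuous (fun p : R * R => partials J w f p.1 p.2)} /\
    forall x t, J t ->
      derivable ((partials J w f)^~ t) x 1 /\
      derivable_within J (partials J w f x) t.

Definition is_solution (R : realType) (I : set R) (phi rho0 : R -> R) (T : R)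
    (rho : R -> R -> R) : Prop :=
  [/\ smooth_S1_time `[0, T[ rho,
      forall x t, 0 <= t < T -> I (rho x t),
      forall x t, 0 < t < T ->
        let W := fun y s =>
          Num.sqrt (phi (rho y s) ^+ 2 + partial_x rho y s ^+ 2) in
        partial_t `[0, T[ rho x t =
          partial_x (fun y s => partial_x rho y s / W y s) x t
          + derive_within I phi (rho x t) / phi (rho x t)
            * (partial_x rho x t ^+ 2 / W x t)
    & forall x, rho x 0 = rho0 x].

(* The unique maximal solution, in the case of a finite lifespan T. *)
Definition is_maximal_solution (R : realType) (I : set R) (phi rho0 : R -> R)
    (T : R) (rho : R -> R -> R) : Prop :=
  is_solution I phi rho0 T rho /\
  forall (T' : R) (rho' : R -> R -> R), 0 < T' ->
    is_solution I phi rho0 T' rho' ->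
    T' <= T /\ forall x t, 0 <= t < T' -> rho' x t = rho x t.

Definition gradient_blows_up (R : realType) (T : R) (rho : R -> R -> R)
    : Prop :=
  ereal_sup [set e | exists x s, 0 < s < t /\ e = (`|partial_x rho x s|)%:E]
    @[t --> T^'-] --> +oo%E.

(* Main.v *)
Require Import Defs.
From HB Require Import structures.
From mathcomp Require Import all_boot all_order all_algebra.
From mathcomp Require Import all_classical all_reals all_analysis.
From mathcomp Require Import ring lra.
Import Order.TTheory GRing.Theory Num.Theory.
Import numFieldNormedType.Exports.
Local Open Scope classical_set_scope.
Local Open Scope ring_scope.
Set Implicit Arguments.
Unset Strict Implicit.
Unset Printing Implicit Defensive.

(* Put rho = psi(r) with psi' = phi(psi). The equation becomes
     r_t = g(r) r_xx / (1 + r_x^2)^(3/2) - g'(r) r_x^2 / (1 + r_x^2)^(1/2),   g = 1 / phi(psi),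
   where g is even and, because phi''(0) > 0, satisfies g'(r) <= - c r for small r >= 0.

   Blow-up: an odd solution stays odd, vanishes at x = 0 and is nonnegative on [0, pi]. There the inequality
   m(t) r + K(t) r^3 >= x is preserved when m decreases linearly at rate c / 4, K grows suitably and K m is
   small. At the time where m vanishes it contradicts the finiteness of r_x(0). The data
   r = A y (eps^2 + y^2)^(-(1 - s) / 2), y = sin x, have a Hoelder seminorm of exponent s controlled by A and
   satisfy the inequality initially with K m = O(eps^(2 - 4 s)), which is small since s < 1/2.

   Existence: averaging the space derivatives at scale h commutes with d/dx, and the explicit Euler step of the
   averaged equation obeys a discrete maximum principle; this bounds all derivatives uniformly in h on a time
   interval depending only on a C^3 bound of the data. Bernstein's method shows that r_xx and r_xxx stay bounded
   as long as r_x does, so the maximal solution can only stop by blow-up of r_x. Uniqueness follows from the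
   maximum principle. *)

(** The substitution turns the square root in the flux into [phi] times sqrt(1 + r_x^2), so only g
    and g' remain as coefficients. For the inverse X(r, t) of a monotone branch of r, with w = (1 +
    X_r^2)^(-1/2), the equation reads X_t = w^3 X_r g X_rr + w g'. Since g' <= - c r, the last term
    pulls every level towards x = 0 while diffusion resists. For X = m r + K r^3 diffusion costs at
    most 6 g K (m + 3 K r^2) r: the part with K m loses to the pull when K m is small against c, the
    cubic part is absorbed by the growth of K. A bound m r >= x alone is impossible away from the
    origin, where r stays below a fixed amplitude while m tends to 0; the cubic term covers that
    region. The comparison runs on [0, pi/2], so r(pi/2) must not collapse before m vanishes; a
    second barrier, built on the sine, secures this.

    The sign of g' is known only near 0 and [phi] only on I. Hence the small amplitude, and the
    demand that the bound |r| <= A survive each step of the scheme exactly. *)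

(** Division-free form of differentiability relative to [A]: the point y = x needs no exclusion, and
    sums, products and compositions become plain estimates. [A = setT] gives ordinary derivatives, a
    half-open interval gives the time derivatives of the statement. *)
Definition der (R : realType) (A : set R) (f : R -> R) (x l : R) : Prop :=
  forall e : R, 0 < e -> exists2 d : R, 0 < d &
    forall y : R, A y -> `|y - x| < d -> `|f y - f x - l * (y - x)| <= e * `|y - x|.

(** * Calculus of derivatives relative to a set *)

Section der_theory.
Variable R : realType.
Implicit Types (A B : set R) (f g : R -> R).

Lemma der_eq A f x l l' : der A f x l -> l = l' -> der A f x l'.
Proof. by move=> h <-. Qed.

Lemma der_sub A B f x l : B `<=` A -> der A f x l -> der B f x l.
Proof. by move=> BA h e /h[d d0 hd]; exists d => // y /BA; exact: hd. Qed.

Lemma der_loc A B f g x l d0 : 0 < d0 -> f x = g x ->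
  (forall y, B y -> `|y - x| < d0 -> A y /\ f y = g y) ->
  der A f x l -> der B g x l.
Proof.
move=> d0p fgx fg h e /h[d dp hd]; exists (Num.min d d0); rewrite ?lt_min ?dp//.
move=> y By; rewrite lt_min => /andP[yd yd0]; have [Ay <-] := fg _ By yd0.
by rewrite -fgx; exact: hd.
Qed.

Lemma der_ext A f g x l : A x -> (forall y, A y -> f y = g y) ->
  der A f x l -> der A g x l.
Proof.
by move=> Ax fg; apply: (@der_loc _ _ _ _ _ _ 1) => //; [exact: fg|move=> y Ay _; split=> //; exact: fg].
Qed.

Lemma der_lip A f x l : der A f x l -> exists2 d : R, 0 < d &
  forall y, A y -> `|y - x| < d -> `|f y - f x| <= (`|l| + 1) * `|y - x|.
Proof.
move=> /(_ 1 ltr01)[d dp hd]; exists d => // y Ay yx.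
have := hd _ Ay yx; rewrite mulrDl => h.
rewrite -[f y - f x](subrK (l * (y - x))) addrC.
by apply: (le_trans (ler_normD _ _)); rewrite normrM lerD2l.
Qed.

Lemma der_cont A f x l : der A f x l -> forall e : R, 0 < e -> exists2 d : R, 0 < d &
  forall y, A y -> `|y - x| < d -> `|f y - f x| < e.
Proof.
move=> /der_lip[d dp hd] e ep.
have l1 : 0 < `|l| + 1 by rewrite ltr_pwDr.
exists (Num.min d (e / (`|l| + 1))); first by rewrite lt_min dp divr_gt0.
move=> y Ay; rewrite lt_min => /andP[yd ye].
by apply: (le_lt_trans (hd _ Ay yd)); rewrite mulrC -ltr_pdivlMr.
Qed.

Lemma der_cst A c x : der A (fun=> c) x 0.
Proof. by move=> e e0; exists 1 => // y _ _; rewrite subrr mul0r subr0 normr0 mulr_ge0// ltW. Qed.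

Lemma der_id A x : der A (fun y => y) x 1.
Proof. by move=> e e0; exists 1 => // y _ _; rewrite mul1r subrr normr0 mulr_ge0// ltW. Qed.

Lemma der_add A f g x l m : der A f x l -> der A g x m ->
  der A (fun y => f y + g y) x (l + m).
Proof.
move=> hf hg e e0; have e20 : 0 < e / 2 by rewrite divr_gt0.
have [d dp hd] := hf _ e20; have [d' dp' hd'] := hg _ e20.
exists (Num.min d d'); first by rewrite lt_min dp.
move=> y Ay; rewrite lt_min => /andP[yd yd'].
have := hd _ Ay yd; have := hd' _ Ay yd'.
rewrite (_ : _ + _ - _ - _ = (f y - f x - l * (y - x)) + (g y - g x - m * (y - x))); last by ring.
by move=> h1 h2; apply: (le_trans (ler_normD _ _)); lra.
Qed.

Lemma der_scale A f x l c : der A f x l -> der A (fun y => c * f y) x (c * l).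
Proof.
move=> hf e e0; have cp : 0 < `|c| + 1 by rewrite ltr_pwDr.
have [d dp hd] := hf (e / (`|c| + 1)) (divr_gt0 e0 cp).
exists d => // y Ay yd; have := hd _ Ay yd.
rewrite -[c * l * _]mulrA -!mulrBr normrM => h.
apply: (le_trans (ler_wpM2l (normr_ge0 _) h)).
rewrite mulrA ler_wpM2r// mulrCA ler_piMr ?(ltW e0)// ler_pdivrMr// mul1r lerDl//.
Qed.

Lemma der_opp A f x l : der A f x l -> der A (fun y => - f y) x (- l).
Proof. by move=> /(der_scale (-1)); rewrite mulN1r; under eq_fun do rewrite mulN1r. Qed.

Lemma der_bnd A f x l : der A f x l -> exists2 d : R, 0 < d &
  forall y, A y -> `|y - x| < d -> `|f y| <= `|f x| + 1.
Proof.
move=> /der_cont/(_ 1 ltr01)[d dp hd]; exists d => // y Ay yd.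
rewrite -[f y](subrK (f x)) addrC; apply: (le_trans (ler_normD _ _)).
by rewrite lerD2l ltW// hd.
Qed.

Lemma der_mul A f g x l m : der A f x l -> der A g x m ->
  der A (fun y => f y * g y) x (l * g x + f x * m).
Proof.
move=> hf hg e e0.
have [d1 p1 h1] := der_bnd hg.
pose K := `|g x| + 1 + `|f x| + `|l|; have K0 : 0 < K by rewrite /K -!addrA ltr_wpDl// ltr_pwDl// addr_ge0.
have [d2 p2 h2] := hf _ (divr_gt0 e0 (mulr_gt0 (ltr0Sn R 2) K0)).
have [d3 p3 h3] := hg _ (divr_gt0 e0 (mulr_gt0 (ltr0Sn R 2) K0)).
have [d4 p4 h4] := der_cont hg (divr_gt0 e0 (mulr_gt0 (ltr0Sn R 2) K0)).
exists (Num.min (Num.min d1 d2) (Num.min d3 d4)); first by rewrite !lt_min p1 p2 p3.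
move=> y Ay; rewrite !lt_min => /andP[/andP[y1 y2] /andP[y3 y4]].
move: (h1 _ Ay y1) (h2 _ Ay y2) (h3 _ Ay y3) (h4 _ Ay y4).
set w := e / _; move=> b1 b2 b3 b4.
rewrite (_ : _ - _ - _ = (f y - f x - l * (y - x)) * g y +
  (f x * (g y - g x - m * (y - x)) + l * (y - x) * (g y - g x))); last by ring.
have -> : e = w * K *+ 3 by rewrite /w mulrAC -mulrnAr; field; rewrite gt_eqF.
have w0 : 0 <= w by rewrite /w divr_ge0 ?ltW// mulr_gt0.
have t1 : `|f y - f x - l * (y - x)| * `|g y| <= w * `|y - x| * K.
  by apply: ler_pM => //; apply: (le_trans b1); rewrite /K -!addrA lerD2l lerDl addr_ge0.
have t2 : `|f x| * `|g y - g x - m * (y - x)| <= K * (w * `|y - x|).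
  apply: ler_pM => //; rewrite /K -addrA addrCA lerDl; rewrite addr_ge0// addr_ge0//.
have t3 : `|l| * `|y - x| * `|g y - g x| <= K * `|y - x| * w.
  apply: ler_pM => //; rewrite ?mulr_ge0 ?(ltW b4)//.
  by rewrite ler_wpM2r// /K lerDr addr_ge0// addr_ge0.
apply: (le_trans (ler_normD _ _)); apply: (@le_trans _ _ (w * `|y - x| * K + (K * (w * `|y - x|) + K * `|y - x| * w))); last first.
  by rewrite le_eqVlt; apply/orP; left; apply/eqP; ring.
rewrite lerD// ?normrM//; apply: (le_trans (ler_normD _ _)).
by rewrite lerD// !normrM.
Qed.

Lemma der_comp A B f g x l m : (forall y, A y -> B (f y)) ->
  der A f x l -> der B g (f x) m -> der A (fun y => g (f y)) x (m * l).
Proof.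
move=> AB hf hg e e0.
have [d1 p1 h1] := der_lip hf.
pose K := `|m| + 1 + `|l| + 1; have K0 : 0 < K by rewrite /K ltr_wpDl ?addr_ge0.
have w0 := divr_gt0 e0 (mulr_gt0 (ltr0Sn R 1) K0).
have [d2 p2 h2] := hf _ w0; have [d3 p3 h3] := hg _ w0.
have [d4 p4 h4] := der_cont hf p3.
exists (Num.min d1 (Num.min d2 d4)); first by rewrite !lt_min p1 p2.
move=> y Ay; rewrite !lt_min => /andP[y1 /andP[y2 y4]].
move: (h1 _ Ay y1) (h2 _ Ay y2) (h3 _ (AB _ Ay) (h4 _ Ay y4)).
set w := e / _; move=> b1 b2 b3; rewrite -/w in w0.
rewrite (_ : _ - _ - _ = (g (f y) - g (f x) - m * (f y - f x)) +
  m * (f y - f x - l * (y - x))); last by ring.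
have -> : e = w * K + w * K by rewrite /w; field; rewrite gt_eqF.
rewrite mulrDl; apply: (le_trans (ler_normD _ _)); apply: lerD.
  apply: (le_trans b3); rewrite -mulrA ler_pM2l//.
  apply: (le_trans b1); rewrite ler_wpM2r// /K.
  by have := normr_ge0 m; lra.
rewrite normrM [w * K]mulrC -mulrA; apply: ler_pM => //.
by rewrite /K -!addrA lerDl addr_ge0// addr_ge0.
Qed.

Lemma der_exp A f x l n : der A f x l ->
  der A (fun y => f y ^+ n) x (n%:R * f x ^+ n.-1 * l).
Proof.
move=> h; elim: n => [|n ih]; first by apply: der_eq (der_cst _ _ _) _; rewrite mul0r mul0r.
have := der_mul ih h; under eq_fun do rewrite -exprSr.
move/der_eq; apply; case: n {ih} => [|n]; first by rewrite !expr0/=; ring.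
by rewrite /= [in LHS]exprSr [in RHS]exprSr -[n.+2%:R]natr1; ring.
Qed.

Lemma der_inv A f x l : (forall y, A y -> f y != 0) -> A x -> der A f x l ->
  der A (fun y => (f y)^-1) x (- l / f x ^+ 2).
Proof.
move=> f0 Ax hf.
have fx0 := f0 _ Ax; have nf0 : 0 < `|f x| by rewrite normr_gt0.
move=> e e0.
have [d1 p1 h1] := der_lip hf.
have [d2 p2 h2] := der_cont hf (divr_gt0 nf0 (ltr0Sn R 1)).
pose w := `|f x| ^+ 2 * e / 4; have w0 : 0 < w by rewrite divr_gt0// mulr_gt0// exprn_gt0.
have [d3 p3 h3] := hf _ w0.
pose L := `|l| + 1; have L0 : 0 < L by rewrite /L ltr_wpDl.
pose q := `|f x| ^+ 3 * e / 4 / L / L.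
have q0 : 0 < q by rewrite !divr_gt0// mulr_gt0// exprn_gt0.
exists (Num.min (Num.min d1 d2) (Num.min d3 q)); first by rewrite !lt_min p1 p2 p3.
move=> y Ay; rewrite !lt_min => /andP[/andP[y1 y2] /andP[y3 y4]].
move: (h1 _ Ay y1) (h2 _ Ay y2) (h3 _ Ay y3) => b1 b2 b3.
have fy0 := f0 _ Ay.
have fyl : `|f x| / 2 <= `|f y|.
  have : `|f x| <= `|f y| + `|f y - f x|.
    by rewrite -{1}[f x](subKr (f y)); apply: ler_normB.
  by move: b2; lra.
rewrite (_ : _ - _ - _ = (- (f y - f x - l * (y - x)) * f x + (l * (y - x)) * (f y - f x))
   / (f y * f x ^+ 2)); last by field; rewrite fx0.
have fpos : 0 < `|f y * f x ^+ 2| by rewrite normr_gt0 mulf_neq0// expf_neq0.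
rewrite normrM normfV ler_pdivrMr// normrM normrX.
apply: (@le_trans _ _ (e * `|y - x| * (`|f x| / 2 * `|f x| ^+ 2))); last first.
  by rewrite ler_wpM2l ?mulr_ge0 ?(ltW e0)// ler_wpM2r// exprn_ge0.
apply: (le_trans (ler_normD _ _)); rewrite !normrM normrN.
have c2 : `|l| * `|y - x| * `|f y - f x| <= (L * `|y - x|) * (L * `|y - x|).
  by apply: ler_pM => //; rewrite ?mulr_ge0// ler_wpM2r// /L lerDl.
have c3 : `|f y - f x - l * (y - x)| * `|f x| <= w * `|y - x| * `|f x| by apply: ler_wpM2r.
apply: (le_trans (lerD c3 c2)).
have c4 : L * L * `|y - x| <= `|f x| ^+ 3 * e / 4.
  have := ltW y4; rewrite /q !ler_pdivlMr// => h; rewrite mulrC mulrA; lra.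
have : `|y - x| * (L * L * `|y - x|) <= `|y - x| * (`|f x| ^+ 3 * e / 4) by rewrite ler_wpM2l.
rewrite /w; lra.
Qed.

Lemma der_uniq A f x l m : (forall d, 0 < d -> exists y, [/\ A y, y != x & `|y - x| < d]) ->
  der A f x l -> der A f x m -> l = m.
Proof.
move=> lim hl hm; apply/eqP; rewrite -subr_eq0 -normr_le0; apply/ler_addgt0Pr => e e0.
rewrite add0r; have e20 : 0 < e / 2 by rewrite divr_gt0.
have [d dp hd] := hl _ e20; have [d' dp' hd'] := hm _ e20.
have [|y [Ay yx]] := lim (Num.min d d'); first by rewrite lt_min dp.
rewrite lt_min => /andP[/(hd _ Ay) h1 /(hd' _ Ay) h2].
have yx0 : 0 < `|y - x| by rewrite normr_gt0 subr_eq0.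
rewrite -(ler_pM2r yx0) -normrM.
rewrite (_ : _ * _ = (f y - f x - m * (y - x)) - (f y - f x - l * (y - x))); last by ring.
by apply: (le_trans (ler_normB _ _)); lra.
Qed.

(** Link with [derive_within]: its limit only sees points y != x, and at y = x the estimate of [der]
    is trivial. *)
Lemma der_quotient A f x l : der A f x l <->
  quotient_within f x y @[y --> within A x^'] --> l.
Proof.
split=> [h|/cvgrPdist_le h].
  apply/cvgrPdist_le => e e0; have [d dp hd] := h _ e0.
  rewrite near_withinE; near=> y => Ay.
  have yx : y != x by near: y; exact: nbhs_dnbhs_neq.
  have yd : `|y - x| < d.
    by rewrite distrC; near: y; apply: nbhs_dnbhs; exact: nbhsx_ballx.
  have := hd _ Ay yd; rewrite /quotient_within.
  have yx0 : 0 < `|y - x| by rewrite normr_gt0 subr_eq0.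
  rewrite -ler_pdivrMr// -normfV -normrM mulrBl mulfK ?subr_eq0//.
  by rewrite distrC.
move=> e /h; rewrite near_withinE => /nbhs_ballP[d /= dp hd]; exists d => // y Ay yd.
have [->|yx] := eqVneq y x; first by rewrite !subrr mulr0 subrr normr0 mulr0.
have := hd y; rewrite /= /ball/= distrC => /(_ yd yx Ay).
have yx0 : 0 < `|y - x| by rewrite normr_gt0 subr_eq0.
rewrite /quotient_within => hq; rewrite -ler_pdivrMr// -normfV -normrM mulrBl mulfK ?subr_eq0//.
by rewrite distrC.
Unshelve. all: by end_near. Qed.

Lemma der_is_derive f x l : der setT f x l <-> is_derive x 1 f l.
Proof.
split=> [h|[df <-]].
  have hl : h^-1 *: (f (h *: (1 : R) + x) - f x) @[h --> 0^'] --> l.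
    apply/cvgrPdist_le => e e0; have [d dp hd] := h _ e0.
    near=> k.
    have k0 : k != 0 by near: k; exact: nbhs_dnbhs_neq.
    have kd : `|k| < d.
      by near: k; apply: dnbhs0_lt.
    have := hd (k *: 1 + x) I; rewrite addrK /= [k *: 1]mulr1 => /(_ kd).
    have kp : 0 < `|k| by rewrite normr_gt0.
    rewrite -ler_pdivrMr// -normfV -normrM mulrBl mulfK//.
    by rewrite distrC [_ *: _]mulrC.
  by apply: DeriveDef; [apply/cvg_ex; exists l|apply/cvg_lim].
move=> e e0; have /cvgrPdist_le/(_ _ e0) := df.
move=> /nbhs_ballP[d /= dp hd]; exists d => // y _ yd.
have [->|yx] := eqVneq y x; first by rewrite !subrr mulr0 subrr normr0 mulr0.
have := hd (y - x); rewrite /= /ball/= sub0r normrN => /(_ yd).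
rewrite subr_eq0 => /(_ yx).
have yx0 : 0 < `|y - x| by rewrite normr_gt0 subr_eq0.
move=> hq; rewrite -ler_pdivrMr// -normfV -normrM mulrBl mulfK ?subr_eq0//.
by move: hq; rewrite distrC [_ *: 1]mulr1 subrK [_ *: _]mulrC.
Unshelve. all: by end_near. Qed.

End der_theory.

(** Differentiates along the syntax of the function, leaving the derivative as a unification
    variable and taking the leaves from the context; [der_ring] then reconciles the result with the
    expected derivative. *)
Ltac der_t :=
  lazymatch goal with
  | |- der _ (fun _ => ?c) _ _ => exact (der_cst _ _ _)
  | |- der _ (fun y => y) _ _ => exact (der_id _ _)
  | |- der _ (fun y => GRing.add (@?f y) (@?g y)) _ _ => eapply (@der_add _ _ f g); der_t
  | |- der _ (fun y => GRing.opp (@?f y)) _ _ => eapply (@der_opp _ _ f); der_t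
  | |- der _ (fun y => GRing.mul (@?f y) (@?g y)) _ _ => eapply (@der_mul _ _ f g); der_t
  | |- der _ (fun y => GRing.exp (@?f y) ?n) _ _ => eapply (@der_exp _ _ f _ _ n); der_t
  | |- _ => solve [eassumption | eauto] || idtac
  end.
Ltac der_ring := eapply der_eq; [der_t|rewrite /= ?expr1; ring].

(** * Mean value estimates, extremum tests and primitives on the line *)

Section der_real.
Variable R : realType.
Implicit Types f : R -> R.

Lemma der_continuous f x l : der setT f x l -> {for x, continuous f}.
Proof. by move=> /der_is_derive[df _]; exact/differentiable_continuous/derivable1_diffP. Qed.

Lemma der_uniqT f x l m : der setT f x l -> der setT f x m -> l = m.
Proof.
apply: der_uniq => d dp; exists (x + d / 2); split=> //.
  by rewrite -subr_eq0 addrC addKr gt_eqF// divr_gt0.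
by rewrite addrC addKr gtr0_norm ?divr_gt0//; lra.
Qed.

Lemma mvt f f' (a b : R) : a < b -> (forall x, a <= x <= b -> der setT f x (f' x)) ->
  exists c, [/\ a < c, c < b & f b - f a = f' c * (b - a)].
Proof.
move=> ab h; have [||c] := @MVT R f f' a b ab.
- move=> x; rewrite in_itv/= => /andP[xa xb]; apply/der_is_derive/h.
  by rewrite !ltW.
- by apply/continuous_in_subspaceT => x; rewrite inE/= in_itv/= => /h/der_continuous.
by rewrite in_itv/= => /andP[ac cb] fE; exists c.
Qed.

Lemma lip_der f f' (M x y : R) : (forall z, der setT f z (f' z)) ->
  (forall z, `|f' z| <= M) -> `|f y - f x| <= M * `|y - x|.
Proof.
move=> df bf; wlog xy : x y / x < y.
  move=> h; have [/h//|] := ltP x y; rewrite le_eqVlt => /orP[/eqP->|/h].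
    by rewrite !subrr normr0 mulr0.
  by rewrite distrC [`|x - y|]distrC.
have [c [_ _ ->]] := mvt xy (fun x _ => df x).
by rewrite normrM ler_wpM2r.
Qed.

(** The mean value theorem for f, then for f', loses the factor 1/2 of Taylor's formula, which never
    matters here. *)
Lemma taylor1 f f' f'' (M x y : R) : (forall z, der setT f z (f' z)) ->
  (forall z, der setT f' z (f'' z)) -> (forall z, `|f'' z| <= M) ->
  `|f y - f x - f' x * (y - x)| <= M * `|y - x| ^+ 2.
Proof.
move=> df df' bf.
have key c : `|c - x| <= `|y - x| -> `|f' c * (y - x) - f' x * (y - x)| <= M * `|y - x| ^+ 2.
  move=> cx; rewrite -mulrBl normrM expr2 mulrA ler_wpM2r//.
  apply: (le_trans (lip_der _ _ df' bf)); rewrite ler_wpM2l//.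
  exact: le_trans (normr_ge0 _) (bf 0).
have [xy|] := ltP x y; last rewrite le_eqVlt => /orP[/eqP->|yx].
- have [c [ac cb ->]] := mvt xy (fun x _ => df x); apply: key.
  by rewrite !gtr0_norm ?subr_gt0//; lra.
- by rewrite !subrr mulr0 subrr normr0 expr0n mulr0.
- have [c [ac cb e]] := mvt yx (fun x _ => df x).
  have -> : f y - f x = f' c * (y - x) by rewrite -opprB e; ring.
  by apply: key; rewrite !ltr0_norm ?subr_lt0//; lra.
Qed.

Lemma der_max f (x l d : R) : 0 < d ->
  (forall z, `|z - x| < d -> f z <= f x) -> der setT f x l -> l = 0.
Proof.
move=> d0 fm h; apply/eqP/negPn/negP => l0; have l0p : 0 < `|l| by rewrite normr_gt0.
have [e e0 he] := h _ (divr_gt0 l0p (ltr0Sn R 1)).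
pose w := Num.min d e / 2; have w0 : 0 < w by rewrite divr_gt0// lt_min d0.
have wd : w < d by rewrite ltr_pdivrMr// gt_min; apply/orP; left; lra.
have we : w < e by rewrite ltr_pdivrMr// gt_min; apply/orP; right; lra.
have [lp|ln] := ltP 0 l.
  have := fm (x + w); have := he (x + w) I; rewrite addrC addKr gtr0_norm// => /(_ we) a /(_ wd) b.
  move: a; rewrite ler_norml => /andP[a _]; move: a; rewrite gtr0_norm//.
  by have := mulr_gt0 lp w0; lra.
have := fm (x - w); have := he (x - w) I; rewrite addrC addKr normrN gtr0_norm// => /(_ we) a /(_ wd) b.
have ln' : l < 0 by rewrite lt_neqAle l0.
move: a; rewrite ler_norml => /andP[a _]; move: a; rewrite ltr0_norm//.
have : 0 < - l * w by rewrite mulr_gt0// oppr_gt0.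
by lra.
Qed.

(** If l > 0, then f', which vanishes at the maximum x, is positive just to the right of x, and the
    mean value theorem produces a larger value of f there. *)
Lemma der2_max f f' (x l d : R) : 0 < d ->
  (forall z, `|z - x| < d -> f z <= f x) -> (forall z, der setT f z (f' z)) ->
  der setT f' x l -> l <= 0.
Proof.
move=> d0 fm df df'; rewrite leNgt; apply/negP => l0.
have f'x : f' x = 0 by apply: (der_max d0 fm).
have [e e0 he] := df' _ (divr_gt0 l0 (ltr0Sn R 1)).
pose w := Num.min d e / 2; have w0 : 0 < w by rewrite divr_gt0// lt_min d0.
have wd : w < d by rewrite ltr_pdivrMr// gt_min; apply/orP; left; lra.
have we : w < e by rewrite ltr_pdivrMr// gt_min; apply/orP; right; lra.
have xw : x < x + w by rewrite ltrDl.
have [c [xc cw ce]] := mvt xw (fun z _ => df z).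
have := fm (x + w); rewrite addrC addKr gtr0_norm// => /(_ wd) fw.
have : f (x + w) - f x <= 0 by rewrite subr_le0.
rewrite ce addrAC subrr add0r.
have c0 : 0 < c - x by rewrite subr_gt0.
have := he c I; rewrite gtr0_norm// => /(_ _).
have -> : c - x < e by lra.
move=> /(_ isT); rewrite f'x subr0 ler_norml => /andP[a _].
have : 0 < f' c by have := mulr_gt0 l0 c0; lra.
by move=> p; rewrite leNgt mulr_gt0.
Qed.

Lemma der_min f (x l d : R) : 0 < d ->
  (forall z, `|z - x| < d -> f x <= f z) -> der setT f x l -> l = 0.
Proof.
move=> d0 fm h; apply/eqP; rewrite -oppr_eq0; apply/eqP.
by apply: (@der_max (fun y => - f y) x _ d) => //; [move=> z /fm; rewrite lerN2|exact: der_opp].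
Qed.

Lemma der0_cst f (a b : R) : a <= b -> (forall x, a <= x <= b -> der setT f x 0) -> f b = f a.
Proof.
rewrite le_eqVlt => /orP[/eqP->//|ab] h.
have [c [_ _]] := mvt ab (f' := fun=> 0) h.
by rewrite mul0r => /eqP; rewrite subr_eq0 => /eqP.
Qed.

(** The fundamental theorem of calculus differentiates the integral from a base point only to the
    right of that point. Base points to the left of 0 give the same function up to a constant, so
    normalising at 0 allows a base point that depends on x. *)
Lemma primitive f : continuous f -> exists F : R -> R, forall x, der setT F x (f x).
Proof.
move=> cf; pose P a x := \int[lebesgue_measure]_(t in [set` `]a, x]]) f t.
have dP a x : a < x -> der setT (P a) x (f x).
  move=> ax; apply/der_is_derive.
  have xu : x < x + 1 by rewrite ltrDl.
  have [|||dP <-] := @continuous_FTC1 R f (BRight a) x _ xu.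
  - apply: (@integrableS _ _ _ lebesgue_measure `[a, x + 1]%classic) => //.
      by move=> y/=; rewrite !in_itv/= => /andP[/ltW-> ->].
    by apply: continuous_compact_integrable => //; [exact: segment_compact|exact: continuous_subspaceT].
  - by [].
  - exact: cf.
  by rewrite derive1E; exact: derivableP.
have PP a b x : b <= a -> a < x -> a < 0 -> P a x - P a 0 = P b x - P b 0.
  move=> ba ax a0.
  have e (y : R) z : a < y -> y <= z -> P a z - P b z = P a y - P b y.
    move=> ay yz; apply: (@der0_cst (fun t => P a t - P b t)) => // t /andP[yt tz].
    have at_ := lt_le_trans ay yt.
    by apply: der_eq (der_add (dP _ _ at_) (der_opp (dP _ _ (le_lt_trans ba at_)))) _; rewrite subrr.
  case: (leP x 0) => [x0|/ltW x0]; first by have := e _ _ ax x0; lra.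
  by have := e _ _ a0 x0; lra.
exists (fun x => P (- `|x| - 1) x - P (- `|x| - 1) 0) => x.
pose a := - `|x| - 2.
have ax : a < x by rewrite /a; have := ler_norm (- x); rewrite normrN; lra.
have a0 : a < 0 by rewrite /a; have := normr_ge0 x; lra.
apply: (@der_loc _ setT setT (fun y => P a y - P a 0) _ x _ 1) => //.
- apply/esym/PP; rewrite /a; first by lra.
    by have := ler_norm (- x); rewrite normrN; lra.
  by have := normr_ge0 x; lra.
- move=> y _ yx; split=> //; apply/esym/PP; rewrite /a.
  + have : `|y| <= `|y - x| + `|x| by rewrite -{1}[y](subrK x) ler_normD.
    lra.
  + by have := ler_norm (- y); rewrite normrN; lra.
  + by have := normr_ge0 y; lra.
- by apply: der_eq (der_add (dP _ _ ax) (der_cst _ _ _)) _; rewrite addr0.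
Qed.

End der_real.

(** * The function (1 + v^2)^(-1/2) *)

Definition zeta (R : realType) (v : R) : R := (Num.sqrt (1 + v ^+ 2))^-1.

Section zeta_theory.
Variable R : realType.
Implicit Types v : R.

Lemma sqr1p_gt0 v : 0 < 1 + v ^+ 2.
Proof. by rewrite ltr_pwDl// sqr_ge0. Qed.

Lemma zeta_gt0 v : 0 < zeta v.
Proof. by rewrite invr_gt0 sqrtr_gt0 sqr1p_gt0. Qed.

Lemma zeta2 v : zeta v ^+ 2 * (1 + v ^+ 2) = 1.
Proof.
by rewrite exprVn sqr_sqrtr ?mulVf ?gt_eqF ?ltW// sqr1p_gt0.
Qed.

Lemma zeta_le1 v : zeta v <= 1.
Proof.
have z0 := zeta_gt0 v; have e := zeta2 v.
rewrite leNgt; apply/negP => z1.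
have : 1 < zeta v ^+ 2 by rewrite exprn_egt1.
by have : 0 <= zeta v ^+ 2 * v ^+ 2 by [rewrite mulr_ge0 ?sqr_ge0]; lra.
Qed.

Lemma norm_zeta v : `|zeta v| <= 1.
Proof. by rewrite gtr0_norm ?zeta_gt0// zeta_le1. Qed.

Lemma norm_vzeta v : `|v * zeta v| <= 1.
Proof.
rewrite -(@expr_le1 _ 2)// real_normK ?num_real// exprMn mulrC.
by have := zeta2 v; have := sqr_ge0 (zeta v); lra.
Qed.

Lemma der_zeta v : der setT (@zeta R) v (- v * zeta v ^+ 3).
Proof.
have p := sqr1p_gt0 v.
have hs : der setT (fun y : R => Num.sqrt (1 + y ^+ 2)) v (v * zeta v).
  have h1 : der setT (fun y : R => 1 + y ^+ 2) v (2 * v).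
    by der_ring.
  have h2 : der setT (@Num.sqrt R) (1 + v ^+ 2) (2 * Num.sqrt (1 + v ^+ 2))^-1.
    exact/der_is_derive/is_derive1_sqrt.
  eapply der_eq; first exact: (der_comp (fun _ _ => I) h1 h2).
  by rewrite /zeta; field; rewrite sqrtr_eq0 -ltNge p.
apply: der_eq (der_inv _ _ hs) _ => //.
  by move=> y _; rewrite sqrtr_eq0 -ltNge sqr1p_gt0.
by rewrite /zeta; field; rewrite sqrtr_eq0 -ltNge p.
Qed.

End zeta_theory.

(** * Uniform derivative bounds in families of functions *)

Section families.
Variables (R : realType) (J : Type) (N : J -> R).
Hypothesis N0 : forall i, 0 <= N i.
Implicit Types f g : J -> R -> R.

Definition bdd f := exists C, forall i x, `|f i x| <= C.

(* The derivatives of order below [m] exist and are bounded uniformly in the family; the derivative of order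
   [m] may grow linearly with the parameter [N i]. *)
Fixpoint tame m f : Prop :=
  if m is m'.+1 then
    bdd f /\ exists2 g, (forall i x, der setT (f i) x (g i x)) & tame m' g
  else exists C, forall i x, `|f i x| <= C * (1 + N i).

Lemma bdd_tame0 f : bdd f -> tame 0 f.
Proof.
move=> [C h]; exists `|C| => i x; apply: (le_trans (h i x)).
apply: (le_trans (ler_norm C)); rewrite ler_peMr//.
by rewrite lerDl.
Qed.

Lemma tame_bdd m f : tame m.+1 f -> bdd f. Proof. by case. Qed.

Lemma tameS m f : tame m.+1 f -> tame m f.
Proof.
elim: m f => [|m ih] f; first by move=> [/bdd_tame0].
by move=> [bf [g dg tg]]; split=> //; exists g => //; exact: ih.
Qed.

Lemma tame_le m n f : (m <= n)%N -> tame n f -> tame m f.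
Proof. by move=> /subnK <-; elim: (n - m)%N => // k ih /tameS. Qed.

Lemma tame_der m f g : (forall i x, der setT (f i) x (g i x)) -> tame m.+1 f -> tame m g.
Proof.
move=> dg [_ [h dh]]; have -> // : g = h.
by apply/funext => i; apply/funext => x; exact: der_uniqT (dg i x) (dh i x).
Qed.

Lemma bdd_add f g : bdd f -> bdd g -> bdd (fun i x => f i x + g i x).
Proof.
move=> [C hf] [D hg]; exists (C + D) => i x.
by apply: (le_trans (ler_normD _ _)); rewrite lerD.
Qed.

Lemma bdd_mul f g : bdd f -> bdd g -> bdd (fun i x => f i x * g i x).
Proof.
by move=> [C hf] [D hg]; exists (C * D) => i x; rewrite normrM ler_pM.
Qed.

Lemma tame_cst m (c : R) : tame m (fun _ _ => c).
Proof.
elim: m c => [|m ih] c; first by apply: bdd_tame0; exists `|c|.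
split; first by exists `|c|.
by exists (fun _ _ => 0) => // i x; exact: der_cst.
Qed.

Lemma tame_add m f g : tame m f -> tame m g -> tame m (fun i x => f i x + g i x).
Proof.
elim: m f g => [|m ih] f g.
  move=> [C hf] [D hg]; exists (C + D) => i x; rewrite mulrDl.
  by apply: (le_trans (ler_normD _ _)); rewrite lerD.
move=> [bf [f' df tf]] [bg [g' dg tg]]; split; first exact: bdd_add.
exists (fun i x => f' i x + g' i x); last exact: ih.
by move=> i x; exact: der_add.
Qed.

Lemma tame_opp m f : tame m f -> tame m (fun i x => - f i x).
Proof.
elim: m f => [|m ih] f; first by move=> [C hf]; exists C => i x; rewrite normrN.
move=> [[C bf] [f' df tf]]; split; first by exists C => i x; rewrite normrN.
by exists (fun i x => - f' i x); [move=> i x; exact: der_opp|exact: ih].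
Qed.

(** One factor is controlled to one order more than the other, so a term that grows with [N] always
    meets a bounded one and the growth stays linear. *)
Lemma tame_mul m f g : tame m f -> tame m.+1 g -> tame m (fun i x => f i x * g i x).
Proof.
elim: m f g => [|m ih] f g.
  move=> [C hf] [[D hg] _]; exists (C * D) => i x; rewrite normrM mulrAC ler_pM//.
move=> [bf [f' df tf]] tg; have [bg [g' dg tg']] := tg; split; first exact: bdd_mul.
exists (fun i x => f' i x * g i x + f i x * g' i x).
  by move=> i x; exact: der_mul.
apply: tame_add; first by apply: ih => //; exact: tameS.
have : tame m (fun i x => g' i x * f i x).
  apply: ih; first exact: tameS.
  by split=> //; exists f'.
by under eq_fun do under eq_fun do rewrite mulrC.
Qed.

Lemma tame_mulr m f g : tame m.+1 f -> tame m g -> tame m (fun i x => f i x * g i x).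
Proof.
by move=> tf tg; have := tame_mul tg tf; under eq_fun do under eq_fun do rewrite mulrC.
Qed.

Lemma tame_mulS m f g : tame m.+1 f -> tame m.+1 g -> tame m.+1 (fun i x => f i x * g i x).
Proof.
move=> tf tg; have [bf [f' df tf']] := tf; have [bg [g' dg tg']] := tg.
split; first exact: bdd_mul.
exists (fun i x => f' i x * g i x + f i x * g' i x).
  by move=> i x; exact: der_mul.
by apply: tame_add; [exact: tame_mul|exact: tame_mulr].
Qed.

(** Two factors of the critical order would give quadratic growth in [N]; with [N] bounded this is
    harmless. *)
Lemma tame_mul_bdd m f g : bdd (fun i _ => N i) -> tame m f -> tame m g ->
  tame m (fun i x => f i x * g i x).
Proof.
case: m => [|m]; last by move=> _; exact: tame_mulS.
move=> [C NC] tf [D hg]; apply: bdd_tame0; case: tf => E hf.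
have b (K : R) (F : J -> R -> R) : (forall i x, `|F i x| <= K * (1 + N i)) -> bdd F.
  move=> h; exists (`|K| * (1 + C)) => i x; apply: (le_trans (h i x)).
  have := NC i 0; rewrite ger0_norm// => Ni.
  by apply: (@le_trans _ _ (`|K| * (1 + N i))); rewrite ?ler_wpM2r ?ler_wpM2l ?lerD2l ?addr_ge0 ?ler_norm.
by apply: bdd_mul; [exact: b hf|exact: b hg].
Qed.

Lemma tame_exp m f n : tame m.+1 f -> tame m.+1 (fun i x => f i x ^+ n).
Proof.
move=> tf; elim: n => [|n ih]; first exact: tame_cst.
have := tame_mulS tf ih; under eq_fun do under eq_fun do rewrite -exprS.
by [].
Qed.

Lemma tame_comp (G : nat -> R -> R) (A eta : R) m f k : A < eta ->
  (forall k y, `|y| < eta -> der setT (G k) y (G k.+1 y)) ->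
  (forall k, exists C, forall y, `|y| <= A -> `|G k y| <= C) ->
  (forall i x, `|f i x| <= A) -> tame m f -> (0 < m)%N -> tame m (fun i x => G k (f i x)).
Proof.
move=> Aeta dG bG fA; case: m => // m tf _; elim: m k tf => [|m ih] k tf; have [bf [f' df tf']] := tf.
  split; first by have [C hC] := bG k; exists C => i x; exact: hC.
  exists (fun i x => G k.+1 (f i x) * f' i x).
    by move=> i x; apply: (der_comp (B := setT)) => //; apply: dG; exact: le_lt_trans (fA _ _) _.
  case: tf' => C hC; have [D hD] := bG k.+1; exists (D * C) => i x.
  by rewrite normrM -mulrA ler_pM// hD.
split; first by have [C hC] := bG k; exists C => i x; exact: hC.
exists (fun i x => G k.+1 (f i x) * f' i x).
  by move=> i x; apply: (der_comp (B := setT)) => //; apply: dG; exact: le_lt_trans (fA _ _) _.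
by apply: tame_mulS => //; apply: ih; exact: tameS.
Qed.

Lemma tame_zeta m f : tame m.+1 f -> tame m.+1 (fun i x => zeta (f i x)).
Proof.
have bz (g : J -> R -> R) : bdd (fun i x => zeta (g i x)).
  by exists 1 => i x; exact: norm_zeta.
have dz i x (l : R) : der setT (f i) x l ->
    der setT (fun y => zeta (f i y)) x (- f i x * zeta (f i x) ^+ 3 * l).
  by move=> df; apply: (der_comp (B := setT)) => //; exact: der_zeta.
elim: m => [|m ih] tf; have [bf [f' df tf']] := tf; split=> //.
all: exists (fun i x => - f i x * zeta (f i x) ^+ 3 * f' i x) => [i x|]; first exact: dz.
  case: tf' => C hC; case: bf => D hD; exists (D * C) => i x.
  have z3 : `|zeta (f i x) ^+ 3| <= 1 by rewrite normrX exprn_ile1// norm_zeta.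
  rewrite 2!normrM normrN -mulrA -[D * C * _]mulrA; apply: ler_pM => //.
  by rewrite -[X in _ <= X]mul1r; apply: ler_pM.
apply: tame_mulS => //; apply: tame_mulS; first by apply: tame_opp; exact: tameS.
by apply: tame_exp; apply: ih; exact: tameS.
Qed.

End families.

(** * Averaged derivatives and their discrete maximum principle *)

Section average_difference.
Variable R : realType.
Implicit Types f g : R -> R.

Definition prim f : R -> R := xget f [set F | forall x, der setT F x (f x)].

Lemma primP f : continuous f -> forall x, der setT (prim f) x (f x).
Proof.
move=> /primitive[F hF]; rewrite /prim.
by apply: (@xgetPex _ f [set F | forall x, der setT F x (f x)]); exists F.
Qed.

(* The average of [f'] over [[x - h, x + h]] with the weight [3 (h - |s|)^2 / (2 h^3)]; writing it with two
   primitives of [f] makes it commute with differentiation. *)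
Definition avd (h : R) f (x : R) : R :=
  3 / h ^+ 3 * (prim (prim f) (x + h) - prim (prim f) (x - h) - 2 * h * prim f x).

Lemma der_addl (F : R -> R) x s l : der setT F (x + s) l -> der setT (fun s => F (x + s)) s l.
Proof.
move=> h; apply: der_eq (der_comp (A := setT) (B := setT) (f := fun s => x + s) (fun _ _ => I) _ h) _.
  by eapply der_eq; [der_t|].
by rewrite add0r mulr1.
Qed.

Lemma der_subl (F : R -> R) x s l : der setT F (x - s) l -> der setT (fun s => F (x - s)) s (- l).
Proof.
move=> h; apply: der_eq (der_comp (A := setT) (B := setT) (f := fun s => x - s) (fun _ _ => I) _ h) _.
  by eapply der_eq; [der_t|].
by rewrite add0r mulrN1.
Qed.

Lemma der_lin_cont f f' : (forall x, der setT f x (f' x)) -> continuous f.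
Proof. by move=> h x; exact: der_continuous (h x). Qed.

(** The choice of primitives does not matter: another choice changes G by an affine function, and
    G(x + h) - G(x - h) - 2 h F(x) vanishes when G is affine with derivative F. *)
Lemma avdE h f F G x : (forall x, der setT F x (f x)) -> (forall x, der setT G x (F x)) ->
  continuous f ->
  avd h f x = 3 / h ^+ 3 * (G (x + h) - G (x - h) - 2 * h * F x).
Proof.
move=> dF dG cf; have dF' := primP cf.
have cF' : continuous (prim f) by apply: der_lin_cont dF'.
have dG' := primP cF'; rewrite /avd; congr (_ * _).
have cst0 (K k : R -> R) (y z : R) : (forall x, der setT K x (k x)) -> (forall x, k x = 0) -> K y = K z.
  move=> dK k0; wlog yz : y z / y <= z.
    by move=> w; case: (leP y z) => [/w//|/ltW/w].
  by apply/esym/der0_cst => // t _; rewrite -(k0 t).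
pose c := prim f 0 - F 0.
have FE y : prim f y = F y + c.
  have : prim f y - F y = c; last by move=> <-; ring.
  apply: (@cst0 (fun y => prim f y - F y) (fun y => f y - f y)) => [t|t]; last by rewrite subrr.
  by apply: der_add => //; exact: der_opp.
have GE y z : prim (prim f) y - G y - c * y = prim (prim f) z - G z - c * z.
  apply: (@cst0 (fun y => prim (prim f) y - G y - c * y)
    (fun y => prim f y - F y - (0 * y + c * 1))) => t; last by rewrite FE; ring.
  apply: der_add; first by apply: der_add => //; exact: der_opp.
  by apply: der_opp; apply: der_mul; [exact: der_cst|exact: der_id].
have := GE (x + h) (x - h); rewrite FE; lra.
Qed.

Lemma double_mvt (K K' K'' : R -> R) (C h : R) : 0 < h ->
  (forall s, der setT K s (K' s)) -> (forall s, der setT K' s (K'' s)) ->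
  K 0 = 0 -> K' 0 = 0 -> (forall s, 0 < s < h -> `|K'' s| <= C) -> `|K h| <= C * h ^+ 2.
Proof.
move=> h0 dK dK' K0 K'0 bK.
have [c [c0 ch]] := mvt h0 (fun x _ => dK x); rewrite K0 !subr0 => ->.
have [d [d0 dc]] := mvt c0 (fun x _ => dK' x); rewrite K'0 !subr0 => ->.
rewrite !normrM (gtr0_norm h0) (gtr0_norm c0) expr2 mulrA ler_pM2r//.
by apply: ler_pM => //; [exact: ltW|apply: bK; rewrite d0 (lt_trans dc ch)|exact: ltW].
Qed.

(** An average of f' is at most [M]; the cruder factor 6 comes from using [double_mvt] in place of
    integration. *)
Lemma avd_bound h f f' (M : R) x : 0 < h -> (forall x, der setT f x (f' x)) ->
  (forall x, `|f' x| <= M) -> `|avd h f x| <= 6 * M.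
Proof.
move=> h0 df bf; have cf := der_lin_cont df; have dF := primP cf.
have dG := primP (der_lin_cont dF); rewrite /avd.
set F := prim f in dF dG *; set G := prim F in dG *.
have M0 : 0 <= M := le_trans (normr_ge0 _) (bf 0).
have : `|G (x + h) - G (x - h) - 2 * h * F x| <= 2 * M * h * h ^+ 2.
  apply: (@double_mvt (fun s => G (x + s) - G (x - s) - 2 * s * F x)
    (fun s => F (x + s) + F (x - s) - 2 * F x) (fun s => f (x + s) - f (x - s))) => //.
  - move=> s; have h1 := der_addl (dG (x + s)); have h2 := der_subl (dG (x - s)).
    by der_ring.
  - move=> s; have h1 := der_addl (dF (x + s)); have h2 := der_subl (dF (x - s)).
    by der_ring.
  - by rewrite addr0 subr0; ring.
  - by rewrite addr0 subr0; ring.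
  move=> s /andP[s0 sh]; apply: (le_trans (lip_der _ _ df bf)).
  rewrite (_ : _ - _ = 2 * s); last by ring.
  rewrite gtr0_norm ?mulr_gt0//.
  have : M * s <= M * h by rewrite ler_wpM2l// ltW.
  by lra.
rewrite normrM => b; rewrite (gtr0_norm (divr_gt0 _ (exprn_gt0 3 h0)))//.
apply: (@le_trans _ _ (3 / h ^+ 3 * (2 * M * h * h ^+ 2))).
  by rewrite ler_wpM2l// divr_ge0// exprn_ge0// ltW.
by rewrite le_eqVlt; apply/orP; left; apply/eqP; field; rewrite gt_eqF.
Qed.

Lemma avd_consistent h f f' f'' (M : R) x : 0 < h -> (forall x, der setT f x (f' x)) ->
  (forall x, der setT f' x (f'' x)) ->
  (forall x, `|f'' x| <= M) -> `|avd h f x - f' x| <= 6 * M * h.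
Proof.
move=> h0 df df' bf; have cf := der_lin_cont df; have dF := primP cf.
have dG := primP (der_lin_cont dF); rewrite /avd.
set F := prim f in dF dG *; set G := prim F in dG *.
have M0 : 0 <= M := le_trans (normr_ge0 _) (bf 0).
have : `|G (x + h) - G (x - h) - 2 * h * F x - f' x * h ^+ 3 / 3| <= 2 * M * h ^+ 2 * h ^+ 2.
  apply: (@double_mvt (fun s => G (x + s) - G (x - s) - 2 * s * F x - f' x * s ^+ 3 / 3)
    (fun s => F (x + s) + F (x - s) - 2 * F x - f' x * s ^+ 2)
    (fun s => f (x + s) - f (x - s) - 2 * s * f' x)) => //.
  - move=> s; have h1 := der_addl (dG (x + s)); have h2 := der_subl (dG (x - s)).
    by eapply der_eq; [der_t|rewrite /=; field].
  - move=> s; have h1 := der_addl (dF (x + s)); have h2 := der_subl (dF (x - s)).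
    by der_ring.
  - by rewrite addr0 subr0 expr0n/=; ring.
  - by rewrite addr0 subr0 expr0n/=; ring.
  move=> s /andP[s0 sh].
  have := taylor1 x (x + s) df df' bf; have := taylor1 x (x - s) df df' bf.
  have -> : x - s - x = - s by ring.
  have -> : x + s - x = s by ring.
  rewrite normrN (gtr0_norm s0) => h1 h2.
  rewrite (_ : _ - _ - _ = (f (x + s) - f x - f' x * s) - (f (x - s) - f x - f' x * - s)); last by ring.
  apply: (le_trans (ler_normB _ _)).
  have : M * s ^+ 2 <= M * h ^+ 2 by rewrite ler_wpM2l// lerXn2r// ?nnegrE ltW.
  lra.
set E := _ - _ => b.
rewrite (_ : _ - f' x = 3 / h ^+ 3 * E); last by rewrite /E; field; rewrite gt_eqF.
rewrite normrM (gtr0_norm (divr_gt0 _ (exprn_gt0 3 h0)))//.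
apply: (@le_trans _ _ (3 / h ^+ 3 * (2 * M * h ^+ 2 * h ^+ 2))).
  by rewrite ler_wpM2l// divr_ge0// exprn_ge0// ltW.
by rewrite le_eqVlt; apply/orP; left; apply/eqP; field; rewrite gt_eqF.
Qed.

Lemma avd_derE h f g F x : (forall x, der setT f x (g x)) -> (forall x, der setT F x (f x)) ->
  continuous g -> avd h g x = 3 / h ^+ 3 * (F (x + h) - F (x - h) - 2 * h * f x).
Proof. by move=> df dF cg; exact: avdE. Qed.

Lemma der_avd h f g x : (forall x, der setT f x (g x)) -> continuous g ->
  der setT (avd h f) x (avd h g x).
Proof.
move=> df cg; have dF := primP (der_lin_cont df); have dG := primP (der_lin_cont dF).
rewrite (avd_derE _ _ df dF cg) /avd.
set F := prim f in dF dG *; set G := prim F in dG *.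
have h1 := dG (x + h); have h2 := dG (x - h).
have d1 : der setT (fun y => G (y + h)) x (F (x + h)).
  have := der_addl (x := h) (s := x); rewrite [h + x]addrC => /(_ _ _ h1).
  by under eq_fun do rewrite addrC.
have d2 : der setT (fun y => G (y - h)) x (F (x - h)).
  have := der_addl (x := - h) (s := x); rewrite [- h + x]addrC => /(_ _ _ h2).
  by under eq_fun do rewrite addrC.
by der_ring.
Qed.

Lemma avd_shift h f T x : continuous f -> (forall y, f (y + T) = f y) ->
  avd h f (x + T) = avd h f x.
Proof.
move=> cf fT; have dF := primP cf; have dG := primP (der_lin_cont dF).
have sh (K k : R -> R) y : (forall y, der setT K y (k y)) -> der setT (fun y => K (y + T)) y (k (y + T)).
  move=> dK; have := der_addl (x := T) (s := y); rewrite [T + y]addrC => /(_ _ _ (dK _)).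
  by under eq_fun do rewrite addrC.
rewrite [RHS](@avdE h _ (fun y => prim f (y + T)) (fun y => prim (prim f) (y + T)))//.
- by rewrite /avd (addrAC x T h) (addrAC x T (- h)).
- by move=> y; rewrite -[f y]fT; exact: sh.
- by move=> y; exact: sh.
Qed.

(** The new value is a convex combination of values of f: weight 1 - 6 tau a / h^2 at x, and
    densities 3 tau (a + c (h - s)) / h^3 at x + s and 3 tau (a - c (h - s)) / h^3 at x - s, for s
    in [0, h]. They are nonnegative because |c| h <= a and 6 tau a <= h^2, and their total is 1. *)
Lemma avd_max h f g (M a c tau : R) x : 0 < h -> 0 <= tau -> 0 <= a -> `|c| * h <= a ->
  6 * tau * a <= h ^+ 2 -> (forall x, der setT f x (g x)) -> continuous g ->
  (forall x, `|f x| <= M) ->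
  `|f x + tau * (a * avd h g x + c * avd h f x)| <= M.
Proof.
move=> h0 t0 a0 ca ta df cg bf.
have dF := primP (der_lin_cont df); have dG := primP (der_lin_cont dF).
rewrite (avd_derE _ _ df dF cg) /avd.
set F := prim f in dF dG *; set G := prim F in dG *.
have M0 : 0 <= M := le_trans (normr_ge0 _) (bf 0).
(* An antiderivative in s of the weighted values, found by integrating by parts; one application of
   the mean value theorem to it replaces the integral. *)
pose H s := a * (F (x + s) - F (x - s)) + c * ((h - s) * (F (x + s) + F (x - s)) + (G (x + s) - G (x - s))).
pose H' s := (a + c * (h - s)) * f (x + s) + (a - c * (h - s)) * f (x - s).
have dH s : der setT H s (H' s).
  have h1 := der_addl (dG (x + s)); have h2 := der_subl (dG (x - s)).
  have h3 := der_addl (dF (x + s)); have h4 := der_subl (dF (x - s)).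
  by rewrite /H /H'; der_ring.
have [s [s0 sh HE]] := mvt h0 (fun x _ => dH x).
have bH : `|H' s| <= 2 * a * M.
  have cs : `|c * (h - s)| <= a.
    rewrite normrM (gtr0_norm (_ : 0 < h - s)) ?subr_gt0//; apply: le_trans ca.
    by rewrite ler_wpM2l//; lra.
  move: cs; rewrite ler_norml => /andP[c1 c2].
  apply: (le_trans (ler_normD _ _)); rewrite !normrM (@ger0_norm _ (a + _)) ?(@ger0_norm _ (a - _)); [|lra|lra].
  have b1 : (a + c * (h - s)) * `|f (x + s)| <= (a + c * (h - s)) * M by rewrite ler_wpM2l//; lra.
  have b2 : (a - c * (h - s)) * `|f (x - s)| <= (a - c * (h - s)) * M by rewrite ler_wpM2l//; lra.
  lra.
rewrite (_ : f x + _ = f x * (1 - 6 * tau * a / h ^+ 2) + 3 * tau / h ^+ 3 * (H h - H 0)); last first.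
  by rewrite /H !subr0 !addr0; field; rewrite gt_eqF.
rewrite HE subr0; set q := 6 * tau * a / h ^+ 2.
have q1 : q <= 1 by rewrite ler_pdivrMr ?mul1r// exprn_gt0.
have k0 : 0 <= 3 * tau / h ^+ 3 by apply: divr_ge0; [exact: mulr_ge0|apply: exprn_ge0; exact: ltW].
apply: (le_trans (ler_normD _ _)); rewrite normrM [`|_ * (_ * h)|]normrM [`|_ * h|]normrM [`|1 - q|]ger0_norm ?subr_ge0//.
rewrite (gtr0_norm h0) (ger0_norm k0).
have b1 : `|f x| * (1 - q) <= M * (1 - q) by rewrite ler_wpM2r// subr_ge0.
have b2 : 3 * tau / h ^+ 3 * (`|H' s| * h) <= 3 * tau / h ^+ 3 * (2 * a * M * h).
  by rewrite ler_wpM2l// ler_wpM2r// ltW.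
apply: (le_trans (lerD b1 b2)); rewrite le_eqVlt; apply/orP; left; apply/eqP; rewrite /q.
by field; rewrite gt_eqF.
Qed.

End average_difference.

(** * Coefficients of the transformed equation and their derivatives *)

Section coefficients.
Variables (R : realType) (g : nat -> R -> R) (eta : R).
Hypothesis dg : forall k y, `|y| < eta -> der setT (g k) y (g k.+1 y).

(* The equation for [r] is [r_t = ca r r_x * r_xx + cb r r_x]; [g k] is the k-th derivative of [g]. *)
Definition ca (r v : R) := g 0%N r * zeta v ^+ 3.
Definition ca_r (r v : R) := g 1%N r * zeta v ^+ 3.
Definition ca_v (r v : R) := - 3 * g 0%N r * v * zeta v ^+ 5.
Definition cb (r v : R) := - g 1%N r * v ^+ 2 * zeta v.
Definition cb_r (r v : R) := - g 2%N r * v ^+ 2 * zeta v.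
Definition cb_v (r v : R) := - g 1%N r * (2 * v * zeta v - v ^+ 3 * zeta v ^+ 3).

Lemma der_gcomp (B : set R) (p : R -> R) x p' k : `|p x| < eta -> der B p x p' ->
  der B (fun y => g k (p y)) x (g k.+1 (p x) * p').
Proof. by move=> px dp; apply: (der_comp (B := setT)) => //; exact: dg. Qed.

Lemma der_zcomp (B : set R) (q : R -> R) x q' : der B q x q' ->
  der B (fun y => zeta (q y)) x (- q x * zeta (q x) ^+ 3 * q').
Proof. by move=> dq; apply: (der_comp (B := setT)) => //; exact: der_zeta. Qed.

Lemma der_ca (B : set R) (p q : R -> R) x p' q' : `|p x| < eta -> der B p x p' -> der B q x q' ->
  der B (fun y => ca (p y) (q y)) x (ca_r (p x) (q x) * p' + ca_v (p x) (q x) * q').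
Proof.
move=> px dp dq; have h1 := der_gcomp 0%N px dp; have h2 := der_zcomp dq.
by rewrite /ca; eapply der_eq; [der_t|rewrite /ca_r /ca_v /=; ring].
Qed.

Lemma der_cb (B : set R) (p q : R -> R) x p' q' : `|p x| < eta -> der B p x p' -> der B q x q' ->
  der B (fun y => cb (p y) (q y)) x (cb_r (p x) (q x) * p' + cb_v (p x) (q x) * q').
Proof.
move=> px dp dq; have h1 := der_gcomp 1%N px dp; have h2 := der_zcomp dq.
by rewrite /cb; eapply der_eq; [der_t|rewrite /cb_r /cb_v /=; ring].
Qed.

End coefficients.

(** * Functions with all derivatives bounded *)

Section jets.
Variable R : realType.

Lemma der_derive1 (f : R -> R) x l : der setT f x l -> derive1 f x = l.
Proof. by move=> /der_is_derive[df <-]; rewrite derive1E. Qed.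

(** Phrased as [tame] for a one-element family, so that the calculus of families applies to single
    functions. *)
Definition nice (f : R -> R) := forall m, tame (fun _ : unit => 0) m (fun _ => f).

Lemma nice_der f g : (forall x, der setT f x (g x)) -> nice f -> nice g.
Proof.
by move=> dg nf m; apply: (@tame_der _ _ _ m (fun _ => f)); [move=> _; exact: dg|exact: nf].
Qed.

Lemma nice_derive1 f : nice f -> (forall x, der setT f x (derive1 f x)) /\ nice (derive1 f).
Proof.
move=> nf; have [_ [g dg _]] := nf 1%N.
have e : derive1 f = g tt by apply/funext => x; exact: der_derive1.
by rewrite e; split=> [x|]; [exact: dg|apply: nice_der nf => x; exact: dg].
Qed.

Lemma nice_jet f : nice f -> forall k, nice (derive1n k f) /\ forall x, der setT (derive1n k f) x ((derive1n k.+1 f) x).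
Proof.
move=> nf k; elim: k f nf => [|k ih] f nf.
  by split=> // x; rewrite derive1n1; have [h _] := nice_derive1 nf; exact: h.
by have [_ /ih[h1 h2]] := nice_derive1 nf; rewrite !(derive1Sn f).
Qed.

Lemma nice_bounded f : nice f -> exists C, forall x, `|f x| <= C.
Proof. by move=> /(_ 1%N)[[C hC] _]; exists C => x; exact: (hC tt). Qed.

Lemma tame_jet (J : Type) (N : J -> R) m (W : J -> nat -> R -> R) :
  (forall i k x, der setT (W i k) x (W i k.+1 x)) ->
  (forall k, (k < m)%N -> bdd (fun i => W i k)) ->
  (exists C, forall i x, `|W i m x| <= C * (1 + N i)) -> tame N m (fun i => W i 0%N).
Proof.
elim: m W => [//|m ih] W dW bW tW; split; first exact: bW.
exists (fun i => W i 1%N); first by move=> i x; exact: dW.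
apply: (ih (fun i k => W i k.+1)) => //.
by move=> k km; exact: bW.
Qed.

Lemma jet_nice (W : nat -> R -> R) : (forall k x, der setT (W k) x (W k.+1 x)) ->
  (forall k, exists C, forall x, `|W k x| <= C) -> nice (W 0%N).
Proof.
move=> dW bW m; apply: (@tame_jet unit _ m (fun _ => W)) => //.
  by move=> k _; have [C hC] := bW k; exists C.
by have [C hC] := bW m; exists C => _ x; rewrite addr0 mulr1.
Qed.

Lemma jet_uniq (f : R -> R) (W : nat -> R -> R) : W 0%N = f ->
  (forall k x, der setT (W k) x (W k.+1 x)) -> forall k, derive1n k f = W k.
Proof.
move=> <- dW; elim=> // k ih; rewrite derive1nS ih.
by apply/funext => x; exact: der_derive1.
Qed.

End jets.

(** * Structure of the space derivatives of the right-hand side *)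

Section expansion.
Variables (R : realType) (g : nat -> R -> R) (eta A : R).
Hypothesis dg : forall k y, `|y| < eta -> der setT (g k) y (g k.+1 y).
Hypothesis Aeta : A < eta.
Hypothesis bg : forall k, exists C, forall y, `|y| <= A -> `|g k y| <= C.
Variables (J : Type) (N : J -> R) (u V : J -> nat -> R -> R) (l : nat).
Hypothesis N0 : forall i, 0 <= N i.
Hypothesis du : forall i k x, der setT (u i k) x (u i k.+1 x).
Hypothesis dV : forall i k x, der setT (V i k) x (V i k.+1 x).
Hypothesis uA : forall i x, `|u i 0%N x| <= A.
Hypothesis tu0 : tame N l.+1 (fun i => u i 0%N).
Hypothesis tV0 : tame N l (fun i => V i 0%N).

Let tj (W : J -> nat -> R -> R) m k : (forall i k x, der setT (W i k) x (W i k.+1 x)) ->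
  tame N m (fun i => W i 0%N) -> (k <= m)%N -> tame N (m - k) (fun i => W i k).
Proof.
move=> dW tW; elim: k => [|k ih] km; first by rewrite subn0.
apply: (@tame_der _ _ N _ (fun i => W i k)); first by move=> i x; exact: dW.
by rewrite -subSn//= subSS; apply: ih; exact: ltnW.
Qed.

Lemma tame_u k : (k <= l.+1)%N -> tame N (l.+1 - k) (fun i => u i k).
Proof. exact: tj. Qed.

Lemma tame_V k : (k <= l)%N -> tame N (l - k) (fun i => V i k).
Proof. exact: tj. Qed.

Let tg k : (0 < l)%N -> tame N l (fun i x => g k (u i 0%N x)).
Proof.
by move=> l0; apply: (@tame_comp _ _ N N0 g A eta) => //; exact: tameS.
Qed.

Let tz n : (0 < l)%N -> tame N l (fun i x => zeta (V i 0%N x) ^+ n).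
Proof. by case: l tV0 => // m tv _; apply: tame_exp => //; exact: tame_zeta. Qed.

Let tv n : (0 < l)%N -> tame N l (fun i x => V i 0%N x ^+ n).
Proof. by case: l tV0 => // m tv' _; exact: tame_exp. Qed.

(** [V] is the jet of the averaged slope in the scheme and the jet [u k.+1] of the exact slope in
    the regularity estimates; one expansion serves both. *)
Definition rhs i x := ca g (u i 0%N x) (V i 0%N x) * V i 1%N x + cb g (u i 0%N x) (V i 0%N x).

Lemma tame_coefs : (0 < l)%N -> [/\ tame N l (fun i x => ca g (u i 0%N x) (V i 0%N x)),
  tame N l (fun i x => ca_r g (u i 0%N x) (V i 0%N x)),
  tame N l (fun i x => ca_v g (u i 0%N x) (V i 0%N x)),
  tame N l (fun i x => cb_r g (u i 0%N x) (V i 0%N x)) &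
  tame N l (fun i x => cb_v g (u i 0%N x) (V i 0%N x))].
Proof.
move=> l0; have h0 := tg 0%N l0; have h1 := tg 1%N l0; have h2 := tg 2%N l0.
have z1 := tz 1%N l0; have z3 := tz 3%N l0; have z5 := tz 5%N l0.
have v1 := tv 1%N l0; have v2 := tv 2%N l0; have v3 := tv 3%N l0.
have cst c : tame N l (fun _ _ => c) by exact: tame_cst.
case: l l0 h0 h1 h2 z1 z3 z5 v1 v2 v3 cst => // m _ h0 h1 h2 z1 z3 z5 v1 v2 v3 cst.
have M := @tame_mulS _ _ N N0 m; have O := @tame_opp _ _ N m.+1.
rewrite /ca /ca_r /ca_v /cb_r /cb_v; split.
- exact: M.
- exact: M.
- by apply: (M) => //; apply: (M) => //; apply: (M).
- by apply: (M) => //; apply: (M) => //; exact: O.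
- apply: (M); first exact: O.
  apply: tame_add; first by apply: (M) => //; apply: (M).
  by apply: O; exact: M.
Qed.

Lemma tame_cb : (0 < l)%N -> tame N l (fun i x => cb g (u i 0%N x) (V i 0%N x)).
Proof.
move=> l0; have h1 := tg 1%N l0; have z1 := tz 1%N l0; have v2 := tv 2%N l0.
case: l l0 h1 z1 v2 => // m _ h1 z1 v2.
by apply: tame_mulS => //; apply: tame_mulS => //; exact: tame_opp.
Qed.

Lemma tame_rhs : (0 < l)%N -> tame N l.-1 rhs.
Proof.
move=> l0; have [t0 _ _ _ _] := tame_coefs l0; have t1 := tame_cb l0.
have := tame_V l0; rewrite subn1; case: l l0 t0 t1 => // m _ t0 t1 /= tV.
by apply: tame_add; [exact: tame_mulr|exact: tameS].
Qed.

Hypothesis l2 : (2 <= l)%N.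

Lemma der_rhs i x : der setT (rhs i) x
  (let r := u i 0%N x in let v := V i 0%N x in let gam := ca_r g r v * u i 1%N x + ca_v g r v * V i 1%N x in
   ca g r v * V i 2%N x + (gam + cb_v g r v) * V i 1%N x + cb_r g r v * u i 1%N x).
Proof.
have ux : `|u i 0%N x| < eta by exact: le_lt_trans (uA _ _) _.
have h1 := der_ca dg ux (du i 0%N x) (dV i 0%N x).
have h2 := der_cb dg ux (du i 0%N x) (dV i 0%N x).
have h3 := dV i 1%N x.
by rewrite /rhs; der_ring.
Qed.

(** Only the factor V_1 next to [ca] produces the top order V_(j+1); the terms in V_j are collected
    in a bounded coefficient [c], and the remainder [S] is at most linear in [N]. From j = 3 on, the
    derivative of [c] multiplies a derivative of V, and for l = 2 both may grow with [N]: this is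
    the reason for the trichotomy. *)
Lemma rhs_expand (FJ : J -> nat -> R -> R) :
  (forall i, FJ i 0%N = rhs i) -> (forall i k x, der setT (FJ i k) x (FJ i k.+1 x)) ->
  forall j, (0 < j <= l.+1)%N -> [\/ (2 < l)%N, bdd (fun i _ => N i) | (j <= 2)%N] ->
  exists c, exists2 S, tame N l.-1 c /\ tame N (l.+1 - j) S &
    forall i x, FJ i j x = ca g (u i 0%N x) (V i 0%N x) * V i j.+1 x + c i x * V i j x + S i x.
Proof.
move=> FJ0 dF; have l0 : (0 < l)%N by exact: leq_trans l2.
have [t0 t1 t2 t3 t4] := tame_coefs l0.
have l1 : l = l.-1.+1 by case: l l0.
have l1' : l.-1 = l.-2.+1 by case: l l2 => [//|[//|]].
pose gam i x := ca_r g (u i 0%N x) (V i 0%N x) * u i 1%N x + ca_v g (u i 0%N x) (V i 0%N x) * V i 1%N x.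
have S m f : tame N m.+1 f -> tame N m f by exact: tameS.
have tl f : tame N l f -> tame N l.-1 f by rewrite {1}l1; exact: tameS.
have tu1 : tame N l (fun i => u i 1%N) by have := @tame_u 1%N isT; rewrite subn1.
have tu2 : tame N l.-1 (fun i => u i 2%N).
  by rewrite (_ : l.-1 = l.+1 - 2)%N; [apply: tame_u; exact: leqW|rewrite subSS subn1].
have tV1 : tame N l.-1 (fun i => V i 1%N) by have := @tame_V 1%N l0; rewrite subn1.
have tgam : tame N l.-1 gam.
  apply: tame_add; first by apply: tl; rewrite l1; apply: tame_mulS; rewrite -?l1.
  by rewrite l1'; apply: tame_mulS; rewrite -?l1' //; exact: tl.
have F1 i x : FJ i 1%N x = ca g (u i 0%N x) (V i 0%N x) * V i 2%N x
    + (gam i x + cb_v g (u i 0%N x) (V i 0%N x)) * V i 1%N x + cb_r g (u i 0%N x) (V i 0%N x) * u i 1%N x.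
  by apply: der_uniqT (dF i 0%N x) _; rewrite FJ0; exact: der_rhs.
have dca i x : der setT (fun x => ca g (u i 0%N x) (V i 0%N x)) x (gam i x).
  by apply: (der_ca dg); [exact: le_lt_trans (uA _ _) _|exact: du|exact: dV].
have D f : tame N l f -> exists2 f', (forall i x, der setT (f i) x (f' i x)) & tame N l.-1 f'.
  by rewrite {1}l1 => -[].
case=> // -[_ _|j]; first (exists (fun i x => gam i x + cb_v g (u i 0%N x) (V i 0%N x));
  exists (fun i x => cb_r g (u i 0%N x) (V i 0%N x) * u i 1%N x); [split|by move=> i x; rewrite F1]).
- by apply: tame_add => //; exact: tl.
- by rewrite subSS subn0 l1; apply: tame_mulS; rewrite -?l1.
(* At j = 2 the remainder must keep l - 1 orders, so the product of V_2, coming from the derivative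
   of [gam], with V_1 cannot stay in it; it joins the coefficient of V_2. *)
elim: j => [_ _|j ih jl l3].
  have [ar' dar tar] := D _ t1; have [av' dav tav] := D _ t2.
  have [bv' dbv tbv] := D _ t4.
  have tbu : tame N l (fun i x => cb_r g (u i 0%N x) (V i 0%N x) * u i 1%N x).
    by rewrite l1; apply: tame_mulS; rewrite -?l1.
  have [bu' dbu tb] := D _ tbu.
  exists (fun i x => 2 * gam i x + cb_v g (u i 0%N x) (V i 0%N x) + ca_v g (u i 0%N x) (V i 0%N x) * V i 1%N x).
  exists (fun i x => (ar' i x * u i 1%N x + ca_r g (u i 0%N x) (V i 0%N x) * u i 2%N x + av' i x * V i 1%N x
    + bv' i x) * V i 1%N x + bu' i x).
    have M f h : tame N l.-1 f -> tame N l.-1 h -> tame N l.-1 (fun i x => f i x * h i x).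
      by rewrite l1'; exact: tame_mulS.
    split.
      apply: tame_add; last by apply: (M) => //; exact: tl.
      by apply: tame_add; [apply: (M) => //; exact: tame_cst|exact: tl].
    rewrite subSS subn1; apply: tame_add => //; apply: (M) => //; apply: tame_add => //.
    apply: tame_add; last by apply: (M).
    by apply: tame_add; apply: (M) => //; exact: tl.
  move=> i x; apply: der_uniqT (dF i 1%N x) _.
  have -> : FJ i 1%N = (fun x => ca g (u i 0%N x) (V i 0%N x) * V i 2%N x
    + (ca_r g (u i 0%N x) (V i 0%N x) * u i 1%N x + ca_v g (u i 0%N x) (V i 0%N x) * V i 1%N x
      + cb_v g (u i 0%N x) (V i 0%N x)) * V i 1%N x + cb_r g (u i 0%N x) (V i 0%N x) * u i 1%N x).
    by apply/funext => y; exact: F1.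
  have h1 := dca i x; have h2 := dar i x; have h3 := dav i x; have h4 := dbv i x; have h5 := dbu i x.
  have h6 := du i 1%N x; have h7 := dV i 1%N x; have h8 := dV i 2%N x.
  have h9 := der_mul h2 h6; have h10 := der_mul h3 h7; have h11 := der_mul (der_add (der_add h9 h10) h4) h7.
  by apply: der_eq (der_add (der_add (der_mul h1 h8) h11) h5) _; rewrite /gam; ring.
have [||c [Sj [tc tS] FE]] := ih; first by rewrite (ltnW jl).
  by case: l3 => [l3|bN|//]; [apply: Or31|apply: Or32].
have [c' dc tc'] : exists2 c', (forall i x, der setT (c i) x (c' i x)) & tame N l.-2 c'.
  by move: tc; rewrite l1' => -[].
have jl' : (j.+2 <= l)%N by move: jl => /andP[_].
have e1 : (l.+1 - j.+2)%N = (l - j.+2).+1 by rewrite subSn.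
have [S' dS tS'] : exists2 S', (forall i x, der setT (Sj i) x (S' i x)) & tame N (l - j.+2) S'.
  by move: tS; rewrite e1 => -[].
have tVj := tame_V jl'.
exists (fun i x => c i x + gam i x); exists (fun i x => c' i x * V i j.+2 x + S' i x).
  split; first exact: tame_add.
  rewrite subSS; apply: tame_add => //.
  case: l3 => [l3|bN|//].
    case: (posnP j) => [j0|j0].
      have e2 : l.-2 = (l - 3).+1 by rewrite -subn2 -[in RHS]subSn// subSS.
      by move: tVj; rewrite j0 subn2 e2 => tVj; apply: tame_mulS => //; rewrite -e2.
    apply: (tame_mulr N0) tVj; apply: tame_le tc' => //.
    by rewrite -subn2 -(subSn jl') -(prednK j0) !subSS leq_sub2l.
  apply: (tame_mul_bdd N0 bN) tVj; apply: tame_le tc' => //.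
  by rewrite -subn2 leq_sub2l.
move=> i x; apply: der_uniqT (dF i j.+2 x) _.
have -> : FJ i j.+2 = (fun x => ca g (u i 0%N x) (V i 0%N x) * V i j.+3 x + c i x * V i j.+2 x + Sj i x).
  by apply/funext => y; exact: FE.
have h1 := dca i x; have h2 := dc i x; have h3 := dS i x; have h4 := dV i j.+2 x; have h5 := dV i j.+3 x.
by apply: der_eq (der_add (der_add (der_mul h1 h5) (der_mul h2 h4)) h3) _; ring.
Qed.

End expansion.

(* One explicit Euler step of the equation in which [r_x] and [r_xx] are replaced by averages at scale [h].
   When [tau] is small compared to [h^2] such a step does not increase the sup norm of any derivative, up to
   lower order terms, so no linear theory is needed for existence. *)
Section scheme.
Variables (R : realType) (g : nat -> R -> R) (eta A : R).
Hypothesis dg : forall k y, `|y| < eta -> der setT (g k) y (g k.+1 y).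
Hypothesis Aeta : A < eta.
Hypothesis A0 : 0 <= A.
Hypothesis bg : forall k, exists C, forall y, `|y| <= A -> `|g k y| <= C.
Variables (gmin gmax : R).
Hypothesis gmin0 : 0 < gmin.
Hypothesis ming : forall y, `|y| <= A -> gmin <= g 0%N y.
Hypothesis maxg : forall y, `|y| <= A -> g 0%N y <= gmax.

Definition avj (h : R) (r : R -> R) (k : nat) : R -> R := avd h (derive1n k r).

Definition srhs (h : R) (r : R -> R) (x : R) :=
  ca g (r x) (avj h r 0%N x) * avj h r 1%N x + cb g (r x) (avj h r 0%N x).

Definition step (h tau : R) (r : R -> R) (x : R) := r x + tau * srhs h r x.

Lemma nice_cont (f : R -> R) : nice f -> continuous f.
Proof. by move=> /nice_derive1[h _]; exact: der_lin_cont h. Qed.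

Lemma der_avj h r k x : nice r -> der setT (avj h r k) x (avj h r k.+1 x).
Proof.
move=> nr; apply: der_avd; first by move=> y; have [_] := nice_jet nr k; exact.
by apply: nice_cont; have [] := nice_jet nr k.+1.
Qed.

Lemma avj_bound h r k M x : 0 < h -> nice r -> (forall x, `|derive1n k.+1 r x| <= M) ->
  `|avj h r k x| <= 6 * M.
Proof. by move=> h0 nr; apply: avd_bound => // y; have [_] := nice_jet nr k; exact. Qed.

Lemma nice_avj h r : 0 < h -> nice r -> nice (avj h r 0%N).
Proof.
move=> h0 nr; apply: jet_nice => [k x|k]; first exact: der_avj.
have [nk _] := nice_jet nr k.+1; have [C hC] := nice_bounded nk.
by exists (6 * C) => x; exact: avj_bound.
Qed.

Lemma nice_srhs h r : 0 < h -> nice r -> (forall x, `|r x| <= A) -> nice (srhs h r).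
Proof.
move=> h0 nr rA m.
apply: (@tame_rhs R g eta A dg Aeta bg unit (fun=> 0) (fun _ k => derive1n k r) (fun _ => avj h r) m.+1) => //.
- by move=> _ k x; exact: der_avj.
- exact: nice_avj.
Qed.

Lemma step_jet h tau r j x : 0 < h -> nice r -> (forall x, `|r x| <= A) ->
  derive1n j (step h tau r) x = derive1n j r x + tau * derive1n j (srhs h r) x.
Proof.
move=> h0 nr rA; have ns := nice_srhs h0 nr rA.
rewrite (@jet_uniq _ (step h tau r) (fun j x => derive1n j r x + tau * derive1n j (srhs h r) x))//.
move=> k y; apply: der_add; first by have [_] := nice_jet nr k; exact.
by apply: der_scale; have [_] := nice_jet ns k; exact.
Qed.

Lemma nice_step h tau r : 0 < h -> nice r -> (forall x, `|r x| <= A) -> nice (step h tau r).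
Proof.
move=> h0 nr rA m; have ns := nice_srhs h0 nr rA.
apply: tame_add; first exact: nr.
have := @tame_mulS _ unit (fun=> 0) (fun=> lexx _) m _ _ (@tame_cst _ unit (fun=> 0) (fun=> lexx _) m.+1 tau) (ns m.+1).
exact: tameS.
Qed.

Lemma zeta_mono (v w : R) : `|v| <= w -> zeta w <= zeta v.
Proof.
move=> vw; rewrite /zeta lef_pV2 ?posrE ?sqrtr_gt0 ?sqr1p_gt0// ler_wsqrtr// lerD2l.
by rewrite -[v ^+ 2]real_normK ?num_real// lerXn2r// ?nnegrE (le_trans _ vw).
Qed.

Lemma ca_bounds r v w : `|r| <= A -> `|v| <= w -> gmin * zeta w ^+ 3 <= ca g r v <= gmax.
Proof.
move=> rA vw; have z0 := zeta_gt0 v; have zw := zeta_gt0 w.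
have g0 := ming rA; have g1 := maxg rA.
rewrite /ca; apply/andP; split.
  apply: ler_pM => //; rewrite ?exprn_ge0 ?(ltW zw) ?(ltW gmin0)//.
  by rewrite lerXn2r ?nnegrE ?(ltW z0) ?(ltW zw)// zeta_mono.
apply: le_trans g1; rewrite ler_piMr ?(le_trans (ltW gmin0))//.
by rewrite exprn_ile1 ?(ltW z0)// zeta_le1.
Qed.

(** [cb] carries a factor V_0, so the right-hand side is an average of r'' with weight [ca] plus an
    average of r' with a coefficient bounded through |v zeta v| <= 1, and [avd_max] applies without
    remainder. The range thus stays in [- A, A], where the bounds on [g] hold. *)
Lemma step_max B : 0 <= B -> exists2 h1, 0 < h1 & forall h tau r, 0 < h <= h1 -> 0 <= tau ->
  6 * tau * gmax <= h ^+ 2 -> nice r -> (forall x, `|r x| <= A) ->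
  (forall x, `|derive1n 1 r x| <= B) -> forall x, `|step h tau r x| <= A.
Proof.
move=> B0; have [C hC] := bg 1%N; pose am := gmin * zeta (6 * B) ^+ 3.
have am0 : 0 < am by rewrite mulr_gt0// exprn_gt0// zeta_gt0.
have C1 : 0 < `|C| + 1 by rewrite ltr_wpDl.
(* For h below this value the first order coefficient times h is at most the lower bound [am] of
   [ca], as [avd_max] demands. *)
exists (am / (`|C| + 1)); first exact: divr_gt0.
move=> h tau r /andP[h0 hh] t0 ht nr rA rB x.
have vB : `|avj h r 0%N x| <= 6 * B by exact: avj_bound.
have /andP[a1 a2] := ca_bounds (rA x) vB.
have rx := rA x.
rewrite /step /srhs.
have -> : cb g (r x) (avj h r 0%N x) =
    (- g 1%N (r x) * (avj h r 0%N x * zeta (avj h r 0%N x))) * avj h r 0%N x by rewrite /cb; ring.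
apply: avd_max => //.
- by apply: le_trans a1; exact: ltW.
- apply: le_trans a1; rewrite -/am normrM normrN.
  apply: (@le_trans _ _ ((`|C| + 1) * h)); last by rewrite mulrC -ler_pdivlMr.
  rewrite ler_pM2r// -[X in _ <= X]mulr1; apply: ler_pM => //; last exact: norm_vzeta.
  by apply: (le_trans (hC _ rx)); rewrite ler_wpDr// ler_norm.
- by apply: le_trans ht; rewrite ler_wpM2l// mulr_ge0.
- by move=> y; have [_] := nice_jet nr 0%N; exact.
- by apply: nice_cont; have [] := nice_jet nr 1%N.
Qed.

(** By [rhs_expand] the j-th derivative of the step splits into a part controlled by [avd_max],
    which adds nothing to [M], and tau times the remainder. For l = 2 the highest derivative must
    itself be bounded by [B]; from l = 3 on it enters linearly. *)
Lemma step_est l j B : (2 <= l)%N -> (0 < j <= l.+1)%N -> 0 <= B ->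
  exists C h1, [/\ 0 < C, 0 < h1 & forall h tau r N M, 0 < h <= h1 -> 0 <= tau ->
    6 * tau * gmax <= h ^+ 2 -> nice r -> (forall x, `|r x| <= A) ->
    (forall k x, (0 < k <= l)%N -> `|derive1n k r x| <= B) ->
    (forall x, `|derive1n l.+1 r x| <= N) -> ((2 < l)%N \/ N <= B) ->
    (forall x, `|derive1n j r x| <= M) ->
    forall x, `|derive1n j (step h tau r) x| <= M + tau * (C * (1 + N))].
Proof.
move=> l2 jl B0.
(* All admissible triples (h, r, N) form one family, so the constants supplied by [tame] depend on
   none of them. *)
pose P (p : R * (R -> R) * R) := let: (h, r, N) := p in
  [/\ 0 < h, nice r, (forall x, `|r x| <= A),
   (forall k x, (0 < k <= l)%N -> `|derive1n k r x| <= B) &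
   (forall x, `|derive1n l.+1 r x| <= N) /\ ((2 < l)%N \/ N <= B)].
pose J := {p | P p}.
pose hh (i : J) := (projT1 i).1.1; pose rr (i : J) := (projT1 i).1.2; pose NN (i : J) := (projT1 i).2.
have PJ i : P (hh i, rr i, NN i) by rewrite /hh /rr /NN; case: i => [[[h r] N] p].
pose u (i : J) k := derive1n k (rr i); pose V (i : J) k := avj (hh i) (rr i) k.
have du i k x : der setT (u i k) x (u i k.+1 x).
  by have [_ nr _ _ _] := PJ i; have [_] := nice_jet nr k; exact.
have dV i k x : der setT (V i k) x (V i k.+1 x) by have [_ nr _ _ _] := PJ i; exact: der_avj.
have uA i x : `|u i 0%N x| <= A by have [_ _ rA _ _] := PJ i; exact: rA.
have NN0 i : 0 <= NN i.
  by have [_ _ _ _ [h _]] := PJ i; exact: le_trans (normr_ge0 _) (h 0).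
have ub k : (k < l.+1)%N -> bdd (fun i => u i k).
  case: k => [_|k kl]; first by exists A.
  by exists B => i x; have [_ _ _ h _] := PJ i; exact: h.
have ul : exists C, forall i x, `|u i l.+1 x| <= C * (1 + NN i).
  exists 1 => i x; have [_ _ _ _ [h _]] := PJ i; rewrite mul1r.
  by apply: (le_trans (h x)); rewrite lerDr.
have tu0 : tame NN l.+1 (fun i => u i 0%N) by exact: tame_jet.
have vb k i x C : (forall x, `|u i k.+1 x| <= C) -> `|V i k x| <= 6 * C.
  by have [h0 nr _ _ _] := PJ i; exact: avj_bound.
have tV0 : tame NN l (fun i => V i 0%N).
  apply: tame_jet => // [k kl|]; first by have [C hC] := ub k.+1 kl; exists (6 * C) => i x; exact: vb.
  by have [C hC] := ul; exists (6 * C) => i x; rewrite -mulrA; exact: vb.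
have nF i : nice (srhs (hh i) (rr i)) by have [h0 nr rA _ _] := PJ i; exact: nice_srhs.
have l3 : [\/ (2 < l)%N, bdd (fun i (_ : R) => NN i) | (j <= 2)%N].
  have [l3|l3] := ltnP 2 l; [exact: Or31|apply: Or32].
  exists B => i _; have [_ _ _ _ [_ [|]]] := PJ i; first by rewrite ltnNge l3.
  by rewrite ger0_norm.
have [|i k x|c [S [tc tS] FE]] := @rhs_expand R g eta A dg Aeta bg J NN u V l NN0 du dV uA tu0 tV0 l2
  (fun i k => derive1n k (srhs (hh i) (rr i))) _ _ j jl l3; first by [].
  by have [_] := nice_jet (nF i) k; exact.
have [C1 hC1] : bdd c by have := tc; rewrite -[l.-1]prednK ?subn1 -?subn1 ?subn_gt0// => -[].
have [C hC] : tame NN 0 S by exact: tame_le tS.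
pose am := gmin * zeta (6 * B) ^+ 3.
have am0 : 0 < am by rewrite mulr_gt0// exprn_gt0// zeta_gt0.
have C1p : 0 < `|C1| + 1 by rewrite ltr_wpDl.
exists (`|C| + 1), (am / (`|C1| + 1)); split; [by rewrite ltr_wpDl|exact: divr_gt0|].
move=> h tau r N M /andP[h0 hh1] t0 ht nr rA rB rN lN rM x.
have p : P (h, r, N) by [].
pose i : J := exist _ _ p.
have N0 := NN0 i; rewrite /NN/= in N0.
rewrite step_jet//.
have := FE i x; rewrite /= /hh /rr /= => ->.
have vB : `|avj h r 0%N x| <= 6 * B.
  by apply: avj_bound => // y; apply: rB; rewrite (leq_trans _ l2).
have /andP[a1 a2] := ca_bounds (rA x) vB.
have -> : derive1n j r x + tau * (ca g (u i 0%N x) (V i 0%N x) * V i j.+1 x + c i x * V i j x + S i x) =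
  (derive1n j r x + tau * (ca g (r x) (avj h r 0%N x) * avj h r j.+1 x + c i x * avj h r j x)) + tau * S i x.
  by rewrite /u /V /hh /rr/=; ring.
apply: (le_trans (ler_normD _ _)); apply: lerD; last first.
  rewrite normrM ger0_norm// ler_wpM2l//; apply: (le_trans (hC i x)).
  by rewrite ler_wpM2r ?addr_ge0// ler_wpDr// ler_norm.
apply: avd_max => //.
- by apply: le_trans a1; exact: ltW.
- apply: le_trans a1; rewrite -/am.
  apply: (@le_trans _ _ ((`|C1| + 1) * h)); last by rewrite mulrC -ler_pdivlMr.
  by rewrite ler_pM2r//; apply: (le_trans (hC1 _ _)); rewrite ler_wpDr// ler_norm.
- by apply: le_trans ht; rewrite ler_wpM2l// mulr_ge0.
- by move=> y; have [_] := nice_jet nr j; exact.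
- by apply: nice_cont; have [] := nice_jet nr j.+1.
Qed.

(** The increments of the scheme are tau times derivatives of [srhs]; this bound makes every space
    derivative Lipschitz in time, uniformly in h. *)
Lemma srhs_bound l B : (0 < l)%N -> 0 <= B -> exists C, forall h r, 0 < h ->
    nice r -> (forall x, `|r x| <= A) ->
    (forall k x, (0 < k <= l.+1)%N -> `|derive1n k r x| <= B) ->
    forall j x, (j.+1 < l)%N -> `|derive1n j (srhs h r) x| <= C.
Proof.
move=> l0 B0.
pose P (p : R * (R -> R)) := let: (h, r) := p in
  [/\ 0 < h, nice r, (forall x, `|r x| <= A) &
   (forall k x, (0 < k <= l.+1)%N -> `|derive1n k r x| <= B)].
pose J := {p | P p}.
pose hh (i : J) := (projT1 i).1; pose rr (i : J) := (projT1 i).2; pose NN (i : J) := (0 : R).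
have PJ i : P (hh i, rr i) by rewrite /hh /rr; case: i => [[h r] p].
pose u (i : J) k := derive1n k (rr i); pose V (i : J) k := avj (hh i) (rr i) k.
have du i k x : der setT (u i k) x (u i k.+1 x).
  by have [_ nr _ _] := PJ i; have [_] := nice_jet nr k; exact.
have dV i k x : der setT (V i k) x (V i k.+1 x) by have [_ nr _ _] := PJ i; exact: der_avj.
have uA i x : `|u i 0%N x| <= A by have [_ _ rA _] := PJ i; exact: rA.
have ub k : (k <= l.+1)%N -> bdd (fun i => u i k).
  case: k => [_|k kl]; first by exists A.
  by exists B => i x; have [_ _ _ h] := PJ i; exact: h.
have tu0 : tame NN l.+1 (fun i => u i 0%N).
  apply: tame_jet => // [k kl|]; first by apply: ub; exact: ltnW.
  by have [C hC] := ub l.+1 (leqnn _); exists C => i x; rewrite addr0 mulr1.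
have vb k : (k <= l)%N -> bdd (fun i => V i k).
  move=> kl; have [C hC] := ub k.+1 kl; exists (6 * C) => i x.
  by have [h0 nr _ _] := PJ i; exact: (avj_bound _ h0 nr (hC i)).
have tV0 : tame NN l (fun i => V i 0%N).
  apply: tame_jet => // [k kl|]; first by apply: vb; exact: ltnW.
  by have [C hC] := vb l (leqnn _); exists C => i x; rewrite addr0 mulr1.
have tF : tame NN l.-1 (fun i => srhs (hh i) (rr i)).
  by apply: (@tame_rhs R g eta A dg Aeta bg J NN u V l) => // i; rewrite /NN.
have nF i : nice (srhs (hh i) (rr i)) by have [h0 nr rA _] := PJ i; exact: nice_srhs.
have bF j : (j.+1 < l)%N -> bdd (fun i => derive1n j (srhs (hh i) (rr i))).
  move=> jl; have : tame NN (l.-1 - j) (fun i => derive1n j (srhs (hh i) (rr i))).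
    elim: j jl => [|j ih] jl; first by rewrite subn0.
    apply: (@tame_der _ _ NN _ (fun i => derive1n j (srhs (hh i) (rr i)))).
      by move=> i x; have [_] := nice_jet (nF i) j; exact.
    by rewrite -subSn ?subSS; [apply: ih; exact: ltnW|rewrite -ltnS prednK// ltnW// ltnW].
  have -> : (l.-1 - j)%N = (l.-1 - j).-1.+1 by rewrite prednK// subn_gt0 -ltnS prednK.
  by case.
have [C hC] : exists C, forall j i x, (j.+1 < l)%N -> `|derive1n j (srhs (hh i) (rr i)) x| <= C.
  have : forall n, exists C, forall j i x, (j < n)%N -> (j.+1 < l)%N -> `|derive1n j (srhs (hh i) (rr i)) x| <= C.
    elim=> [|n [C hC]]; first by exists 0.
    have [nl|nl] := ltnP n.+1 l; last first.
      exists C => j i x; rewrite ltnS leq_eqVlt => /orP[/eqP->|jn jl]; last exact: hC.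
      by rewrite ltnNge nl.
    have [D hD] := bF _ nl; exists (Num.max C D) => j i x; rewrite ltnS leq_eqVlt le_max.
    by move=> /orP[/eqP->|jn] jl; apply/orP; [right; exact: hD|left; exact: hC].
  by move=> /(_ l)[C hC]; exists C => j i x jl; apply: hC => //; exact: ltnW.
exists C => h r h0 nr rA rB j x jl.
have p : P (h, r) by [].
by have := hC j (exist _ _ p) x jl.
Qed.

End scheme.

(* Passing to the limit along an ultrafilter makes all limits exist at once and replaces compactness in
   function spaces. *)
Section ultralimit.
Variables (R : realType) (U : set_system nat).
Hypothesis UU : UltraFilter U.
Hypothesis U_oo : \oo `<=` U.

Lemma ultra_cvg (s : nat -> R) (C : R) : (\forall j \near U, `|s j| <= C) ->
  exists l : R, s @ U --> l.
Proof.
move=> bs; have cK := @segment_compact R (- C) C.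
have sK : (s @ U) `[- C, C]%classic.
  by apply: filterS bs => j /=; rewrite in_itv/= ler_norml.
have [p [_ clp]] := cK (s @ U) _ sK.
exists p => B Bp; have [//|nB] := in_ultra_setVsetC (s @^-1` B) UU.
have [y [/= yB]] := clp (~` B) B nB Bp.
by [].
Qed.

Definition ulim (s : nat -> R) : R := lim (s @ U).

Lemma ulimP (s : nat -> R) (C : R) : (\forall j \near U, `|s j| <= C) -> s @ U --> ulim s.
Proof. by move=> /ultra_cvg[l sl]; apply/cvg_ex; exists l. Qed.

Lemma near_U (P : nat -> Prop) n0 : (forall j, (n0 <= j)%N -> P j) -> \forall j \near U, P j.
Proof. by move=> h; apply: U_oo; exists n0. Qed.

Lemma cvg_U_near (s : nat -> R) (l e : R) : s @ U --> l -> 0 < e ->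
  \forall j \near U, `|s j - l| < e.
Proof. by move=> /cvgrPdist_lt h /h; apply: filterS => j; rewrite distrC. Qed.

Lemma cvg_oo_U (s : nat -> R) (l : R) : s @ \oo --> l -> s @ U --> l.
Proof. by move=> h B /h; exact: U_oo. Qed.

Lemma ule (s z : nat -> R) (a b : R) : s @ U --> a -> z @ U --> b ->
  (\forall j \near U, s j <= z j) -> a <= b.
Proof. by move=> sa zb; exact: ler_cvg_to. Qed.

End ultralimit.

(** * Elementary estimates on time grids *)

Section elementary.
Variable R : realType.

Lemma telescope_error (z : nat -> R) (tau q e : R) (a b : nat) : (a <= b)%N ->
  (forall n, (a <= n < b)%N -> `|z n.+1 - z n - tau * q| <= e * tau) ->
  `|z b - z a - (b - a)%:R * tau * q| <= e * ((b - a)%:R * tau).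
Proof.
move=> ab; rewrite -(subnK ab); elim: (b - a)%N => [|m ih] hn.
  by rewrite add0n subnn !mul0r mulr0 !subrr normr0.
have h1 : `|z (m + a).+1 - z (m + a)%N - tau * q| <= e * tau.
  by apply: hn; rewrite leq_addl addSn ltnSn.
have h2 : `|z (m + a)%N - z a - (m + a - a)%:R * tau * q| <= e * ((m + a - a)%:R * tau).
  by apply: ih => n /andP[an nm]; apply: hn; rewrite an addSn ltnS ltnW.
rewrite addSn subSn ?leq_addl// -natr1.
rewrite (_ : _ - _ - _ = (z (m + a).+1 - z (m + a)%N - tau * q) +
  (z (m + a)%N - z a - (m + a - a)%:R * tau * q)); last by ring.
by apply: (le_trans (ler_normD _ _)); lra.
Qed.

(** In the application [D] is the time between two grid points, w = s - t the true time difference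
    and [q] the expected slope. *)
Lemma slope_error (ys yt D q e tau w : R) : 0 <= e -> `|ys - yt - D * q| <= e * `|D| ->
  `|D - w| <= tau -> `|ys - yt - q * w| <= e * (`|w| + tau) + `|q| * tau + e * `|w|.
Proof.
move=> e0 h1 h2.
rewrite (_ : _ - _ = (ys - yt - D * q) + q * (D - w)); last by ring.
apply: (le_trans (ler_normD _ _)); rewrite normrM.
have h3 : `|q| * `|D - w| <= `|q| * tau by rewrite ler_wpM2l.
have h4 : `|D| <= `|w| + tau.
  rewrite (_ : D = w + (D - w)); last by ring.
  by apply: (le_trans (ler_normD _ _)); rewrite lerD2l.
have h5 : e * `|D| <= e * (`|w| + tau) by rewrite ler_wpM2l.
have h6 : 0 <= e * `|w| by rewrite mulr_ge0.
by lra.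
Qed.

Lemma dist3_lt (a b c f d : R) : 0 <= d -> `|a - b| <= d / 8 -> `|b - c| <= d / 2 ->
  `|c - f| < d / 8 -> `|a - f| < d.
Proof.
move=> d0 h1 h2 h3; rewrite (_ : a - f = (a - b) + ((b - c) + (c - f))); last by ring.
apply: (le_lt_trans (ler_normD _ _)); have := ler_normD (b - c) (c - f); lra.
Qed.

Lemma grid_gap (a c e s t tau : R) : a <= c -> e <= t < e + tau -> c <= s < c + tau ->
  a - e <= `|s - t| + tau.
Proof. by have := ler_norm (s - t); lra. Qed.

Lemma grid_gap' (a c e s t tau : R) : c <= a -> e <= t < e + tau -> c <= s < c + tau ->
  e - a <= `|s - t| + tau.
Proof. by have := ler_norm (t - s); rewrite distrC; lra. Qed.

Lemma grid_dist (c e s t tau : R) : e <= t < e + tau -> c <= s < c + tau ->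
  `|c - e - (s - t)| <= tau.
Proof. by rewrite ler_norml; lra. Qed.

End elementary.

(** * Convergence of the discrete solutions *)

Section limit.
Variables (R : realType) (X : nat -> nat -> nat -> R -> R) (tau : nat -> R) (T P : R).
Variable Q : R -> R -> R -> R.
Hypothesis tau0 : forall j, 0 < tau j.
Hypothesis tau_cvg : tau @ \oo --> (0 : R).
Hypothesis dX : forall j n k x, n%:R * tau j <= T -> der setT (X j n k) x (X j n k.+1 x).
Hypothesis bX : forall k, exists C j0, forall j n x, (j0 <= j)%N -> n%:R * tau j <= T ->
  `|X j n k x| <= C.
Hypothesis lX : forall k, exists C j0, forall j n x, (j0 <= j)%N -> n.+1%:R * tau j <= T ->
  `|X j n.+1 k x - X j n k x| <= C * tau j.
Hypothesis perX : forall j n k x, n%:R * tau j <= T -> X j n k (x + P) = X j n k x.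
Hypothesis eqX : forall e, 0 < e -> exists j0, forall j n x, (j0 <= j)%N -> n.+1%:R * tau j <= T ->
  exists v w, [/\ `|v - X j n 1%N x| < e, `|w - X j n 2%N x| < e &
    X j n.+1 0%N x - X j n 0%N x = tau j * Q (X j n 0%N x) v w].

Let bX' k : exists2 C, 0 <= C & exists j0, forall j n x, (j0 <= j)%N -> n%:R * tau j <= T ->
  `|X j n k x| <= C.
Proof.
have [C [j0 h]] := bX k; exists `|C| => //; exists j0 => j n x jj nt.
exact: le_trans (h _ _ _ jj nt) (ler_norm _).
Qed.

Let lX' k : exists2 C, 0 <= C & exists j0, forall j m n x, (j0 <= j)%N -> n%:R * tau j <= T ->
  (m <= n)%N -> `|X j n k x - X j m k x| <= C * ((n - m)%:R * tau j).
Proof.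
have [C [j0 h]] := lX k; exists `|C| => //; exists j0 => j m n x jj nt mn.
rewrite -(subnK mn) in nt *; elim: (n - m)%N nt => [|d ih] nt.
  by rewrite add0n subnn mul0r mulr0 subrr normr0.
have nt' : (d + m)%:R * tau j <= T.
  by apply: le_trans nt; rewrite ler_pM2r// ler_nat addSn leqnSn.
rewrite addSn in nt *.
rewrite (_ : _ - _ = (X j (d + m)%N k x - X j m k x) + (X j (d + m).+1 k x - X j (d + m)%N k x)); last by ring.
apply: (le_trans (ler_normD _ _)); rewrite subSn ?leq_addl// -natr1 mulrDl mulrDr mul1r.
apply: lerD; first exact: ih.
by apply: (le_trans (h _ _ _ jj nt)); rewrite ler_wpM2r ?ler_norm ?ltW.
Qed.

(** Index of the last grid time not after t: the discrete solutions are extended to all times as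
    step functions. *)
Let nn j t := Num.truncn (t / tau j).

Let nnP j t : 0 <= t -> (nn j t)%:R * tau j <= t < (nn j t)%:R * tau j + tau j.
Proof.
move=> t0; have := truncn_itv (divr_ge0 t0 (ltW (tau0 j))).
by rewrite ler_pdivlMr// ltr_pdivrMr// -natr1 mulrDl mul1r.
Qed.

(** Space derivatives survive the limit because the Taylor bounds are uniform in j. The time
    derivative is found by summing increments between t and s: by the Lipschitz bounds in time, each
    of them is within e tau / 2 of tau times the limiting right-hand side. *)
Lemma limit_exists : exists u : nat -> R -> R -> R, [/\
  forall k x t, 0 <= t <= T -> der setT (u k ^~ t) x (u k.+1 x t),
  (forall k, exists C, forall x t, 0 <= t <= T -> `|u k x t| <= C),
  (forall k, exists C, forall x t s, 0 <= t <= T -> 0 <= s <= T -> `|u k x s - u k x t| <= C * `|s - t|),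
  (forall x t, 0 <= t <= T ->
     (forall e, 0 < e -> exists2 d, 0 < d & forall r v w, `|r - u 0%N x t| < d -> `|v - u 1%N x t| < d ->
        `|w - u 2%N x t| < d -> `|Q r v w - Q (u 0%N x t) (u 1%N x t) (u 2%N x t)| <= e) ->
     der [set s | 0 <= s <= T] (u 0%N x) t (Q (u 0%N x t) (u 1%N x t) (u 2%N x t))) &
  [/\ forall k x t, 0 <= t <= T -> u k (x + P) t = u k x t,
     (forall k x (l : R), (forall j, X j 0%N k x = l) -> 0 <= T -> u k x 0 = l) &
     (forall x t (C : R), 0 <= t <= T -> (forall j n, n%:R * tau j <= T -> `|X j n 0%N x| <= C) -> `|u 0%N x t| <= C)]].
Proof.
have [U [UU U_oo]] := ultraFilterLemma (eventually_filter).
pose Y k x t j := X j (nn j t) k x.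
pose u k x t := ulim U (Y k x t).
have nT j t : 0 <= t <= T -> (nn j t)%:R * tau j <= T.
  by move=> /andP[t0 tT]; have /andP[h _] := nnP j t0; exact: le_trans h tT.
have cu k x t : 0 <= t <= T -> Y k x t @ U --> u k x t.
  move=> tT; have [C _ [j0 h]] := bX' k; apply: (@ulimP _ U UU _ C).
  by apply: (near_U U_oo (n0 := j0)) => j jj; apply: h => //; exact: nT.
have tauU : tau @ U --> (0 : R) by apply: cvg_oo_U.
have normU (s : nat -> R) (l : R) : s @ U --> l -> (fun j => `|s j|) @ U --> `|l|.
  by move=> h; apply: cvg_norm.
have cst (c : R) : (fun=> c) @ U --> c by exact: cvg_cst.
exists u; split.
- move=> k x t tT; have [C C0 [j0 h]] := bX' k.+2.
  move=> e e0; exists (e / (C + 1)); first by rewrite divr_gt0// ltr_wpDl.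
  move=> y _ yx.
  have : `|u k y t - u k x t - u k.+1 x t * (y - x)| <= C * `|y - x| ^+ 2.
    apply: (@ule _ U UU (fun j => `|Y k y t j - Y k x t j - Y k.+1 x t j * (y - x)|) (fun=> C * `|y - x| ^+ 2)).
    + apply: normU; apply: cvgB; first by apply: cvgB; exact: cu.
      by apply: cvgM; [exact: cu|exact: cst].
    + exact: cst.
    + apply: (near_U U_oo (n0 := j0)) => j jj.
      apply: taylor1 => [z|z|z]; [exact: dX (nT _ _ tT)|exact: dX (nT _ _ tT)|].
      by apply: h => //; exact: nT.
  move=> h2; apply: (le_trans h2); rewrite expr2 mulrA ler_wpM2r//.
  apply: (@le_trans _ _ ((C + 1) * `|y - x|)); first by rewrite ler_wpM2r// lerDl.
  by rewrite mulrC -ler_pdivlMr ?ltr_wpDl// ltW.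
- move=> k; have [C _ [j0 h]] := bX' k; exists C => x t tT.
  apply: (@ule _ U UU (fun j => `|Y k x t j|) (fun=> C)); [exact/normU/cu|exact: cst|].
  by apply: (near_U U_oo (n0 := j0)) => j jj; apply: h => //; exact: nT.
- move=> k; have [C C0 [j0 h]] := lX' k; exists C => x t s tT sT.
  wlog ts : t s tT sT / t <= s.
    by move=> w; case: (leP t s) => [/w|/ltW/w]; [exact|rewrite distrC [`|s - t|]distrC; exact].
  rewrite [`|s - t|]ger0_norm ?subr_ge0//.
  apply: (@ule _ U UU (fun j => `|Y k x s j - Y k x t j|) (fun j => C * (s - t + tau j))).
  + by apply: normU; apply: cvgB; exact: cu.
  + rewrite -{2}[s - t]addr0; apply: cvgM; [exact: cst|apply: cvgD; [exact: cst|exact: tauU]].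
  + apply: (near_U U_oo (n0 := j0)) => j jj.
    have /andP[t0 _] := tT; have /andP[s0 _] := sT.
    have nts : (nn j t <= nn j s)%N by apply: le_truncn; rewrite ler_pM2r ?invr_gt0.
    apply: (le_trans (h _ _ _ _ jj (nT _ _ sT) nts)); rewrite ler_wpM2l// natrB// mulrBl.
    by have := nnP j t0; have := nnP j s0; lra.
- move=> x t tT contQ e e0.
  have [d d0 hd] := contQ (e / 2) (divr_gt0 e0 (ltr0Sn R 1)).
  set q := Q _ _ _ in hd *.
  have [C0 C00 [j0 l0]] := lX' 0%N; have [C1 C10 [j1 l1]] := lX' 1%N; have [C2 C20 [j2 l2]] := lX' 2%N.
  pose C := C0 + C1 + C2 + 1; have Cp : 0 < C by rewrite /C ltr_wpDl// !addr_ge0.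
  have d4 : 0 < d / 8 by rewrite divr_gt0.
  have [j3 e3] := eqX d4.
  (* With |s - t| and tau_j below d / (8 C), the values at all grid times between t and s stay
     within d / 4 of those at t, which leaves room for the consistency error of the scheme. *)
  exists (d / 8 / C); first by rewrite divr_gt0.
  move=> s sT st.
  have tC : 0 < d / 8 / C by rewrite divr_gt0.
  apply: (@ule _ U UU (fun j => `|Y 0%N x s j - Y 0%N x t j - q * (s - t)|)
    (fun j => e / 2 * (`|s - t| + tau j) + `|q| * tau j + e / 2 * `|s - t|)).
  + apply: normU; apply: cvgB; last exact: cst.
    by apply: cvgB; exact: cu.
  + have -> : e * `|s - t| = e / 2 * (`|s - t| + 0) + `|q| * 0 + e / 2 * `|s - t| by field.
    apply: cvgD; last exact: cst.
    apply: cvgD; last by apply: cvgM; [exact: cst|exact: tauU].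
    by apply: cvgM; [exact: cst|apply: cvgD; [exact: cst|exact: tauU]].
  have near_tau : \forall j \near U, tau j < d / 8 / C.
    have := cvg_U_near UU tauU tC; apply: filterS => j; rewrite subr0 gtr0_norm//.
  have n0 := cvg_U_near UU (cu 0%N x t tT) d4.
  have n1 := cvg_U_near UU (cu 1%N x t tT) d4.
  have n2 := cvg_U_near UU (cu 2%N x t tT) d4.
  have nj := @near_U U U_oo (fun j => (j0 + j1 + j2 + j3 <= j)%N) (j0 + j1 + j2 + j3)%N (fun j h => h).
  near=> j.
  have tj : tau j < d / 8 / C by near: j.
  have m0 : `|Y 0%N x t j - u 0%N x t| < d / 8 by near: j.
  have m1 : `|Y 1%N x t j - u 1%N x t| < d / 8 by near: j.
  have m2 : `|Y 2%N x t j - u 2%N x t| < d / 8 by near: j.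
  have jj : (j0 + j1 + j2 + j3 <= j)%N by near: j.
  have jj0 : (j0 <= j)%N by apply: leq_trans jj; rewrite -!addnA leq_addr.
  have jj1 : (j1 <= j)%N by apply: leq_trans jj; rewrite -addnA; apply: leq_trans (leq_addr _ _); exact: leq_addl.
  have jj2 : (j2 <= j)%N by apply: leq_trans jj; apply: leq_trans (leq_addr _ _); exact: leq_addl.
  have jj3 : (j3 <= j)%N by apply: leq_trans jj; exact: leq_addl.
  have /andP[t0 _] := tT; have /andP[s0 _] := sT.
  have pt := nnP j t0; have ps := nnP j s0.
  have close k Ck jk n : (forall j m n x, (jk <= j)%N -> n%:R * tau j <= T ->
      (m <= n)%N -> `|X j n k x - X j m k x| <= Ck * ((n - m)%:R * tau j)) -> 0 <= Ck -> Ck <= C - 1 ->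
      (jk <= j)%N -> n%:R * tau j <= T -> `|n%:R - (nn j t)%:R| * tau j <= `|s - t| + tau j ->
      `|X j n k x - Y k x t j| <= d / 2.
    move=> lk Ck0 CkC jjk nTT nt.
    have b : `|X j n k x - Y k x t j| <= Ck * (`|n%:R - (nn j t)%:R| * tau j).
      have [mn|/ltnW mn] := leqP (nn j t) n.
        by rewrite [`|_%:R - _|]ger0_norm ?subr_ge0 ?ler_nat// -natrB//; exact: lk.
      by rewrite [`|_%:R - _|]ler0_norm ?subr_le0 ?ler_nat// opprB -natrB// distrC; apply: lk => //; exact: nT.
    apply: (le_trans b); apply: (@le_trans _ _ (C * (`|s - t| + tau j))).
      by apply: ler_pM => //; [rewrite mulr_ge0// ltW|by apply: (le_trans CkC); rewrite gerBl].
    have : C * (`|s - t| + tau j) <= C * (d / 8 / C + d / 8 / C) by rewrite ler_wpM2l ?(ltW Cp)// lerD// ltW.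
    have -> : C * (d / 8 / C + d / 8 / C) = d / 4 by field; rewrite gt_eqF.
    by move/le_trans; apply; rewrite ler_pM2l// lef_pV2 ?posrE// ler_nat.
  have step1 n : n.+1%:R * tau j <= T -> `|n%:R - (nn j t)%:R| * tau j <= `|s - t| + tau j ->
      `|X j n.+1 0%N x - X j n 0%N x - tau j * q| <= e / 2 * tau j.
    move=> nT1 nt; have nT0 : n%:R * tau j <= T.
      by apply: le_trans nT1; rewrite ler_pM2r// ler_nat leqnSn.
    have [v [w [hv hw ->]]] := e3 _ _ x jj3 nT1.
    rewrite -mulrBr normrM gtr0_norm// mulrC ler_pM2r//.
    have c0 := close _ _ _ n l0 C00 _ jj0 nT0 nt; have c1 := close _ _ _ n l1 C10 _ jj1 nT0 nt.
    have c2 := close _ _ _ n l2 C20 _ jj2 nT0 nt.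
    have C0C : C0 <= C - 1 by rewrite /C addrK -addrA lerDl addr_ge0.
    have C1C : C1 <= C - 1 by rewrite /C addrK addrAC lerDr addr_ge0.
    have C2C : C2 <= C - 1 by rewrite /C addrK lerDr addr_ge0.
    apply: hd.
    + by apply: (dist3_lt (ltW d0) _ (c0 C0C) m0); rewrite subrr normr0 ltW.
    + by apply: (dist3_lt (ltW d0) (ltW hv) (c1 C1C) m1).
    + by apply: (dist3_lt (ltW d0) (ltW hw) (c2 C2C) m2).
  have fin D : `|Y 0%N x s j - Y 0%N x t j - D * q| <= e / 2 * `|D| -> `|D - (s - t)| <= tau j ->
      `|Y 0%N x s j - Y 0%N x t j - q * (s - t)| <= e / 2 * (`|s - t| + tau j) + `|q| * tau j + e / 2 * `|s - t|.
    by apply: slope_error => //; rewrite divr_ge0// ltW.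
  have [st'|ts'] := leP t s.
    have nts : (nn j t <= nn j s)%N by apply: le_truncn; rewrite ler_pM2r ?invr_gt0.
    apply: (fin ((nn j s - nn j t)%:R * tau j)).
      rewrite [`|_ * tau j|]ger0_norm ?mulr_ge0 ?(ltW (tau0 j))//.
      apply: (@telescope_error _ (fun n => X j n 0%N x)) => // n /andP[an nb].
      have nb' : n.+1%:R * tau j <= (nn j s)%:R * tau j by rewrite ler_pM2r// ler_nat.
      apply: step1; first exact: le_trans nb' (nT _ _ sT).
      rewrite [`|_%:R - _|]ger0_norm ?subr_ge0 ?ler_nat// mulrBl.
      have nb'' : n%:R * tau j <= n.+1%:R * tau j by rewrite ler_pM2r// ler_nat.
      exact: grid_gap (le_trans nb'' nb') pt ps.
    by rewrite natrB// mulrBl; exact: grid_dist.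
  have nts : (nn j s <= nn j t)%N by apply: le_truncn; rewrite ler_pM2r ?invr_gt0// ltW.
  apply: (fin (- ((nn j t - nn j s)%:R * tau j))).
    rewrite normrN [`|_ * tau j|]ger0_norm ?mulr_ge0 ?(ltW (tau0 j))//.
    rewrite (_ : _ - _ * q = - (Y 0%N x t j - Y 0%N x s j - (nn j t - nn j s)%:R * tau j * q)); last by ring.
    rewrite normrN.
    apply: (@telescope_error _ (fun n => X j n 0%N x)) => // n /andP[an nb].
    have nb' : n.+1%:R * tau j <= (nn j t)%:R * tau j by rewrite ler_pM2r// ler_nat.
    apply: step1; first exact: le_trans nb' (nT _ _ tT).
    rewrite [`|_%:R - _|]ler0_norm ?subr_le0 ?ler_nat ?(ltnW nb)// opprB mulrBl.
    have nb'' : (nn j s)%:R * tau j <= n%:R * tau j by rewrite ler_pM2r// ler_nat.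
    exact: grid_gap' nb'' pt ps.
  by rewrite natrB// mulrBl opprB; exact: grid_dist.
- split.
  + move=> k x t tT; congr (lim _); apply: (f_equal (fun f => f @ U)).
    by apply/funext => j; rewrite /Y perX//; exact: nT.
  + move=> k x l X0 T0; have tT : 0 <= (0 : R) <= T by rewrite lexx.
    rewrite /u /ulim; have -> : Y k x 0 = fun=> l.
      by apply/funext => j; rewrite /Y /nn mul0r truncn0 X0.
    by apply/cvg_lim => //; exact: cst.
  + move=> x t C tT h.
    apply: (@ule _ U UU (fun j => `|Y 0%N x t j|) (fun=> C)); [exact/normU/cu|exact: cst|].
    by apply: (near_U U_oo (n0 := 0%N)) => j jj; apply: h => //; exact: nT.
Unshelve. all: by end_near. Qed.

End limit.

(* [u k] is the k-th space derivative of the solution and [q k] that of its time derivative. *)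
Record jsol (R : realType) (g : nat -> R -> R) (A a b : R) (u q : nat -> R -> R -> R) : Prop := Jsol {
  js_dx : forall k x t, a <= t < b -> der setT (u k ^~ t) x (u k.+1 x t);
  js_dt : forall k x t, a <= t < b -> der [set s | a <= s < b] (u k x) t (q k x t);
  js_qx : forall k x t, a <= t < b -> der setT (q k ^~ t) x (q k.+1 x t);
  js_eq : forall x t, a <= t < b ->
    q 0%N x t = ca g (u 0%N x t) (u 1%N x t) * u 2%N x t + cb g (u 0%N x t) (u 1%N x t);
  js_per : forall k x t, a <= t < b -> u k (x + pi *+ 2) t = u k x t;
  js_bd : forall x t, a <= t < b -> `|u 0%N x t| <= A;
  js_cont : forall k x t e, a <= t < b -> 0 < e -> exists2 d, 0 < d &
    forall y s, a <= s < b -> `|y - x| < d -> `|s - t| < d -> `|u k y s - u k x t| < e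
}.

(** * Exchange of time and space derivatives *)

Section swap.
Variables (R : realType) (S : set R).

(* The error of the first order expansion in time of [f] at [t] is [o(s - t)], and its second space derivative is
   [O(s - t)]; by interpolation its first space derivative is [o(s - t)] too. *)
Lemma der_swap (f f1 f2 : R -> R -> R) (p p1 p2 : R -> R) (t C D : R) : 0 <= C ->
  (forall s, S s -> forall x, der setT (f ^~ s) x (f1 x s)) ->
  (forall s, S s -> forall x, der setT (f1 ^~ s) x (f2 x s)) ->
  (forall x, der setT p x (p1 x)) -> (forall x, der setT p1 x (p2 x)) ->
  (forall x, `|p2 x| <= D) ->
  (forall s x, S s -> `|f2 x s - f2 x t| <= C * `|s - t|) -> S t ->
  (forall x, der S (f x) t (p x)) -> forall x, der S (f1 x) t (p1 x).
Proof.
move=> C0 df df1 dp dp1 bp lf St dt x e e0.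
have D0 : 0 <= D := le_trans (normr_ge0 _) (bp 0).
pose K := C + D + 1; have K0 : 0 < K by rewrite /K ltr_wpDl// addr_ge0.
(* This length balances the two errors: after division by w, the values at x and x + w contribute e
   / 2 together, and the second derivative contributes K w = e / 2. *)
pose w := e / 2 / K; have w0 : 0 < w by rewrite !divr_gt0.
have ew : 0 < e * w / 4 by rewrite divr_gt0// mulr_gt0.
have [d1 d10 h1] := dt x _ ew; have [d2 d20 h2] := dt (x + w) _ ew.
exists (Num.min d1 d2); first by rewrite lt_min d10.
move=> s Ss; rewrite lt_min => /andP[s1 s2].
have b1 := h1 _ Ss s1; have b2 := h2 _ Ss s2.
pose E z := f z s - f z t - p z * (s - t); pose E' z := f1 z s - f1 z t - p1 z * (s - t).
have dE z : der setT E z (E' z).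
  have ha := df _ Ss z; have hb := df _ St z; have hc := dp z.
  by rewrite /E /E'; der_ring.
have dE' z : der setT E' z (f2 z s - f2 z t - p2 z * (s - t)).
  have ha := df1 _ Ss z; have hb := df1 _ St z; have hc := dp1 z.
  by rewrite /E'; der_ring.
have bE z : `|f2 z s - f2 z t - p2 z * (s - t)| <= K * `|s - t|.
  apply: (le_trans (ler_normB _ _)); rewrite normrM /K.
  have := lf s z Ss; have : `|p2 z| * `|s - t| <= D * `|s - t| by rewrite ler_wpM2r.
  by have := normr_ge0 (s - t); lra.
have := taylor1 x (x + w) dE dE' bE.
rewrite -/(E x) in b1; rewrite -/(E (x + w)) in b2.
have -> : x + w - x = w by rewrite addrC addKr.
rewrite (gtr0_norm w0).
have -> : K * `|s - t| * w ^+ 2 = e / 2 * w * `|s - t| by rewrite /w; field; rewrite gt_eqF.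
move=> h; rewrite -/(E' x) -(ler_pM2r w0) -[X in _ * X <= _](gtr0_norm w0) -normrM.
have -> : E' x * w = E (x + w) - E x - (E (x + w) - E x - E' x * w) by ring.
apply: (le_trans (ler_normB _ _)); have h' := ler_normB (E (x + w)) (E x).
by clear - h h' b1 b2; lra.
Qed.

End swap.

(** * A priori bounds for the scheme and local existence *)

Section local_existence.
Variables (R : realType) (g : nat -> R -> R) (eta A : R).
Hypothesis dg : forall k y, `|y| < eta -> der setT (g k) y (g k.+1 y).
Hypothesis Aeta : A < eta.
Hypothesis A0 : 0 <= A.
Hypothesis bg : forall k, exists C, forall y, `|y| <= A -> `|g k y| <= C.
Variables (gmin gmax : R).
Hypothesis gmin0 : 0 < gmin.
Hypothesis ming : forall y, `|y| <= A -> gmin <= g 0%N y.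
Hypothesis maxg : forall y, `|y| <= A -> g 0%N y <= gmax.

Definition orbit h tau r n := iter n (step g h tau) r.

(** For l = 2 the estimates of orders 1 to 3 close on themselves: as long as the bound B + 1 holds,
    each step adds at most tau K, so it persists up to time 1 / K. *)
Lemma scheme_base B : 0 <= B -> exists T h1, [/\ 0 < T, 0 < h1 &
  forall h tau r, 0 < h <= h1 -> 0 < tau -> 6 * tau * gmax <= h ^+ 2 -> nice r ->
   (forall x, `|r x| <= A) -> (forall k x, (0 < k <= 3)%N -> `|derive1n k r x| <= B) ->
   forall n, n%:R * tau <= T -> [/\ nice (orbit h tau r n),
     forall x, `|orbit h tau r n x| <= A &
     forall k x, (0 < k <= 3)%N -> `|derive1n k (orbit h tau r n) x| <= B + 1]].
Proof.
move=> B0; have B1 : 0 <= B + 1 by rewrite addr_ge0.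
have E j (jl : (0 < j <= 3)%N) := @step_est R g eta A dg Aeta bg gmin gmax gmin0 ming maxg 2 j (B + 1) isT jl B1.
have [C1 [h1 [C10 h10 e1]]] := E 1%N isT.
have [C2 [h2 [C20 h20 e2]]] := E 2%N isT.
have [C3 [h3 [C30 h30 e3]]] := E 3%N isT.
have [h4 h40 e4] := step_max bg gmin0 ming maxg B1.
pose C := C1 + C2 + C3; have C0 : 0 < C by rewrite !addr_gt0.
pose K := C * (1 + (B + 1)); have K0 : 0 < K by rewrite mulr_gt0// addr_gt0// ltr_wpDl.
exists K^-1, (Num.min (Num.min h1 h2) (Num.min h3 h4)); split; [by rewrite invr_gt0|by rewrite !lt_min h10 h20 h30|].
move=> h tau r /andP[h0]; rewrite !le_min => /andP[/andP[hh1 hh2] /andP[hh3 hh4]] t0 ht nr rA rB n nT.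
suff : [/\ nice (orbit h tau r n), forall x, `|orbit h tau r n x| <= A &
     forall k x, (0 < k <= 3)%N -> `|derive1n k (orbit h tau r n) x| <= B + n%:R * tau * K].
  move=> [a b c]; split=> // k x k3; apply: (le_trans (c k x k3)); rewrite lerD2l.
  by rewrite -ler_pdivlMr// mul1r.
elim: n nT => [|n ih] nT.
  by rewrite mul0r mul0r addr0; split.
have nT' : n%:R * tau <= K^-1 by apply: le_trans nT; rewrite ler_pM2r// ler_nat.
have [a b c] := ih nT'.
have c' k x : (0 < k <= 3)%N -> `|derive1n k (orbit h tau r n) x| <= B + 1.
  by move=> k3; apply: (le_trans (c k x k3)); rewrite lerD2l -ler_pdivlMr// mul1r.
have c2 k x : (0 < k <= 2)%N -> `|derive1n k (orbit h tau r n) x| <= B + 1.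
  by move=> /andP[k1 k2]; apply: c'; rewrite k1 (leq_trans k2).
split.
- by apply: (@nice_step R g eta A).
- apply: (e4 h tau) => //; [by rewrite h0|exact: ltW|].
  by move=> x; exact: c'.
- have key j Cj : (0 < j <= 3)%N -> Cj <= C ->
    (forall x, `|derive1n j (step g h tau (orbit h tau r n)) x| <= B + n%:R * tau * K + tau * (Cj * (1 + (B + 1)))) ->
    forall x, `|derive1n j (orbit h tau r n.+1) x| <= B + n.+1%:R * tau * K.
    move=> j3 CjC hj x; apply: (le_trans (hj x)).
    rewrite -addrA lerD2l -natr1 !mulrDl lerD2l mul1r ler_pM2l// /K.
    by rewrite ler_wpM2r// addr_ge0.
  have ap Cj hj j (ej : forall (h tau : R) (r : R -> R) (N M : R), 0 < h <= hj -> 0 <= tau ->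
     6 * tau * gmax <= h ^+ 2 -> nice r -> (forall x : R, `|r x| <= A) ->
     (forall (k : nat) (x : R), (0 < k <= 2)%N -> `|derive1n k r x| <= B + 1) ->
     (forall x : R, `|derive1n 3 r x| <= N) -> (2 < 2)%N \/ N <= B + 1 ->
     (forall x : R, `|derive1n j r x| <= M) ->
     forall x : R, `|derive1n j (step g h tau r) x| <= M + tau * (Cj * (1 + N))) : h <= hj -> (0 < j <= 3)%N ->
     forall x, `|derive1n j (step g h tau (orbit h tau r n)) x| <= B + n%:R * tau * K + tau * (Cj * (1 + (B + 1))).
    move=> hhj j3 x; apply: ej => //; first by rewrite h0.
    + exact: ltW.
    + by move=> y; exact: c'.
    + by right.
    + by move=> y; exact: c.
  case=> [//|[|[|[|//]]]] x _.
  + apply: (key 1%N C1) => // [|y]; first by rewrite /C -addrA lerDl addr_ge0// ltW.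
    exact: (ap C1 h1 1%N e1).
  + apply: (key 2%N C2) => // [|y]; first by rewrite /C -addrA addrCA lerDl addr_ge0// ltW.
    exact: (ap C2 h2 2%N e2).
  + apply: (key 3%N C3) => // [|y]; first by rewrite /C lerDr addr_ge0// ltW.
    exact: (ap C3 h3 3%N e3).
Qed.

(** At each higher order the bounds obey M' <= M + tau C (1 + M), so 1 + M grows at most
    exponentially. The time T is the same for all orders; only the admissible h shrinks. *)
Lemma scheme_all B T h1 r : 0 <= B -> 0 <= T -> 0 < h1 -> nice r ->
  (forall h tau, 0 < h <= h1 -> 0 < tau -> 6 * tau * gmax <= h ^+ 2 ->
   forall n, n%:R * tau <= T -> [/\ nice (orbit h tau r n),
     forall x, `|orbit h tau r n x| <= A &
     forall k x, (0 < k <= 3)%N -> `|derive1n k (orbit h tau r n) x| <= B]) ->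
  forall l, exists Bl hl, [/\ 0 <= Bl, 0 < hl <= h1 & forall h tau, 0 < h <= hl -> 0 < tau -> 6 * tau * gmax <= h ^+ 2 ->
   forall n, n%:R * tau <= T -> forall k x, (0 < k <= l.+3)%N -> `|derive1n k (orbit h tau r n) x| <= Bl].
Proof.
move=> B0 T0 h10 nr base; elim=> [|l [Bl [hl [Bl0 /andP[hl0 hlh] ih]]]].
  by exists B, h1; split=> // [|h tau hh t0 ht n nT]; [rewrite h10/=|have [_ _] := base h tau hh t0 ht n nT].
have [|C [h' [C0 h'0 est]]] := @step_est R g eta A dg Aeta bg gmin gmax gmin0 ming maxg l.+3 l.+4 Bl isT _ Bl0.
  by rewrite leqnn.
have [nk _] := nice_jet nr l.+4; have [N0 hN0] := nice_bounded nk.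
have N00 : 0 <= N0 := le_trans (normr_ge0 _) (hN0 0).
exists (Num.max Bl ((1 + N0) * expR (C * T))), (Num.min hl h'); split.
- by rewrite le_max Bl0.
- by rewrite lt_min hl0 h'0 /= ge_min hlh.
move=> h tau /andP[h0]; rewrite le_min => /andP[hhl hh'] t0 ht.
have hhl' : 0 < h <= hl by rewrite h0.
have hh1' : 0 < h <= h1 by rewrite h0 (le_trans hhl).
have main n : n%:R * tau <= T -> forall x, `|derive1n l.+4 (orbit h tau r n) x| <= (1 + N0) * expR (C * (n%:R * tau)) - 1.
  elim: n => [|n ihn] nT x.
    by rewrite mul0r mulr0 expR0 mulr1 addrC addKr; exact: hN0.
  have nT' : n%:R * tau <= T by apply: le_trans nT; rewrite ler_pM2r// ler_nat.
  have [a b _] := base h tau hh1' t0 ht n nT'.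
  have := est h tau (orbit h tau r n) ((1 + N0) * expR (C * (n%:R * tau)) - 1) ((1 + N0) * expR (C * (n%:R * tau)) - 1).
  rewrite h0 hh' => /(_ isT (ltW t0) ht a b (ih h tau hhl' t0 ht n nT') (ihn nT') (or_introl isT) (ihn nT') x).
  move/le_trans; apply.
  have -> : C * (n.+1%:R * tau) = C * (n%:R * tau) + C * tau by rewrite -natr1; ring.
  rewrite expRD.
  have := expR_ge1Dx (C * tau); have : 0 <= (1 + N0) * expR (C * (n%:R * tau)) by rewrite mulr_ge0 ?expR_ge0// addr_ge0.
  set E := (1 + N0) * _ => E0 h1'.
  have : E * (1 + C * tau) <= E * expR (C * tau) by rewrite ler_wpM2l.
  have -> : (1 + N0) * (expR (C * (n%:R * tau)) * expR (C * tau)) = E * expR (C * tau) by rewrite mulrA.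
  by lra.
move=> n nT k x /andP[k0]; rewrite leq_eqVlt le_max => /orP[/eqP->|kl]; apply/orP; [right|left].
  apply: (le_trans (main n nT x)); apply: (@le_trans _ _ ((1 + N0) * expR (C * (n%:R * tau)))); first by rewrite gerBl.
  by rewrite ler_wpM2l ?addr_ge0// ler_expR ler_wpM2l// ltW.
by apply: (ih h tau hhl' t0 ht n nT); rewrite k0.
Qed.

Lemma orbit_periodic h tau r P : 0 < h ->
  (forall x, r (x + P) = r x) -> forall n, (forall m, (m < n)%N -> nice (orbit h tau r m)) ->
  forall x, orbit h tau r n (x + P) = orbit h tau r n x.
Proof.
move=> h0 rP; elim=> [//|n ih] nn x.
have nn' := nn n (ltnSn n); have ih' := ih (fun m mn => nn m (ltnW mn)).
have per1 (f : R -> R) : nice f -> (forall x, f (x + P) = f x) -> forall x, derive1 f (x + P) = derive1 f x.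
  move=> nf fP y; have [df _] := nice_derive1 nf.
  apply: der_uniqT (df y); have := der_addl (x := P) (s := y); rewrite [P + y]addrC => /(_ _ _ (df _)).
  by under eq_fun do rewrite addrC fP.
rewrite /orbit /= -/(orbit h tau r n) /step /srhs /avj ih'.
have [_ n1] := nice_derive1 nn'.
rewrite !avd_shift//; [exact: nice_cont| |exact: nice_cont].
by rewrite derive1n1; exact: per1.
Qed.

Lemma periodic_jet (f : R -> R) P : nice f -> (forall x, f (x + P) = f x) ->
  forall k x, derive1n k f (x + P) = derive1n k f x.
Proof.
move=> nf fP; elim=> [//|k ih] x; have [_ df] := nice_jet nf k.
apply: der_uniqT (df x); have := der_addl (x := P) (s := x); rewrite [P + x]addrC => /(_ _ _ (df _)).
by under eq_fun do rewrite addrC ih.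
Qed.

Lemma rhs_continuous r0 v0 w0 e : `|r0| < eta -> 0 < e -> exists2 d, 0 < d &
  forall r v w : R, `|r - r0| < d -> `|v - v0| < d -> `|w - w0| < d ->
  `|ca g r v * w + cb g r v - (ca g r0 v0 * w0 + cb g r0 v0)| <= e.
Proof.
move=> re e0.
have cg k : {for r0, continuous (g k)} by apply: der_continuous (dg k re).
have cz : {for v0, continuous (@zeta R)} by apply: der_continuous (der_zeta v0).
have : (fun p : R * R * R => ca g p.1.1 p.1.2 * p.2 + cb g p.1.1 p.1.2) p
    @[p --> (r0, v0, w0)] --> ca g r0 v0 * w0 + cb g r0 v0.
  have c1 : (fun p : R * R * R => p.1.1) p @[p --> (r0, v0, w0)] --> r0.
    by apply: cvg_comp; [exact: cvg_fst|exact: cvg_fst].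
  have c2 : (fun p : R * R * R => p.1.2) p @[p --> (r0, v0, w0)] --> v0.
    by apply: cvg_comp; [exact: cvg_fst|exact: cvg_snd].
  have c3 : (fun p : R * R * R => p.2) p @[p --> (r0, v0, w0)] --> w0 by exact: cvg_snd.
  have gk k : (fun p : R * R * R => g k p.1.1) p @[p --> (r0, v0, w0)] --> g k r0.
    by apply: (cvg_comp _ _ c1); exact: cg.
  have z1 : (fun p : R * R * R => zeta p.1.2) p @[p --> (r0, v0, w0)] --> zeta v0.
    by apply: (cvg_comp _ _ c2); exact: cz.
  rewrite /ca /cb; apply: cvgD.
    apply: cvgM => //; apply: cvgM => //.
    exact: (cvgM z1 (cvgM z1 z1)).
  apply: cvgM => //; apply: cvgM; first by apply: cvgN.
  exact: (cvgM c2 c2).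
move=> /cvgrPdist_le/(_ _ e0) /nbhs_ballP[d /= d0 hd]; exists d => // r v w hr hv hw.
rewrite distrC; apply: (hd (r, v, w)); rewrite /ball/= /prod_ball/=.
by split; [split|]; rewrite /ball/= distrC.
Qed.

(** [T] is fixed by the bound [B] on three derivatives before the data is chosen; the continuation
    argument rests on this order of quantifiers. *)
Theorem local_existence B : 0 <= B -> exists2 T, 0 < T & forall r, nice r ->
  (forall x, r (x + pi *+ 2) = r x) ->
  (forall x, `|r x| <= A) -> (forall k x, (0 < k <= 3)%N -> `|derive1n k r x| <= B) ->
  exists u q, jsol g A 0 T u q /\ forall k x, u k x 0 = derive1n k r x.
Proof.
move=> B0; have [T [h1 [T0 h10 base]]] := scheme_base B0.
exists T => // r nr rP rA rB.
have gm0 : 0 < gmax by apply: (lt_le_trans gmin0); apply: (@le_trans _ _ (g 0%N 0)); [apply: ming|apply: maxg]; rewrite normr0.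
have base' : forall h tau, 0 < h <= h1 -> 0 < tau -> 6 * tau * gmax <= h ^+ 2 ->
   forall n, n%:R * tau <= T -> [/\ nice (orbit h tau r n),
     forall x, `|orbit h tau r n x| <= A &
     forall k x, (0 < k <= 3)%N -> `|derive1n k (orbit h tau r n) x| <= B + 1].
  by move=> h tau hh t0 ht; exact: base.
have all := scheme_all (addr_ge0 B0 ler01) (ltW T0) h10 nr base'.
pose h j : R := h1 * harmonic j.
(* With this choice the stability condition 6 tau gmax <= h^2 is an equality. *)
pose tau j : R := h j ^+ 2 / (6 * gmax).
have h0 j : 0 < h j by rewrite mulr_gt0// harmonic_gt0.
have hh1 j : 0 < h j <= h1.
  by rewrite h0 /h ger_pMr// /harmonic invf_le1// ler1n.
have tau0 j : 0 < tau j by rewrite divr_gt0 ?exprn_gt0// mulr_gt0.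
have ht j : 6 * tau j * gmax <= h j ^+ 2.
  by rewrite /tau le_eqVlt; apply/orP; left; apply/eqP; field; rewrite gt_eqF.
have h_cvg : h @ \oo --> (0 : R).
  by rewrite -[0](mulr0 h1); apply: cvgM; [exact: cvg_cst|exact: cvg_harmonic].
have tau_cvg : tau @ \oo --> (0 : R).
  rewrite -(mul0r (6 * gmax)^-1) -[X in X * _](mul0r 0); apply: cvgM; last exact: cvg_cst.
  by under eq_fun do rewrite expr2; exact: cvgM.
have h_small e : 0 < e -> exists j0, forall j, (j0 <= j)%N -> h j < e.
  move=> e0; have /cvgrPdist_lt/(_ _ e0)[j0 _ hj] := h_cvg; exists j0 => j jj.
  by have := hj j jj; rewrite /= sub0r normrN gtr0_norm.
pose X j n k := derive1n k (orbit (h j) (tau j) r n).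
have XB j n : n%:R * tau j <= T -> [/\ nice (orbit (h j) (tau j) r n),
     forall x, `|orbit (h j) (tau j) r n x| <= A &
     forall k x, (0 < k <= 3)%N -> `|derive1n k (orbit (h j) (tau j) r n) x| <= B + 1].
  exact: base'.
have dX j n k x : n%:R * tau j <= T -> der setT (X j n k) x (X j n k.+1 x).
  by move=> nT; have [nn _ _] := XB j n nT; have [_] := nice_jet nn k; exact.
have bX k : exists C j0, forall j n x, (j0 <= j)%N -> n%:R * tau j <= T -> `|X j n k x| <= C.
  case: k => [|k]; first by exists A, 0%N => j n x _ nT; have [_ b _] := XB j n nT; exact: b.
  have [Bl [hl [Bl0 /andP[hl0 hlh] hB]]] := all k.+1; have [j0 hj] := h_small _ hl0.
  exists Bl, j0 => j n x jj nT; apply: (hB (h j) (tau j)) => //; first by rewrite h0 ltW ?hj.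
  by rewrite /= -addn3 leq_addr.
have lX k : exists C j0, forall j n x, (j0 <= j)%N -> n.+1%:R * tau j <= T ->
    `|X j n.+1 k x - X j n k x| <= C * tau j.
  have [Bl [hl [Bl0 /andP[hl0 hlh] hB]]] := all k; have [j0 hj] := h_small _ hl0.
  have [C hC] := @srhs_bound R g eta A dg Aeta bg k.+2 Bl isT Bl0.
  exists C, j0 => j n x jj nT.
  have nT' : n%:R * tau j <= T by apply: le_trans nT; rewrite ler_pM2r// ler_nat.
  have [a b _] := XB j n nT'.
  rewrite /X /= (@step_jet R g eta A dg Aeta bg)// addrC addKr normrM gtr0_norm// mulrC ler_pM2r//.
  apply: hC => // i y ik; apply: (hB (h j) (tau j)) => //; first by rewrite h0 ltW ?hj.
have perX j n k x : n%:R * tau j <= T -> X j n k (x + pi *+ 2) = X j n k x.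
  move=> nT; have [a _ _] := XB j n nT; apply: periodic_jet => //.
  apply: orbit_periodic => // m mn.
  by have [|//] := XB j m _; apply: le_trans nT; rewrite ler_pM2r// ler_nat ltnW.
pose Q a v w := ca g a v * w + cb g a v.
have eqX e : 0 < e -> exists j0, forall j n x, (j0 <= j)%N -> n.+1%:R * tau j <= T ->
  exists v w, [/\ `|v - X j n 1%N x| < e, `|w - X j n 2%N x| < e &
    X j n.+1 0%N x - X j n 0%N x = tau j * Q (X j n 0%N x) v w].
  move=> e0; have K0 : 0 < 6 * (B + 1) by rewrite mulr_gt0// ltr_wpDl.
  have [j0 hj] := h_small _ (divr_gt0 e0 K0).
  exists j0 => j n x jj nT.
  have nT' : n%:R * tau j <= T by apply: le_trans nT; rewrite ler_pM2r// ler_nat.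
  have [a b c] := XB j n nT'.
  exists (avj (h j) (orbit (h j) (tau j) r n) 0%N x), (avj (h j) (orbit (h j) (tau j) r n) 1%N x).
  have small : 6 * (B + 1) * h j < e by rewrite mulrC -ltr_pdivlMr ?hj.
  have jet k y : der setT (X j n k) y (X j n k.+1 y) := dX j n k y nT'.
  split.
  + apply: le_lt_trans small; exact: (avd_consistent x (h0 j) (jet 0%N) (jet 1%N) (fun y => c 2%N y isT)).
  + apply: le_lt_trans small; exact: (avd_consistent x (h0 j) (jet 1%N) (jet 2%N) (fun y => c 3%N y isT)).
  + by rewrite /X /= /step addrC addKr.
have [u [ux ub ul ut [up u0 uA]]] := limit_exists tau0 tau_cvg dX bX lX perX eqX.
pose q k x t := derive1n k (fun x => Q (u 0%N x t) (u 1%N x t) (u 2%N x t)) x.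
have uAA x t : 0 <= t <= T -> `|u 0%N x t| <= A.
  by move=> tT; apply: uA => // j n nT; have [_ b _] := XB j n nT; exact: b.
have nQ t : 0 <= t <= T -> nice (fun x => Q (u 0%N x t) (u 1%N x t) (u 2%N x t)).
  move=> tT m.
  have nu k : nice (u k ^~ t).
    have := @jet_nice _ (fun i => u (k + i)%N ^~ t); rewrite addn0; apply=> [i x|i]; first by rewrite addnS; exact: ux.
    by have [C hC] := ub (k + i)%N; exists C => x; exact: hC.
  apply: (@tame_rhs R g eta A dg Aeta bg unit (fun=> 0) (fun _ k => u k ^~ t) (fun _ k => u k.+1 ^~ t) m.+1) => //.
  - by move=> _ k x; exact: ux.
  - by move=> _ x; exact: uAA.
  - exact: nu.
  - exact: nu.
pose S : set R := [set s | 0 <= s <= T].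
(* The limit yields the time derivative for k = 0 only; [der_swap] carries it from one space
   derivative to the next. *)
have dt0 k : forall x t, 0 <= t <= T -> der S (u k x) t (q k x t).
  elim: k => [|k ih] x t tT.
    apply: ut => // e e0; have [|d d0 hd] := @rhs_continuous (u 0%N x t) (u 1%N x t) (u 2%N x t) e _ e0.
      exact: le_lt_trans (uAA _ _ tT) _.
    by exists d.
  have [C hC] := ul k.+2.
  have jet i y : der setT (q i ^~ t) y (q i.+1 y t) by have [_] := nice_jet (nQ t tT) i; exact.
  have [nk2 _] := nice_jet (nQ t tT) k.+2; have [D hD] := nice_bounded nk2.
  apply: (@der_swap _ S (u k) (u k.+1) (u k.+2) (q k ^~ t) (q k.+1 ^~ t) (q k.+2 ^~ t) t `|C| D) => //.
  - by move=> s sT y; exact: ux.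
  - by move=> s sT y; exact: ux.
  - move=> s y sT; apply: (le_trans (hC _ _ _ tT sT)); by rewrite ler_wpM2r// ler_norm.
  - by move=> y; exact: ih.
have w t : 0 <= t < T -> 0 <= t <= T by move=> /andP[-> /ltW].
exists u, q; split; last by move=> k x; apply: u0 => //; exact: ltW.
split.
- by move=> k x t /w; exact: ux.
- by move=> k x t /w tT; apply: der_sub (dt0 k x t tT) => s /= /w.
- by move=> k x t /w tT; have [_] := nice_jet (nQ t tT) k; exact.
- by [].
- by move=> k x t /w; exact: up.
- by move=> x t /w; exact: uAA.
- move=> k x t e /w tT e0; have [C hC] := ul k; have [D hD] := ub k.+1.
  have K0 : 0 < `|C| + `|D| + 1 by rewrite ltr_wpDl// addr_ge0.
  exists (e / (`|C| + `|D| + 1)); first exact: divr_gt0.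
  move=> y s /w sT yx st; rewrite (_ : _ - _ = (u k y s - u k x s) + (u k x s - u k x t)); last by ring.
  apply: (le_lt_trans (ler_normD _ _)).
  have b1 := lip_der x y (fun z => ux k z s sT) (fun z => hD z s sT).
  have b2 := hC x _ _ tT sT.
  have b3 : D * `|y - x| <= `|D| * (e / (`|C| + `|D| + 1)).
    by apply: (le_trans (ler_wpM2r (normr_ge0 _) (ler_norm _))); rewrite ler_wpM2l// ltW.
  have b4 : C * `|s - t| <= `|C| * (e / (`|C| + `|D| + 1)).
    by apply: (le_trans (ler_wpM2r (normr_ge0 _) (ler_norm _))); rewrite ler_wpM2l// ltW.
  have b5 : (`|C| + `|D| + 1) * (e / (`|C| + `|D| + 1)) = e by field; rewrite gt_eqF.
  have b6 : 0 < e / (`|C| + `|D| + 1) by exact: divr_gt0.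
  by lra.
Qed.

End local_existence.

(** * Joint continuity in space and time, and maximum principles *)

Section joint_continuity.
Variable R : realType.
Implicit Types f h : R -> R -> R.

Definition jcont (a b : R) f :=
  {within [set p : R * R | a <= p.2 < b], continuous (fun p : R * R => f p.1 p.2)}.

Lemma jcontP a b f : jcont a b f <-> (forall x t e, a <= t < b -> 0 < e -> exists2 d, 0 < d &
  forall y s, a <= s < b -> `|y - x| < d -> `|s - t| < d -> `|f y s - f x t| < e).
Proof.
split=> [/subspace_continuousP cf x t e tab e0|h].
  have /cvgrPdist_lt/(_ _ e0) := cf (x, t) tab.
  rewrite near_withinE => /nbhs_ballP[d /= d0 hd]; exists d => // y s sab yx st.
  have := hd (y, s); rewrite /ball/= /prod_ball/= distrC; apply => //.
  by rewrite /ball/= !(distrC _ y) !(distrC _ s).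
apply/subspace_continuousP => -[x t] /= tab; apply/cvgrPdist_lt => e e0.
have [d d0 hd] := h x t e tab e0; rewrite near_withinE; apply/nbhs_ballP; exists d => //.
by move=> [y s]; rewrite /ball/= /prod_ball/ball/= => -[yx st] sab; rewrite distrC; apply: hd => //; rewrite distrC.
Qed.

Lemma jcontW a b a' b' f : a <= a' -> b' <= b -> jcont a b f -> jcont a' b' f.
Proof.
move=> aa bb; apply: continuous_subspaceW => -[x t] /= /andP[h1 h2].
by rewrite (le_trans aa h1) (lt_le_trans h2 bb).
Qed.

Lemma jcont_add a b f h : jcont a b f -> jcont a b h -> jcont a b (fun x t => f x t + h x t).
Proof. by move=> cf ch p; apply: continuousD; [exact: cf|exact: ch]. Qed.

Lemma jcont_opp a b f : jcont a b f -> jcont a b (fun x t => - f x t).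
Proof. by move=> cf p; apply: continuousN; exact: cf. Qed.

Lemma jcont_mul a b f h : jcont a b f -> jcont a b h -> jcont a b (fun x t => f x t * h x t).
Proof. by move=> cf ch p; apply: continuousM; [exact: cf|exact: ch]. Qed.

Lemma jcont_comp a b f (G : R -> R) : jcont a b f ->
  (forall x t, a <= t < b -> {for f x t, continuous G}) -> jcont a b (fun x t => G (f x t)).
Proof.
move=> /subspace_continuousP cf cG; apply/subspace_continuousP => -[x t] tab.
apply: (cvg_comp (fun p : R * R => f p.1 p.2) G); [exact: (cf (x, t) tab)|exact: cG].
Qed.

Lemma jcont_t a b (G : R -> R) : continuous G -> jcont a b (fun _ t => G t).
Proof.
move=> cG; apply: continuous_subspaceT => -[x t].
by apply: (cvg_comp snd G); [exact: cvg_snd|exact: cG].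
Qed.

Lemma jcont_x a b (G : R -> R) : continuous G -> jcont a b (fun x _ => G x).
Proof.
move=> cG; apply: continuous_subspaceT => -[x t].
by apply: (cvg_comp fst G); [exact: cvg_fst|exact: cG].
Qed.

Lemma jcont_max a b f (c d T : R) : jcont a b f -> c <= d -> a <= T -> T < b ->
  exists x t, [/\ c <= x <= d, a <= t <= T &
    forall y s, c <= y <= d -> a <= s <= T -> f y s <= f x t].
Proof.
move=> cf cd aT Tb; pose K := `[c, d]%classic `*` `[a, T]%classic.
have cK : compact K by apply: compact_setX; exact: segment_compact.
have [||[x t]] := @compact_EVT_max _ R (fun p : R * R => f p.1 p.2) K _ cK.
- by exists (c, a); split; rewrite /= in_itv/= lexx.
- apply: continuous_subspaceW cf => -[y s] [_] /=; rewrite in_itv/= => /andP[-> sT] /=.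
  exact: le_lt_trans sT Tb.
rewrite inE => -[/=]; rewrite !in_itv/= => xcd taT h.
exists x, t; split => // y s ycd sT; apply: (h (y, s)).
by rewrite inE; split; rewrite /= in_itv.
Qed.

(** A positive maximum over the box lies at some t > a, and earlier values do not exceed it, which
    is incompatible with l < 0. The hypothesis therefore concerns only points that are maximal in
    space at their own time. *)
Lemma max_principle a b (c d T : R) (y : R -> R -> R) : jcont a b y -> c <= d -> a <= T -> T < b ->
  (forall x, c <= x <= d -> y x a <= 0) ->
  (forall x t, c <= x <= d -> a < t <= T -> 0 < y x t -> (forall z, c <= z <= d -> y z t <= y x t) ->
     exists2 l, l < 0 & der [set s | a <= s < b] (y x) t l) ->
  forall x t, c <= x <= d -> a <= t <= T -> y x t <= 0.
Proof.
move=> cy cd aT Tb y0 hy x' t' xcd' tT'.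
have [x [t [xcd taT ym]]] := jcont_max cy cd aT Tb.
apply: (le_trans (ym _ _ xcd' tT')); rewrite leNgt; apply/negP => yp.
have /andP[at_ tT] := taT.
have {}at_ : a < t.
  rewrite lt_neqAle at_ andbT; apply/negP => /eqP ae.
  by have := y0 _ xcd; rewrite ae leNgt yp.
have [||l l0 dl] := hy x t xcd _ yp; first by rewrite at_.
  by move=> z zcd; apply: ym => //; rewrite ltW.
have nl : 0 < - l by rewrite oppr_gt0.
have [e e0 he] := dl (- l / 2) (divr_gt0 nl (ltr0Sn R 1)).
pose w := Num.min e (t - a) / 2; have w0 : 0 < w by rewrite divr_gt0// lt_min e0 subr_gt0.
have we : w < e by rewrite ltr_pdivrMr// gt_min; apply/orP; left; lra.
have wt : w < t - a by rewrite ltr_pdivrMr// gt_min; apply/orP; right; lra.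
have := he (t - w) _; have -> : t - w - t = - w by ring.
rewrite normrN (gtr0_norm w0) => /(_ _ we).
have h1 : a <= t - w < b.
  by apply/andP; split; lra.
move=> /(_ h1); rewrite ler_norml => /andP[h2 _].
have h3 : a <= t - w <= T by case/andP: h1 => -> _ /=; lra.
have := ym x (t - w) xcd h3.
have : 0 < - l * w by rewrite mulr_gt0// oppr_gt0.
by move: h2; lra.
Qed.

Lemma period_reduce (P x : R) : 0 < P -> exists2 z, 0 <= z <= P &
  forall f : R -> R, (forall y, f (y + P) = f y) -> f x = f z.
Proof.
move=> P0; have per (f : R -> R) n y : (forall y, f (y + P) = f y) -> f (y + n%:R * P) = f y.
  move=> fP; elim: n => [|n ih]; first by rewrite mul0r addr0.
  by rewrite -natr1 mulrDl mul1r addrA fP.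
have [x0|x0] := leP 0 x.
  have := truncn_itv (divr_ge0 x0 (ltW P0)); set n := Num.truncn _.
  rewrite ler_pdivlMr// ltr_pdivrMr// -natr1 mulrDl mul1r => nx.
  exists (x - n%:R * P); first by lra.
  by move=> f fP; rewrite -[in LHS](subrK (n%:R * P) x) per.
have x0' : 0 <= - x by lra.
have := truncn_itv (divr_ge0 x0' (ltW P0)); set n := Num.truncn _.
rewrite ler_pdivlMr// ltr_pdivrMr// => nx.
exists (x + n.+1%:R * P); first by rewrite -natr1 mulrDl mul1r in nx *; lra.
by move=> f fP; rewrite per.
Qed.

Lemma jcont_periodic_bounded a b f P T : 0 < P -> jcont a b f -> a <= T -> T < b ->
  (forall x t, a <= t < b -> f (x + P) t = f x t) ->
  exists M, forall x t, a <= t <= T -> `|f x t| <= M.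
Proof.
move=> P0 cf aT Tb fP.
have [x [t [_ _ h]]] := jcont_max cf (ltW P0) aT Tb.
have [x' [t' [_ _ h']]] := jcont_max (jcont_opp cf) (ltW P0) aT Tb.
exists (Num.max (f x t) (- f x' t')) => y s sT.
have sab : a <= s < b by case/andP: sT => -> /= /le_lt_trans; apply.
have [z zP /(_ (f ^~ s) (fun y => fP y s sab)) ->] := period_reduce y P0.
rewrite ler_norml lerNl !le_max; apply/andP; split; apply/orP; [right|left].
  exact: h'.
exact: h.
Qed.

Lemma max_principle_periodic a b P (T : R) (y : R -> R -> R) : 0 < P -> jcont a b y -> a <= T -> T < b ->
  (forall x t, a <= t < b -> y (x + P) t = y x t) ->
  (forall x, y x a <= 0) ->
  (forall x t, a < t <= T -> 0 < y x t -> (forall z, y z t <= y x t) ->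
     exists2 l, l < 0 & der [set s | a <= s < b] (y x) t l) ->
  forall x t, a <= t <= T -> y x t <= 0.
Proof.
move=> P0 cy aT Tb yP y0 hy x t tT.
have tab s : a <= s <= T -> a <= s < b by move=> /andP[-> /le_lt_trans]; apply.
have [z zP /(_ (y ^~ t) (fun x => yP x t (tab _ tT))) ->] := period_reduce x P0.
apply: (max_principle cy (ltW P0) aT Tb) => // x' t' x'P t'T yp ym; apply: hy => // w.
have t'T' : a <= t' <= T by case/andP: t'T => /ltW->.
have [w' w'P /(_ (y ^~ t') (fun x => yP x t' (tab _ t'T'))) ->] := period_reduce w P0.
exact: ym.
Qed.

End joint_continuity.

(** * Comparison and uniqueness for the transformed equation *)

Section comparison.
Variables (R : realType) (g : nat -> R -> R) (eta A : R).
Hypothesis dg : forall k y, `|y| < eta -> der setT (g k) y (g k.+1 y).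
Hypothesis Aeta : A < eta.
Hypothesis A0 : 0 <= A.
Hypothesis bg : forall k, exists C, forall y, `|y| <= A -> `|g k y| <= C.
Hypothesis g0 : forall y, `|y| <= A -> 0 < g 0%N y.

Lemma g_lip k : exists2 L, 0 <= L & forall y z, `|y| <= A -> `|z| <= A -> `|g k y - g k z| <= L * `|y - z|.
Proof.
have [C hC] := bg k.+1; exists `|C| => // y z.
wlog zy : y z / z < y.
  move=> h yA zA; have [zy|] := ltP z y; first exact: h.
  rewrite le_eqVlt => /orP[/eqP->|yz]; first by rewrite !subrr normr0 mulr0.
  by rewrite distrC [`|y - z|]distrC; exact: h.
move=> yA zA; have yz x : z <= x <= y -> `|x| <= A.
  by move: yA zA; rewrite !ler_norml => /andP[_ h1] /andP[h2 _] /andP[h3 h4]; rewrite (le_trans h2)// (le_trans h4).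
have [|c [zc cy ->]] := @mvt _ (g k) (g k.+1) z y zy.
  by move=> x /yz xA; apply: dg; exact: le_lt_trans Aeta.
rewrite normrM ler_wpM2r//; apply: le_trans (ler_norm C); apply: hC.
by apply: yz; rewrite !ltW.
Qed.

(** The difference of the two values of [ca] may be attached to either second derivative, so a bound
    on one of them is enough; the sign of r2 - s2 disposes of the rest of the diffusion. *)
Lemma rhs_lip M1 M2 : 0 <= M1 -> 0 <= M2 -> exists2 L, 0 <= L & forall r s v r2 s2 : R,
  `|r| <= A -> `|s| <= A -> s < r -> `|v| <= M1 -> (`|r2| <= M2 \/ `|s2| <= M2) -> r2 <= s2 ->
  ca g r v * r2 + cb g r v - (ca g s v * s2 + cb g s v) <= L * (r - s).
Proof.
move=> M10 M20; have [L0 L00 h0] := g_lip 0%N; have [L1 L10 h1] := g_lip 1%N.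
exists (L0 * M2 + L1 * M1); first by rewrite addr_ge0// mulr_ge0.
move=> r s v r2 s2 rA sA sr vM rs2 rs.
have z0 := zeta_gt0 v; have z1 := zeta_le1 v.
have z3 : 0 <= zeta v ^+ 3 <= 1 by rewrite exprn_ge0 ?exprn_ile1 ?(ltW z0).
have nrs : `|r - s| = r - s by rewrite gtr0_norm// subr_gt0.
have d1 : cb g r v - cb g s v <= L1 * M1 * (r - s).
  rewrite /cb (_ : _ - _ = (g 1%N s - g 1%N r) * (v * (v * zeta v))); last by ring.
  apply: (le_trans (ler_norm _)); rewrite !normrM -normrM [`|g _ _ - _|]distrC -nrs.
  rewrite [L1 * M1 * _]mulrAC; apply: ler_pM => //; first exact: h1.
  by rewrite -[M1]mulr1; apply: ler_pM => //; exact: norm_vzeta.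
have d2 w : `|w| <= M2 -> (ca g r v - ca g s v) * w <= L0 * M2 * (r - s).
  move=> wM; rewrite /ca -mulrBl; apply: (le_trans (ler_norm _)); rewrite normrM [X in X * _]normrM -nrs.
  rewrite [L0 * M2 * _]mulrAC; apply: ler_pM => //.
  rewrite -[L0 * _]mulr1; apply: ler_pM => //; first exact: h0.
  by case/andP: z3 => z30 z31; rewrite ger0_norm.
have ca0 w : `|w| <= A -> 0 <= ca g w v.
  by move=> wA; rewrite /ca mulr_ge0 ?(ltW (g0 wA))//; case/andP: z3.
case: rs2 => w2.
  rewrite (_ : _ - _ = ca g s v * (r2 - s2) + (ca g r v - ca g s v) * r2 + (cb g r v - cb g s v)); last by ring.
  have := d2 _ w2; have : ca g s v * (r2 - s2) <= 0 by rewrite mulr_ge0_le0 ?ca0 ?subr_le0.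
  by rewrite mulrDl; lra.
rewrite (_ : _ - _ = ca g r v * (r2 - s2) + (ca g r v - ca g s v) * s2 + (cb g r v - cb g s v)); last by ring.
have := d2 _ w2; have : ca g r v * (r2 - s2) <= 0 by rewrite mulr_ge0_le0 ?ca0 ?subr_le0.
by rewrite mulrDl; lra.
Qed.

(** The regularity at which comparison works. It asks for less than [jsol], so that an arbitrary
    solution, written in the new coordinate, can be compared with a constructed one. *)
Record c21 (a b : R) (r r1 r2 rt : R -> R -> R) : Prop := C21 {
  c21_x : forall x t, a <= t < b -> der setT (r ^~ t) x (r1 x t);
  c21_xx : forall x t, a <= t < b -> der setT (r1 ^~ t) x (r2 x t);
  c21_t : forall x t, a < t < b -> der [set s | a <= s < b] (r x) t (rt x t);
  c21_per : forall x t, a <= t < b -> r (x + pi *+ 2) t = r x t;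
  c21_cont : jcont a b r
}.

Lemma c21W a b b' r r1 r2 rt : b' <= b -> c21 a b r r1 r2 rt -> c21 a b' r r1 r2 rt.
Proof.
move=> bb [h1 h2 h3 h4 h5].
have w t : a <= t < b' -> a <= t < b by move=> /andP[-> /lt_le_trans]; apply.
have w' t : a < t < b' -> a < t < b by move=> /andP[-> /lt_le_trans]; apply.
split=> [x t /w|x t /w|x t /w' tb|x t /w|]; [exact: h1|exact: h2| |exact: h4|exact: jcontW h5].
by apply: der_sub (h3 x t tb) => s /= /w.
Qed.

Lemma comparison a b T r r1 r2 rt s s1 s2 st M1 M2 : c21 a b r r1 r2 rt -> c21 a b s s1 s2 st ->
  a <= T -> T < b ->
  (forall x t, a <= t <= T -> `|r x t| <= A /\ `|s x t| <= A) ->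
  (forall x t, a < t <= T -> rt x t <= ca g (r x t) (r1 x t) * r2 x t + cb g (r x t) (r1 x t)) ->
  (forall x t, a < t <= T -> ca g (s x t) (s1 x t) * s2 x t + cb g (s x t) (s1 x t) <= st x t) ->
  (forall x t, a < t <= T -> `|r1 x t| <= M1 /\ `|r2 x t| <= M2) \/
  (forall x t, a < t <= T -> `|s1 x t| <= M1 /\ `|s2 x t| <= M2) ->
  (forall x, r x a <= s x a) -> forall x t, a <= t <= T -> r x t <= s x t.
Proof.
move=> cr cs aT Tb bA er es M rs0 x t tT.
have [L L0 hL] := rhs_lip (normr_ge0 M1) (normr_ge0 M2).
have p2 : 0 < pi *+ 2 :> R by rewrite mulrn_wgt0// pi_gt0.
(* The exponential factor turns the Lipschitz bound [L] into a strictly negative time derivative at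
   a positive maximum. *)
pose y x t := (r x t - s x t) * expR (- (L + 1) * t).
suff : y x t <= 0 by rewrite /y pmulr_lle0 ?expR_gt0// subr_le0.
have cE : continuous (fun t : R => expR (- (L + 1) * t)).
  move=> z; apply: (@cvg_comp _ _ _ (fun t => - (L + 1) * t) expR); last exact: continuous_expR.
  by apply: cvgM; [exact: cvg_cst|exact: cvg_id].
apply: (@max_principle_periodic _ a b (pi *+ 2) T y p2) => //.
- apply: jcont_mul; last exact: jcont_t.
  by apply: jcont_add; [exact: c21_cont cr|apply: jcont_opp; exact: c21_cont cs].
- by move=> z w wab; rewrite /y (c21_per cr)// (c21_per cs).
- by move=> z; rewrite /y pmulr_lle0 ?expR_gt0// subr_le0.
move=> z w wT yp ym.
have wab : a <= w < b by case/andP: wT => /ltW-> /= /le_lt_trans; apply.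
have wab' : a < w < b by case/andP: wT => -> /= /le_lt_trans; apply.
have wT' : a <= w <= T by case/andP: wT => /ltW->.
have dm z' : r z' w - s z' w <= r z w - s z w.
  by have := ym z'; rewrite /y ler_pM2r// expR_gt0.
have sr : s z w < r z w by move: yp; rewrite /y pmulr_lgt0 ?expR_gt0// subr_gt0.
have d1 := fun x => der_add (c21_x cr x wab) (der_opp (c21_x cs x wab)).
have d2 := der_add (c21_xx cr z wab) (der_opp (c21_xx cs z wab)).
have v0 : r1 z w - s1 z w = 0 by apply: der_max ltr01 _ (d1 z) => z' _; exact: dm.
have w0 : r2 z w - s2 z w <= 0 by apply: der2_max ltr01 _ d1 d2 => z' _; exact: dm.
have vE : s1 z w = r1 z w by apply/eqP; rewrite eq_sym -subr_eq0 v0.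
have dr := c21_t cr z wab'; have ds := c21_t cs z wab'.
exists ((rt z w - st z w - (L + 1) * (r z w - s z w)) * expR (- (L + 1) * w)).
  rewrite pmulr_llt0 ?expR_gt0//.
  have [bA1 bA2] := bA z w wT'.
  have := hL (r z w) (s z w) (r1 z w) (r2 z w) (s2 z w) bA1 bA2 sr.
  have h1 := er z w wT; have h2 := es z w wT; rewrite vE in h2.
  have hM : `|r1 z w| <= `|M1| /\ (`|r2 z w| <= `|M2| \/ `|s2 z w| <= `|M2|).
    case: M => /(_ z w wT)[m1 m2]; rewrite ?vE in m1.
      by split; [exact: le_trans m1 (ler_norm _)|left; exact: le_trans m2 (ler_norm _)].
    by split; [exact: le_trans m1 (ler_norm _)|right; exact: le_trans m2 (ler_norm _)].
  case: hM => m1 m2 /(_ m1 m2).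
  have -> : r2 z w <= s2 z w by rewrite -subr_le0.
  by move=> /(_ isT) h3; rewrite mulrDl mul1r; lra.
have dE : der [set s | a <= s < b] (fun t : R => expR (- (L + 1) * t)) w (expR (- (L + 1) * w) * - (L + 1)).
  apply: (der_comp (B := setT) (f := fun t => - (L + 1) * t)) => //.
    by der_ring.
  by apply/der_is_derive; exact: is_derive_expR.
by rewrite /y; der_ring.
Qed.

Lemma jsol_c21 a b u q : jsol g A a b u q -> c21 a b (u 0%N) (u 1%N) (u 2%N) (q 0%N).
Proof.
case=> h1 h2 h3 h4 h5 h6 h7; split=> [x t|x t|x t /andP[ta tb]|x t|]; [exact: h1|exact: h1| |exact: h5|].
  by apply: h2; rewrite (ltW ta).
by apply/jcontP => x t e tab e0; exact: h7.
Qed.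

Lemma jsol_jcont a b u q k : jsol g A a b u q -> jcont a b (u k).
Proof. by case=> _ _ _ _ _ _ h7; apply/jcontP => x t e tab e0; exact: h7. Qed.

Lemma jsol_bounded a b u q k T : jsol g A a b u q -> a <= T -> T < b ->
  exists M, forall x t, a <= t <= T -> `|u k x t| <= M.
Proof.
move=> su aT Tb; apply: (@jcont_periodic_bounded _ a b (u k) (pi *+ 2)) => //.
- by rewrite mulrn_wgt0// pi_gt0.
- exact: jsol_jcont su.
- by move=> x t; exact: js_per su k x t.
Qed.

(** The derivative bounds needed by [comparison] come from [u] alone on the compact interval [a, t];
    the competitor [r] only has to stay in [- A, A]. *)
Lemma jsol_uniq a b b' u q r r1 r2 rt : jsol g A a b u q -> c21 a b' r r1 r2 rt ->
  (forall x t, a <= t < b' -> `|r x t| <= A) ->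
  (forall x t, a < t < b' -> rt x t = ca g (r x t) (r1 x t) * r2 x t + cb g (r x t) (r1 x t)) ->
  (forall x, r x a = u 0%N x a) -> forall x t, a <= t -> t < b -> t < b' -> r x t = u 0%N x t.
Proof.
move=> su cr rA er r0 x t at_ tb tb'.
have [M1 hM1] := jsol_bounded 1 su at_ tb; have [M2 hM2] := jsol_bounded 2 su at_ tb.
pose c := Num.min b b'; have tc : t < c by rewrite lt_min tb.
have cb_ : c <= b by rewrite ge_min lexx.
have cb'_ : c <= b' by rewrite ge_min lexx orbT.
have cu := c21W cb_ (jsol_c21 su); have cr' := c21W cb'_ cr.
have wb s : a <= s <= t -> a <= s < b by move=> /andP[-> /le_lt_trans]; apply.
have wb' s : a <= s <= t -> a <= s < b' by move=> /andP[-> /le_lt_trans]; apply.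
have sw s : a < s <= t -> a <= s <= t by move=> /andP[/ltW->].
have ttt : a <= t <= t by rewrite at_ lexx.
have eu z s : a < s <= t -> q 0%N z s = ca g (u 0%N z s) (u 1%N z s) * u 2%N z s + cb g (u 0%N z s) (u 1%N z s).
  by move=> sT; apply: (js_eq su); apply: wb; exact: sw.
have er' z s : a < s <= t -> rt z s = ca g (r z s) (r1 z s) * r2 z s + cb g (r z s) (r1 z s).
  by move=> /andP[sa st]; apply: er; rewrite sa (le_lt_trans st).
have hM z s : a < s <= t -> `|u 1%N z s| <= M1 /\ `|u 2%N z s| <= M2.
  by move=> /sw sT; split; [exact: hM1|exact: hM2].
apply/eqP; rewrite eq_le; apply/andP; split.
  apply: (comparison (T := t) (M1 := M1) (M2 := M2) cr' cu) => //.
  - by move=> z s sT; split; [exact/rA/wb'|exact/(js_bd su)/wb].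
  - by move=> z s /er'->.
  - by move=> z s /eu->.
  - by right.
  - by move=> z; rewrite r0.
apply: (comparison (T := t) (M1 := M1) (M2 := M2) cu cr') => //.
- by move=> z s sT; split; [exact/(js_bd su)/wb|exact/rA/wb'].
- by move=> z s /eu->.
- by move=> z s /er'->.
- by left.
- by move=> z; rewrite r0.
Qed.

Lemma jsol_jet_uniq a b b' u q u' q' : jsol g A a b u q -> jsol g A a b' u' q' ->
  (forall x, u' 0%N x a = u 0%N x a) ->
  forall k x t, a <= t -> t < b -> t < b' -> u' k x t = u k x t /\ q' k x t = q k x t.
Proof.
move=> su su' e0 k x t at_ tb tb'.
have E s : a <= s -> s < b -> s < b' -> forall k x, u' k x s = u k x s.
  move=> as_ sb sb'; have sab : a <= s < b by rewrite as_.
  have sab' : a <= s < b' by rewrite as_.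
  elim=> [|i ih] z.
    apply: (jsol_uniq su (jsol_c21 su')) => //; first by move=> y w; exact: js_bd su' y w.
    by move=> y w /andP[/ltW aw wb]; apply: (js_eq su'); rewrite aw.
  apply: der_uniqT (js_dx su' i z sab') _.
  have -> : u' i ^~ s = u i ^~ s by apply/funext => y; exact: ih.
  exact: (js_dx su).
split; first exact: E.
elim: k x => [|i ih] x.
  by rewrite (js_eq su) ?(js_eq su') ?at_// !E.
apply: der_uniqT (js_qx su' i x (_ : a <= t < b')) _; first by rewrite at_.
have -> : q' i ^~ t = q i ^~ t by apply/funext => y; exact: ih.
by apply: js_qx su _ _ _ _; rewrite at_.
Qed.

End comparison.

(** * Bernstein estimates for the second and third derivatives *)

(** Algebraic core of the third derivative bound, with s = r_xx, p = r_xxx and weight 1 + k s^2. The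
    term - 2 a k p^4 (1 - 3 k s^2) is dissipative of order p^4, since 1 - 3 k s^2 >= 1/2; all others
    are of order |p|^3 and lose once |p| is large. *)
Lemma third_derivative_sign (R : realType) (a am k s p S3 c3 c2 S2 M2 C3 C2 CS DD : R) :
  0 < am -> am <= a -> 0 < k -> k * s ^+ 2 <= 1 / 6 -> k * M2 <= 1 -> `|s| <= M2 ->
  `|c3| <= C3 -> `|c2| <= C2 -> `|S2| <= CS -> `|S3| <= DD * p ^+ 2 -> 1 < `|p| ->
  3 * C3 + 2 * DD + 4 * (C2 + CS) < am * k * `|p| ->
  p * (- 2 * c3 * (1 + k * s ^+ 2) * k * s * p ^+ 2 + (1 + k * s ^+ 2) ^+ 2 * S3
    + 2 * k * s * p * (1 + k * s ^+ 2) * (c2 * p + S2) - 2 * a * k * p ^+ 3 * (1 - 3 * (k * s ^+ 2))) < 0.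
Proof.
move=> am0 aam k0 ks kM sM h3 h2 hS hS3 p1 hp.
have p0 : 0 < `|p| by rewrite (lt_trans ltr01).
have P0 : 0 < p ^+ 2 by rewrite -[p ^+ 2]real_normK ?num_real// exprn_gt0.
have f0 : 0 <= k * s ^+ 2 by rewrite mulr_ge0 ?sqr_ge0 ?ltW.
have C30 := le_trans (normr_ge0 _) h3; have C20 := le_trans (normr_ge0 _) h2; have CS0 := le_trans (normr_ge0 _) hS.
have ks1 : `|k * s| <= 1 by rewrite normrM gtr0_norm//; apply: le_trans kM; rewrite ler_pM2l.
set f := 1 + k * s ^+ 2; have ff : 0 <= f <= 7 / 6 by rewrite /f; lra.
have nf : `|f| <= 7 / 6 by case/andP: ff => h ?; rewrite ger0_norm.
have b1 : `|- 2 * c3 * f * k * s * p ^+ 2| <= 3 * C3 * p ^+ 2.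
  rewrite (_ : - 2 * _ * _ * _ * _ * _ = (- 2 * c3 * f * (k * s)) * p ^+ 2); last by ring.
  rewrite normrM [`|p ^+ 2|]gtr0_norm// ler_pM2r// normrM normrM normrM normrN normr_nat.
  apply: (@le_trans _ _ (2 * C3 * (7 / 6) * 1)); last by move: C30; clear; lra.
  by apply: ler_pM => //; apply: ler_pM => //; rewrite ?mulr_ge0//; apply: ler_pM.
have b2 : `|f ^+ 2 * S3| <= 2 * DD * p ^+ 2.
  rewrite normrM -mulrA; apply: ler_pM => //; rewrite normrX.
  apply: (@le_trans _ _ ((7 / 6) ^+ 2)); first by rewrite lerXn2r ?nnegrE//; lra.
  by rewrite expr2; lra.
have b3 : `|2 * k * s * p * f * (c2 * p + S2)| <= 4 * (C2 + CS) * p ^+ 2.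
  rewrite (_ : 2 * _ * _ * _ * _ * _ = (2 * f * (k * s)) * (p * (c2 * p + S2))); last by ring.
  rewrite normrM -[4 * _ * _]mulrA; apply: ler_pM => //.
    rewrite normrM normrM normr_nat; apply: (@le_trans _ _ (2 * (7 / 6) * 1)); last by lra.
    by apply: ler_pM => //; rewrite ?mulr_ge0//; apply: ler_pM.
  rewrite normrM -[p ^+ 2]real_normK ?num_real// expr2 mulrCA; apply: ler_pM => //.
  apply: (le_trans (ler_normD _ _)); rewrite normrM mulrDl; apply: lerD; first by apply: ler_pM.
  by rewrite -[`|S2|]mulr1; apply: ler_pM => //; exact: ltW.
set X := (X in p * (X - _)); have bX : `|X| <= (3 * C3 + 2 * DD + 4 * (C2 + CS)) * p ^+ 2.
  rewrite (_ : _ * p ^+ 2 = 3 * C3 * p ^+ 2 + 2 * DD * p ^+ 2 + 4 * (C2 + CS) * p ^+ 2); last by ring.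
  apply: (le_trans (ler_normD _ _)); apply: lerD => //.
  by apply: (le_trans (ler_normD _ _)); apply: lerD.
have h : p * X <= `|p| * ((3 * C3 + 2 * DD + 4 * (C2 + CS)) * p ^+ 2).
  by apply: (le_trans (ler_norm _)); rewrite normrM ler_pM2l.
have h' : `|p| * ((3 * C3 + 2 * DD + 4 * (C2 + CS)) * p ^+ 2) < am * k * p ^+ 4.
  have pp : `|p| * `|p| = p ^+ 2 by rewrite -expr2 real_normK ?num_real.
  set E := 3 * C3 + _ + _ in hp *.
  have -> : `|p| * (E * p ^+ 2) = E * `|p| * p ^+ 2 by ring.
  have -> : am * k * p ^+ 4 = am * k * `|p| * `|p| * p ^+ 2 by rewrite -[am * k * _ * _]mulrA pp; ring.
  by rewrite ltr_pM2r// ltr_pM2r.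
have h'' : am * k * p ^+ 4 <= 2 * a * k * p ^+ 4 * (1 - 3 * (k * s ^+ 2)).
  have P4 : 0 <= p ^+ 4 by rewrite exprn_even_ge0.
  rewrite (_ : 2 * a * k * p ^+ 4 * _ = a * k * (2 * (1 - 3 * (k * s ^+ 2))) * p ^+ 4); last by ring.
  have e1 : 1 <= 2 * (1 - 3 * (k * s ^+ 2)) by move: ks; clear; lra.
  rewrite ler_wpM2r// -[am * k]mulr1; apply: ler_pM => //; first by rewrite mulr_ge0 ?(ltW am0) ?(ltW k0).
  by rewrite ler_pM2r.
rewrite mulrBr (_ : p * (2 * a * k * p ^+ 3 * _) = 2 * a * k * p ^+ 4 * (1 - 3 * (k * s ^+ 2))); last by ring.
by move: h h' h''; clear; lra.
Qed.

Section bernstein.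
Variables (R : realType) (g : nat -> R -> R) (eta A : R).
Hypothesis dg : forall k y, `|y| < eta -> der setT (g k) y (g k.+1 y).
Hypothesis Aeta : A < eta.
Hypothesis bg : forall k, exists C, forall y, `|y| <= A -> `|g k y| <= C.
Variables (gmin gmax : R).
Hypothesis gmin0 : 0 < gmin.
Hypothesis ming : forall y, `|y| <= A -> gmin <= g 0%N y.
Hypothesis maxg : forall y, `|y| <= A -> g 0%N y <= gmax.

(** Maximum principle for G^2: at a spatial maximum above the threshold, G_x = 0 and G G_xx <= 0,
    and the hypothesis says that G^2 decreases. The bound involves only [K0] and the values at time
    [a], so it holds up to the open end [b]. *)
Lemma bernstein_principle a b P (G G1 G2 Gt : R -> R -> R) K0 : a < b -> 0 < P -> jcont a b G ->
  (forall x t, a <= t < b -> G (x + P) t = G x t) ->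
  (forall x t, a <= t < b -> der setT (G ^~ t) x (G1 x t)) ->
  (forall x t, a <= t < b -> der setT (G1 ^~ t) x (G2 x t)) ->
  (forall x t, a <= t < b -> der [set s | a <= s < b] (G x) t (Gt x t)) ->
  (forall x t, a <= t < b -> K0 < `|G x t| -> (forall z, `|G z t| <= `|G x t|) ->
     G1 x t = 0 -> G x t * G2 x t <= 0 -> G x t * Gt x t < 0) ->
  exists K, forall x t, a <= t < b -> `|G x t| <= K.
Proof.
move=> ab P0 cG GP dG dG1 dGt hG.
have [M hM] := jcont_periodic_bounded P0 cG (lexx a) ab GP.
have aab : a <= a < b by rewrite lexx.
pose K := Num.max `|K0| M; have K00 : 0 <= K by rewrite le_max normr_ge0.
exists K => x t /andP[at_ tb].
suff : G x t ^+ 2 - K ^+ 2 <= 0.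
  rewrite subr_le0 -[G x t ^+ 2]real_normK ?num_real// => h.
  by rewrite -(@ler_pXn2r _ 2)// nnegrE.
apply: (@max_principle_periodic _ a b P t (fun x t => G x t ^+ 2 - K ^+ 2) P0) => //.
- apply: jcont_add; first by under eq_fun do under eq_fun do rewrite expr2; exact: jcont_mul.
  by apply: (@jcont_x R a b (fun _ => - K ^+ 2)) => z; exact: cvg_cst.
- by move=> z s sab; rewrite GP.
- move=> z; rewrite subr_le0 -[G z a ^+ 2]real_normK ?num_real// lerXn2r ?nnegrE//.
  by rewrite le_max hM ?orbT// lexx.
- move=> z s /andP[as_ st] yp ym.
  have sab : a <= s < b by rewrite (ltW as_) (le_lt_trans st).
  have KG : K < `|G z s|.
    by rewrite -(@ltr_pXn2r _ 2) ?nnegrE// real_normK ?num_real// -subr_gt0.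
  have Gn0 : G z s != 0 by rewrite -normr_gt0 (le_lt_trans K00).
  have d1 w : der setT (fun y => G y s ^+ 2 - K ^+ 2) w (2 * (G w s * G1 w s)).
    by have h := dG w s sab; der_ring.
  have d2 : der setT (fun w => 2 * (G w s * G1 w s)) z (2 * (G1 z s ^+ 2 + G z s * G2 z s)).
    by have h1 := dG z s sab; have h2 := dG1 z s sab; der_ring.
  have e1 : G1 z s = 0.
    have := der_max ltr01 (fun w _ => ym w) (d1 z).
    by move/eqP; rewrite !mulf_eq0 (negPf Gn0) pnatr_eq0 /= => /eqP.
  have e2 : G z s * G2 z s <= 0.
    by have := der2_max ltr01 (fun w _ => ym w) d1 d2; rewrite e1; lra.
  exists (2 * (G z s * Gt z s)).
    rewrite pmulr_rlt0//; apply: hG => //.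
      by apply: le_lt_trans KG; rewrite le_max ler_norm.
    by move=> w; rewrite -(@ler_pXn2r _ 2) ?nnegrE// !real_normK ?num_real//; have := ym w; lra.
  by have h := dGt z s sab; der_ring.
- by rewrite at_ lexx.
Qed.

Variables (a b : R) (u q : nat -> R -> R -> R).
Hypothesis ab : a < b.
Hypothesis su : jsol g A a b u q.

Lemma jcont_coef k : jcont a b (fun x t => g k (u 0%N x t)) /\ jcont a b (fun x t => zeta (u 1%N x t)).
Proof.
split; apply: jcont_comp; try exact: jsol_jcont su.
  by move=> x t /(js_bd su x) h; apply: der_continuous (dg k _); exact: le_lt_trans h _.
by move=> x t _; exact: der_continuous (der_zeta _).
Qed.

(* Maximum principle for [r_t (1 + k r_x^2)]. *)
Lemma second_derivative_bound M : (forall x t, a <= t < b -> `|u 1%N x t| <= M) ->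
  exists K, forall x t, a <= t < b -> `|u 2%N x t| <= K.
Proof.
move=> hM.
have aab : a <= a < b by rewrite lexx.
have M0 : 0 <= M := le_trans (normr_ge0 _) (hM 0 a aab).
have [C1 hC1] := bg 1%N; have [C2 hC2] := bg 2%N.
have uA x t : a <= t < b -> `|u 0%N x t| <= A by move=> tab; exact: js_bd su x t tab.
have C10 : 0 <= C1 := le_trans (normr_ge0 _) (hC1 _ (uA 0 a aab)).
have C20 : 0 <= C2 := le_trans (normr_ge0 _) (hC2 _ (uA 0 a aab)).
pose am := gmin * zeta M ^+ 3.
have am0 : 0 < am by rewrite mulr_gt0// exprn_gt0// zeta_gt0.
(* This makes k v^2 <= 1/6, so the weight 1 + k v^2 stays in [1, 7/6] and 1 - 3 k v^2 >= 1/2. *)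
pose k : R := (6 * (M ^+ 2 + 1))^-1.
have k0 : 0 < k by rewrite invr_gt0 mulr_gt0// ltr_wpDl// sqr_ge0.
have kM : k * M ^+ 2 <= 1 / 6.
  rewrite /k invfM -mulrA [1 / 6]mulrC ler_pM2l ?invr_gt0//.
  by rewrite mulrC ler_pdivrMr ?mul1r ?lerDl ?ltr_wpDl ?sqr_ge0//; lra.
pose Q x t := ca g (u 0%N x t) (u 1%N x t) * u 2%N x t + cb g (u 0%N x t) (u 1%N x t).
pose G x t := Q x t * (1 + k * u 1%N x t ^+ 2).
have Qq x t : a <= t < b -> q 0%N x t = Q x t by move=> tab; rewrite (js_eq su).
have dQ x t : a <= t < b -> der setT (Q ^~ t) x (q 1%N x t).
  move=> tab; have := js_qx su 0 x tab; have -> // : q 0%N ^~ t = Q ^~ t.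
  by apply/funext => y; exact: Qq.
pose G1 x t := q 1%N x t * (1 + k * u 1%N x t ^+ 2) + Q x t * (2 * k * u 1%N x t * u 2%N x t).
pose G2 x t := q 2%N x t * (1 + k * u 1%N x t ^+ 2) + 2 * q 1%N x t * (2 * k * u 1%N x t * u 2%N x t)
  + Q x t * (2 * k * u 2%N x t ^+ 2 + 2 * k * u 1%N x t * u 3%N x t).
pose Qt x t := (ca_r g (u 0%N x t) (u 1%N x t) * Q x t + ca_v g (u 0%N x t) (u 1%N x t) * q 1%N x t) * u 2%N x t
  + ca g (u 0%N x t) (u 1%N x t) * q 2%N x t + cb_r g (u 0%N x t) (u 1%N x t) * Q x t
  + cb_v g (u 0%N x t) (u 1%N x t) * q 1%N x t.
pose Gt x t := Qt x t * (1 + k * u 1%N x t ^+ 2) + Q x t * (2 * k * u 1%N x t * q 1%N x t).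
have uA' x t : a <= t < b -> `|u 0%N x t| < eta by move=> tab; exact: le_lt_trans (uA _ _ tab) Aeta.
have q1E x t : a <= t < b -> q 1%N x t = (ca_r g (u 0%N x t) (u 1%N x t) * u 1%N x t
    + ca_v g (u 0%N x t) (u 1%N x t) * u 2%N x t) * u 2%N x t + ca g (u 0%N x t) (u 1%N x t) * u 3%N x t
    + (cb_r g (u 0%N x t) (u 1%N x t) * u 1%N x t + cb_v g (u 0%N x t) (u 1%N x t) * u 2%N x t).
  move=> tab; apply: der_uniqT (dQ x t tab) _.
  have e0 := js_dx su 0 x tab; have e1 := js_dx su 1 x tab; have e2 := js_dx su 2 x tab.
  exact: der_add (der_mul (der_ca dg (uA' x t tab) e0 e1) e2) (der_cb dg (uA' x t tab) e0 e1).
(* The threshold inverts |Q| <= gmax |w| + C1 M, where w = r_xx: above it |w| is so large that the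
   dissipative term, quadratic in w, beats the linear ones. The outer factor 2 covers the weight. *)
have [|||x t tab|x t tab|x t tab|x t tab KG Gm g10 GG2|K hK] :=
    @bernstein_principle a b (pi *+ 2) G G1 G2 Gt (2 * (gmax * (1 + 2 * (2 * (C1 + C2 * M)) / (am * k)) + C1 * M)) ab.
- by rewrite mulrn_wgt0// pi_gt0.
- have [c0 z0] := jcont_coef 0%N; have [c1 _] := jcont_coef 1%N.
  have j1 : jcont a b (u 1%N) := jsol_jcont (k := 1%N) su; have j2 : jcont a b (u 2%N) := jsol_jcont (k := 2%N) su.
  have j11 : jcont a b (fun x t => u 1%N x t ^+ 2).
    by under eq_fun do under eq_fun do rewrite expr2; exact: jcont_mul.
  have cc (c : R) : jcont a b (fun _ _ => c) by apply: (@jcont_x R a b (fun _ => c)) => z; exact: cvg_cst.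
  apply: jcont_mul; last by apply: jcont_add => //; exact: jcont_mul.
  apply: jcont_add.
    apply: jcont_mul => //; apply: jcont_mul => //.
    exact: (jcont_mul z0 (jcont_mul z0 z0)).
  by apply: jcont_mul => //; apply: jcont_mul => //; exact: jcont_opp.
- by move=> x t tab; rewrite /G /Q !(js_per su).
- have h1 := dQ x t tab; have h2 := js_dx su 1 x tab.
  by rewrite /G /G1; der_ring.
- have h1 := dQ x t tab; have h2 := js_dx su 1 x tab; have h3 := js_dx su 2 x tab; have h4 := js_qx su 1 x tab.
  by rewrite /G1 /G2; der_ring.
- have d0 := js_dt su 0 x tab; have d1 := js_dt su 1 x tab; have d2 := js_dt su 2 x tab.
  have h1 := der_ca dg (uA' x t tab) d0 d1; have h2 := der_cb dg (uA' x t tab) d0 d1.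
  rewrite (Qq x t tab) in h1 h2.
  by rewrite /G /Gt /Qt /Q; eapply der_eq; [der_t|rewrite /= expr1 /Q; ring].
- have vM := hM x t tab; have u0A := uA x t tab; have q1e := q1E x t tab.
  move: KG g10 GG2; rewrite /G /G1 /G2 /Gt /Qt.
  have /andP[ac1 ac2] := ca_bounds gmin0 ming maxg u0A vM.
  set v := u 1%N x t in vM q1e ac1 ac2 *; set w := u 2%N x t in q1e *; set u3 := u 3%N x t in q1e *.
  have Qe : Q x t = ca g (u 0%N x t) v * w + cb g (u 0%N x t) v by [].
  set QQ := Q x t in Qe *.
  set ac := ca g (u 0%N x t) v in ac1 ac2 Qe q1e *; set acr := ca_r g (u 0%N x t) v in q1e *.
  set acv := ca_v g (u 0%N x t) v in q1e *; set bcr := cb_r g (u 0%N x t) v in q1e *.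
  set bcv := cb_v g (u 0%N x t) v in q1e *; set bc := cb g (u 0%N x t) v in Qe *.
  set q1 := q 1%N x t in q1e *; set q2 := q 2%N x t.
  have z0 := zeta_gt0 v; have z1 := zeta_le1 v.
  have bb : `|bc| <= C1 * M.
    rewrite /bc /cb (_ : _ * zeta v = - g 1%N (u 0%N x t) * (v * (v * zeta v))); last by ring.
    rewrite !normrM normrN -normrM; apply: ler_pM => //; first exact: hC1.
    by rewrite -[M]mulr1; apply: ler_pM => //; exact: norm_vzeta.
  have br : `|bcr| <= C2 * M.
    rewrite /bcr /cb_r (_ : _ * zeta v = - g 2%N (u 0%N x t) * (v * (v * zeta v))); last by ring.
    rewrite !normrM normrN -normrM; apply: ler_pM => //; first exact: hC2.
    by rewrite -[M]mulr1; apply: ler_pM => //; exact: norm_vzeta.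
  have ar : `|acr| <= C1.
    rewrite /acr /ca_r normrM -[C1]mulr1; apply: ler_pM => //; first exact: hC1.
    by rewrite normrX exprn_ile1// norm_zeta.
  clearbody v w u3 QQ ac acr acv bcr bcv bc q1 q2.
  move=> KG g10 GG2.
  have vv : 0 <= k * v ^+ 2 <= 1 / 6.
    rewrite mulr_ge0 ?(ltW k0) ?sqr_ge0//=; apply: le_trans kM; rewrite ler_pM2l//.
    by rewrite -[v ^+ 2]real_normK ?num_real// lerXn2r// ?nnegrE.
  have QK : gmax * (1 + 2 * (2 * (C1 + C2 * M)) / (am * k)) + C1 * M < `|QQ|.
    have : `|QQ * (1 + k * v ^+ 2)| <= `|QQ| * 2.
      by rewrite normrM ler_wpM2l// ger0_norm; lra.
    by lra.
  have W0 : 0 <= 2 * (2 * (C1 + C2 * M)) / (am * k).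
    apply: divr_ge0; last by rewrite mulr_ge0 ?(ltW k0) ?(ltW am0).
    by rewrite !mulr_ge0// addr_ge0// mulr_ge0.
  have wW : 1 + 2 * (2 * (C1 + C2 * M)) / (am * k) < `|w|.
    have ac0 : 0 < ac := lt_le_trans am0 ac1.
    have : `|QQ| <= gmax * `|w| + C1 * M.
      rewrite Qe; apply: (le_trans (ler_normD _ _)); apply: lerD => //.
      by rewrite normrM ger0_norm ?(ltW ac0)// ler_wpM2r.
    move=> h; have : gmax * (1 + 2 * (2 * (C1 + C2 * M)) / (am * k)) < gmax * `|w| by lra.
    by rewrite ltr_pM2l// (lt_le_trans ac0).
  have Q0 : 0 < QQ ^+ 2.
    rewrite exprn_even_gt0//= -normr_gt0; apply: le_lt_trans QK.
    rewrite addr_ge0 ?mulr_ge0 ?addr_ge0//.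
    exact: le_trans (ltW am0) (le_trans ac1 ac2).
  have w1 : 1 < `|w| by lra.
  have E0 : (1 + k * v ^+ 2) * (1 + 3 * (k * v ^+ 2)) * (acr * w + bcr) - ac * w ^+ 2 * (2 * k * (1 - 3 * (k * v ^+ 2))) < 0.
    have wp : 0 < `|w| by lra.
    have t1 : (1 + k * v ^+ 2) * (1 + 3 * (k * v ^+ 2)) * (acr * w + bcr) <= 2 * ((C1 + C2 * M) * `|w|).
      apply: (le_trans (ler_norm _)); rewrite normrM; apply: ler_pM => //.
        rewrite ger0_norm; first by nra.
        by rewrite mulr_ge0//; lra.
      apply: (le_trans (ler_normD _ _)); rewrite normrM mulrDl; apply: lerD; first by rewrite ler_wpM2r.
      by apply: (le_trans br); rewrite ler_peMr ?mulr_ge0// ltW.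
    have t2 : am * k * `|w| ^+ 2 <= ac * w ^+ 2 * (2 * k * (1 - 3 * (k * v ^+ 2))).
      rewrite real_normK ?num_real// mulrAC; apply: ler_pM => //.
      + by rewrite mulr_ge0 ?sqr_ge0 ?ltW.
      + exact: ltW.
      + by rewrite ler_wpM2r ?sqr_ge0.
      + rewrite mulrAC ler_peMl ?(ltW k0)//; lra.
    have t3 : 2 * (2 * (C1 + C2 * M)) < am * k * `|w|.
      rewrite [ltRHS]mulrC -(ltr_pdivrMr _ _ (mulr_gt0 am0 k0)).
      by apply: lt_trans wW; rewrite ltrDr.
    have : 2 * (2 * (C1 + C2 * M)) * `|w| < am * k * `|w| * `|w| by rewrite (ltr_pM2r wp).
    have : 0 <= (C1 + C2 * M) * `|w| by rewrite mulr_ge0// addr_ge0// mulr_ge0.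
    by move: t2; rewrite expr2; lra.
  set Gt' := (X in QQ * _ * X).
  set GG := (X in QQ * (1 + k * v ^+ 2) * X <= 0) in GG2.
  (* Subtracting [ac] times G_xx removes q2. Of the leftover brackets, the first is G_x, which
     vanishes at the maximum, and the second vanishes by the equation differentiated in x, which
     eliminates u3. *)
  have key : (1 + k * v ^+ 2) * (Gt' - ac * GG) = QQ * ((1 + k * v ^+ 2) * (1 + 3 * (k * v ^+ 2)) * (acr * w + bcr)
      - ac * w ^+ 2 * (2 * k * (1 - 3 * (k * v ^+ 2))))
      + ((1 + k * v ^+ 2) * (acv * w + bcv) - 4 * k * ac * v * w) * (q1 * (1 + k * v ^+ 2) + QQ * (2 * k * v * w))
      + 2 * k * v * QQ * (1 + k * v ^+ 2) * (q1 - ((acr * v + acv * w) * w + ac * u3 + (bcr * v + bcv * w))).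
    by rewrite /Gt' /GG; ring.
  rewrite g10 q1e subrr !mulr0 !addr0 in key.
  have -> : QQ * (1 + k * v ^+ 2) * Gt' = ac * (QQ * (1 + k * v ^+ 2) * GG) + QQ * ((1 + k * v ^+ 2) * (Gt' - ac * GG)) by ring.
  rewrite key [QQ * (QQ * _)]mulrA -expr2.
  have h1 : ac * (QQ * (1 + k * v ^+ 2) * GG) <= 0.
    by rewrite mulr_ge0_le0// (le_trans (ltW am0)).
  have h2 := nmulr_llt0 (QQ ^+ 2) E0.
  have : QQ ^+ 2 * ((1 + k * v ^+ 2) * (1 + 3 * (k * v ^+ 2)) * (acr * w + bcr)
      - ac * w ^+ 2 * (2 * k * (1 - 3 * (k * v ^+ 2)))) < 0 by rewrite pmulr_rlt0.
  by move=> h3; rewrite -[ltRHS]addr0 ler_ltD.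
(* The bound on r_t becomes one on r_xx by solving the equation for it, with [ca] bounded below by
   [am]. *)
exists ((`|K| + C1 * M) / am) => x t tab.
have vM := hM x t tab; have u0A := uA x t tab.
have /andP[ac1 ac2] := ca_bounds gmin0 ming maxg u0A vM.
have QK : `|Q x t| <= `|K|.
  apply: le_trans (le_trans (hK x t tab) (ler_norm K)).
  have f1 : 1 <= 1 + k * u 1%N x t ^+ 2 by rewrite lerDl mulr_ge0 ?sqr_ge0 ?(ltW k0).
  by rewrite /G [X in _ <= X]normrM ler_peMr// (le_trans f1)// ler_norm.
have bb : `|cb g (u 0%N x t) (u 1%N x t)| <= C1 * M.
  rewrite /cb (_ : _ * zeta _ = - g 1%N (u 0%N x t) * (u 1%N x t * (u 1%N x t * zeta (u 1%N x t)))); last by ring.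
  rewrite !normrM normrN -normrM; apply: ler_pM => //; first exact: hC1.
  by rewrite -[M]mulr1; apply: ler_pM => //; exact: norm_vzeta.
have ac0 : 0 < ca g (u 0%N x t) (u 1%N x t) := lt_le_trans am0 ac1.
rewrite ler_pdivlMr// mulrC; apply: (@le_trans _ _ (ca g (u 0%N x t) (u 1%N x t) * `|u 2%N x t|)).
  by rewrite ler_wpM2r.
rewrite -{1}[ca _ _ _]gtr0_norm// -normrM.
have -> : ca g (u 0%N x t) (u 1%N x t) * u 2%N x t = Q x t - cb g (u 0%N x t) (u 1%N x t) by rewrite /Q; ring.
by apply: (le_trans (ler_normB _ _)); exact: lerD.
Qed.

(* Maximum principle for [r_xxx (1 + k r_xx^2)]. *)
Lemma third_derivative_bound M : (forall x t, a <= t < b -> `|u 1%N x t| <= M) ->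
  exists K, forall x t, a <= t < b -> `|u 3%N x t| <= K.
Proof.
have ph (z : R) : 0 <= z <= 1 / 6 -> 1 <= 1 + z <= 7 / 6 by lra.
have pD (p f K : R) : 1 <= f <= 7 / 6 -> 2 * K < `|p| * `|f| -> K < `|p|.
  by move=> hf; have := normr_ge0 p; rewrite [`|f|]ger0_norm; nra.
have pE (x y : R) : 0 <= x -> 0 <= y -> 2 * (3 * (x + y)) <= 18 * (2 * x + y) by lra.
have pF (x : R) : 1 + x <= 7 / 6 -> x <= 1 / 6 by lra.
have pN (p p' f f' : R) : 1 <= f <= 7 / 6 -> 1 <= f' <= 7 / 6 -> `|p| * `|f| <= `|p'| * `|f'| -> `|p| <= 2 * `|p'|.
  move=> hf hf'; have := normr_ge0 p; have := normr_ge0 p'.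
  by rewrite [`|f|]ger0_norm ?[`|f'|]ger0_norm; nra.
move=> hM; have [M2 hM2] := second_derivative_bound hM.
have aab : a <= a < b by rewrite lexx.
have M0 : 0 <= M := le_trans (normr_ge0 _) (hM 0 a aab).
have M20 : 0 <= M2 := le_trans (normr_ge0 _) (hM2 0 a aab).
have uA x t : a <= t < b -> `|u 0%N x t| <= A by move=> tab; exact: js_bd su x t tab.
have uA' x t : a <= t < b -> `|u 0%N x t| < eta by move=> tab; exact: le_lt_trans (uA _ _ tab) Aeta.
pose J := {t : R | a <= t < b}.
(* The family is indexed by time and the growth parameter is the supremum of |r_xxx| at that time,
   so [tame] bounds remainders linearly in this supremum. *)
pose N (i : J) := sup [set `|u 3%N x (sval i)| | x in [set: R]].
have hN (i : J) x : `|u 3%N x (sval i)| <= N i.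
  apply: ub_le_sup; last by exists x.
  case: i => t /= /andP[ta tb]; have [C hC] := jsol_bounded 3 su ta tb.
  by exists C => _ [y _ <-]; apply: hC; rewrite ta lexx.
have N0 i : 0 <= N i := le_trans (normr_ge0 _) (hN i 0).
have N1 : exists C, forall (i : J) x, `|u 3%N x (sval i)| <= C * (1 + N i).
  by exists 1 => i x; rewrite mul1r (le_trans (hN i x))// lerDr.
have du (i : J) k x : der setT (u k ^~ (sval i)) x (u k.+1 x (sval i)).
  exact: (js_dx su) (svalP i).
have b0 : bdd (fun (i : J) x => u 0%N x (sval i)) by exists A => i x; exact: uA (svalP i).
have b1 : bdd (fun (i : J) x => u 1%N x (sval i)) by exists M => i x; exact: hM (svalP i).
have b2 : bdd (fun (i : J) x => u 2%N x (sval i)) by exists M2 => i x; exact: hM2 (svalP i).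
have t0 : tame N 3 (fun i x => u 0%N x (sval i)).
  by apply: (@tame_jet _ J N 3 (fun i k x => u k x (sval i))) => // -[|[|[|//]]].
have t1 : tame N 2 (fun i x => u 1%N x (sval i)).
  by apply: (@tame_jet _ J N 2 (fun i k x => u k.+1 x (sval i))) => // -[|[|//]].
have [||||c [S [tc tS] q2E]] := @rhs_expand _ g eta A dg Aeta bg J N (fun i k x => u k x (sval i))
    (fun i k x => u k.+1 x (sval i)) 2 N0 du _ _ t0 t1 isT (fun i k x => q k x (sval i)) _ _ 2 isT (Or33 _ _ isT).
- by move=> i k x; exact: du.
- by move=> i x; exact: uA (svalP i).
- by move=> i; apply/funext => x; exact: (js_eq su) (svalP i).
- by move=> i k x; exact: (js_qx su) (svalP i).
have [_ tar tav _ _] := @tame_coefs _ g eta A dg Aeta bg J N (fun i k x => u k x (sval i))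
    (fun i k x => u k.+1 x (sval i)) 2 N0 (fun i x => uA _ _ (svalP i)) t0 t1 isT.
have [Cr hCr] := tame_bdd tar; have [Cv hCv] := tame_bdd tav.
case: tc => -[C2 hC2] [c' dc [D2 hD2]]; case: tS => -[CS hCS] [S' dS [DS hDS]].
pose am := gmin * zeta M ^+ 3.
have am0 : 0 < am by rewrite mulr_gt0// exprn_gt0// zeta_gt0.
pose k : R := (6 * (M2 ^+ 2 + 1))^-1.
have k0 : 0 < k by rewrite invr_gt0 mulr_gt0// ltr_wpDl// sqr_ge0.
have kM : k * M2 ^+ 2 <= 1 / 6.
  rewrite /k invfM -mulrA [1 / 6]mulrC ler_pM2l ?invr_gt0//.
  by rewrite mulrC ler_pdivrMr ?mul1r ?lerDl ?ltr_wpDl ?sqr_ge0//; lra.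
have kM1 : k * M2 <= 1.
  rewrite /k mulrC ler_pdivrMr ?mulr_gt0 ?ltr_wpDl ?sqr_ge0// mul1r.
  by have := sqr_ge0 (M2 - 1); rewrite sqrrB1 -mulr_natr; nra.
(* With l = 2 and unbounded [N], [rhs_expand] stops at j = 2; the third derivative is obtained by
   differentiating its result once more. The derivatives of [c] and [S] then grow linearly in [N],
   and [q3] at most quadratically. *)
have [q3 q3E] : exists q3 : R -> R -> R, forall x t (tab : a <= t < b), let i := exist _ t tab : J in
    q 3%N x t = ca g (u 0%N x t) (u 1%N x t) * u 5%N x t
    + (ca_r g (u 0%N x t) (u 1%N x t) * u 1%N x t + ca_v g (u 0%N x t) (u 1%N x t) * u 2%N x t + c i x) * u 4%N x t
    + q3 x t /\ q3 x t = c' i x * u 3%N x t + S' i x.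
  exists (fun x t => if pselect (a <= t < b) is left tab then
      c' (exist _ t tab) x * u 3%N x t + S' (exist _ t tab) x else 0).
  move=> x t tab /=; case: pselect => [tab'|//]; rewrite (Prop_irrelevance tab' tab); split=> //.
  apply: der_uniqT (js_qx su 2%N x tab) _.
  have -> : q 2%N ^~ t = (fun x => ca g (u 0%N x t) (u 1%N x t) * u 4%N x t + c (exist _ t tab) x * u 3%N x t
      + S (exist _ t tab) x) by apply/funext => y; exact: (q2E (exist _ t tab)).
  have h1 := der_ca dg (uA' x t tab) (js_dx su 0%N x tab) (js_dx su 1%N x tab).
  have h2 := dc (exist _ t tab) x; have h3 := dS (exist _ t tab) x.
  have h4 := js_dx su 4%N x tab; have h5 := js_dx su 3%N x tab.
  by apply: der_eq (der_add (der_add (der_mul h1 h4) (der_mul h2 h5)) h3) _; ring.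
pose G x t := u 3%N x t * (1 + k * u 2%N x t ^+ 2).
pose G1 x t := u 4%N x t * (1 + k * u 2%N x t ^+ 2) + 2 * k * u 2%N x t * u 3%N x t ^+ 2.
pose G2 x t := u 5%N x t * (1 + k * u 2%N x t ^+ 2) + 6 * k * u 2%N x t * u 3%N x t * u 4%N x t
  + 2 * k * u 3%N x t ^+ 3.
pose Gt x t := q 3%N x t * (1 + k * u 2%N x t ^+ 2) + 2 * k * u 2%N x t * u 3%N x t * q 2%N x t.
pose D := 3 * (Cr * M + Cv * M2 + C2) + 18 * (2 * D2 + DS) + 4 * (C2 + CS).
have [|||x t tab|x t tab|x t tab|x t tab KG Gm g10 GG2|K hK] :=
    @bernstein_principle a b (pi *+ 2) G G1 G2 Gt (2 * (1 + D / (am * k))) ab.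
- by rewrite mulrn_wgt0// pi_gt0.
- have j3 : jcont a b (u 3%N) := jsol_jcont (k := 3%N) su; have j2 : jcont a b (u 2%N) := jsol_jcont (k := 2%N) su.
  have cc (d : R) : jcont a b (fun _ _ => d) by apply: (@jcont_x R a b (fun _ => d)) => z; exact: cvg_cst.
  apply: jcont_mul => //; apply: jcont_add => //; apply: jcont_mul => //.
  by under eq_fun do under eq_fun do rewrite expr2; exact: jcont_mul.
- by move=> x t tab; rewrite /G !(js_per su).
- have h2 := js_dx su 2%N x tab; have h3 := js_dx su 3%N x tab.
  by rewrite /G /G1; der_ring.
- have h2 := js_dx su 2%N x tab; have h3 := js_dx su 3%N x tab; have h4 := js_dx su 4%N x tab.
  by rewrite /G1 /G2; der_ring.
- have h2 := js_dt su 2%N x tab; have h3 := js_dt su 3%N x tab.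
  by rewrite /G /Gt; der_ring.
- have vM := hM x t tab; have wM := hM2 x t tab; have u0A := uA x t tab.
  have [q3e q3e'] := q3E x t tab; have q2e := q2E (exist _ t tab) x.
  have /andP[ac1 ac2] := ca_bounds gmin0 ming maxg u0A vM.
  have hNx := hN (exist _ t tab).
  have arb := hCr (exist _ t tab) x; have avb := hCv (exist _ t tab) x.
  have cb := hC2 (exist _ t tab) x; have cb' := hD2 (exist _ t tab) x.
  have Sb := hCS (exist _ t tab) x; have Sb' := hDS (exist _ t tab) x.
  have C20 := le_trans (normr_ge0 _) cb; have CS0 := le_trans (normr_ge0 _) Sb.
  have Cr0 := le_trans (normr_ge0 _) arb; have Cv0 := le_trans (normr_ge0 _) avb.
  have phib z : 1 <= 1 + k * u 2%N z t ^+ 2 <= 7 / 6.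
    have : 0 <= k * u 2%N z t ^+ 2 <= 1 / 6.
      rewrite mulr_ge0 ?(ltW k0) ?sqr_ge0//=; apply: le_trans kM; rewrite ler_pM2l//.
      by rewrite -[_ ^+ 2]real_normK ?num_real// lerXn2r// ?nnegrE//; exact: hM2.
    exact: ph.
  (* At a maximum of |G| the weights, all in [1, 7/6], make |r_xxx| at this point comparable to its
     supremum, so bounds in [N] become bounds in |r_xxx|. *)
  have N2 : N (exist _ t tab) <= 2 * `|u 3%N x t|.
    apply: ge_sup; first by exists `|u 3%N 0 t|; exists 0.
    move=> _ [z _ <-] /=; have := Gm z; rewrite /G !normrM.
    exact: pN (phib z) (phib x).
  have f0 : 1 <= 1 + k * u 2%N x t ^+ 2 <= 7 / 6 := phib x.
  have D0 : 0 <= D2 /\ 0 <= DS.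
    have n1 : 0 < 1 + N (exist _ t tab) by rewrite ltr_wpDr.
    by split; rewrite -(pmulr_lge0 _ n1) (le_trans (normr_ge0 _) cb', le_trans (normr_ge0 _) Sb').
  have D00 : 0 <= D.
    by case: D0 => d1 d2; rewrite /D !addr_ge0 ?mulr_ge0 ?addr_ge0 ?mulr_ge0.
  have DK : 1 + D / (am * k) < `|u 3%N x t|.
    move: KG; rewrite /G normrM => KG.
    exact: pD f0 KG.
  have D1 : 0 <= D / (am * k) by rewrite divr_ge0// mulr_ge0// ltW.
  have p1 : 1 < `|u 3%N x t| by apply: le_lt_trans DK; rewrite lerDl.
  have S3b : `|q3 x t| <= 3 * (D2 + DS) * u 3%N x t ^+ 2.
    rewrite q3e' -[u 3%N x t ^+ 2]real_normK ?num_real//; apply: (le_trans (ler_normD _ _)).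
    have n3 : 1 + N (exist _ t tab) <= 3 * `|u 3%N x t| by rewrite -[3](natrD _ 1 2) mulrDl mul1r lerD// ltW.
    case: D0 => d1 d2; have e1 : `|c' (exist _ t tab) x| <= 3 * D2 * `|u 3%N x t|.
      by apply: (le_trans cb'); rewrite [3 * _]mulrC -mulrA ler_wpM2l.
    have e2 : `|S' (exist _ t tab) x| <= 3 * DS * `|u 3%N x t|.
      by apply: (le_trans Sb'); rewrite [3 * _]mulrC -mulrA ler_wpM2l.
    rewrite normrM mulrDr mulrDl; apply: lerD; rewrite expr2 mulrA.
      by rewrite ler_wpM2r.
    by apply: (le_trans e2); rewrite ler_peMr ?(ltW p1)// !mulr_ge0.
  have c3b : `|ca_r g (u 0%N x t) (u 1%N x t) * u 1%N x t + ca_v g (u 0%N x t) (u 1%N x t) * u 2%N x t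
      + c (exist _ t tab) x| <= Cr * M + Cv * M2 + C2.
    apply: (le_trans (ler_normD _ _)); apply: lerD => //.
    apply: (le_trans (ler_normD _ _)); rewrite [`|_ * u 1%N x t|]normrM [`|_ * u 2%N x t|]normrM.
    by apply: lerD; apply: ler_pM.
  have am0' : 0 < ca g (u 0%N x t) (u 1%N x t) by exact: lt_le_trans ac1.
  have ks : k * u 2%N x t ^+ 2 <= 1 / 6 by case/andP: f0 => _; exact: pF.
  have := third_derivative_sign am0 ac1 k0 ks kM1 wM c3b cb Sb S3b p1.
  have -> : 3 * (Cr * M + Cv * M2 + C2) + 2 * (3 * (D2 + DS)) + 4 * (C2 + CS) < am * k * `|u 3%N x t|.
    have : D < am * k * `|u 3%N x t|.
      by rewrite [ltRHS]mulrC -(ltr_pdivrMr _ _ (mulr_gt0 am0 k0)); apply: lt_trans DK; rewrite ltrDr.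
    by apply: le_lt_trans; rewrite /D lerD2r lerD2l; case: D0; exact: pE.
  move=> /(_ isT); move: g10 GG2; rewrite /G1 /G2 /G /Gt q3e q2e.
  set v := u 1%N x t; set w := u 2%N x t; set p := u 3%N x t; set u4 := u 4%N x t; set u5 := u 5%N x t.
  rewrite -/v -/w -/p.
  set ac := ca _ _ _ in am0' *; set acr := ca_r _ _ _; set acv := ca_v _ _ _; set c0 := c _ _; set S0 := S _ _.
  set s3 := q3 _ _; move: am0'; clear; move=> ac0 g10 h1 h2.
  set GG := (X in p * _ * X <= 0) in h1.
  set GT := (X in p * _ * X < 0).
  have key : (1 + k * w ^+ 2) * (GT - ac * GG) =
      (- 2 * (acr * v + acv * w + c0) * (1 + k * w ^+ 2) * k * w * p ^+ 2 + (1 + k * w ^+ 2) ^+ 2 * s3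
    + 2 * k * w * p * (1 + k * w ^+ 2) * (c0 * p + S0) - 2 * ac * k * p ^+ 3 * (1 - 3 * (k * w ^+ 2)))
     + ((acr * v + acv * w + c0) * (1 + k * w ^+ 2) - 4 * ac * k * w * p) * (u4 * (1 + k * w ^+ 2) + 2 * k * w * p ^+ 2).
    by rewrite /GT /GG; ring.
  rewrite g10 mulr0 addr0 in key; rewrite -key in h2.
  have -> : p * (1 + k * w ^+ 2) * GT = ac * (p * (1 + k * w ^+ 2) * GG) + p * ((1 + k * w ^+ 2) * (GT - ac * GG)) by ring.
  by rewrite -[ltRHS]addr0 ler_ltD// mulr_ge0_le0// ltW.
exists `|K| => x t tab.
apply: le_trans (le_trans (hK x t tab) (ler_norm K)).
have f1 : 1 <= 1 + k * u 2%N x t ^+ 2 by rewrite lerDl mulr_ge0 ?sqr_ge0 ?(ltW k0).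
by rewrite /G [X in _ <= X]normrM ler_peMr// (le_trans f1)// ler_norm.
Qed.

End bernstein.

(** * Gluing, continuation and the maximal solution *)

Section continuation.
Variables (R : realType) (g : nat -> R -> R) (eta A : R).
Hypothesis dg : forall k y, `|y| < eta -> der setT (g k) y (g k.+1 y).
Hypothesis Aeta : A < eta.
Hypothesis A0 : 0 <= A.
Hypothesis bg : forall k, exists C, forall y, `|y| <= A -> `|g k y| <= C.
Variables (gmin gmax : R).
Hypothesis gmin0 : 0 < gmin.
Hypothesis ming : forall y, `|y| <= A -> gmin <= g 0%N y.
Hypothesis maxg : forall y, `|y| <= A -> g 0%N y <= gmax.

Let g0 y : `|y| <= A -> 0 < g 0%N y.
Proof. by move=> /ming; exact: lt_le_trans. Qed.

(** Every clause of [jsol] concerns one time and a relative neighbourhood of it, so it may be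
    checked on pieces that agree with the given functions near that time. *)
Lemma jsol_local a b u q :
  (forall t, a <= t < b -> exists a' b' u' q' d, [/\ 0 < d, jsol g A a' b' u' q' &
     forall s, a <= s < b -> `|s - t| < d -> a' <= s < b' /\ forall k x, u' k x s = u k x s /\ q' k x s = q k x s]) ->
  jsol g A a b u q.
Proof.
move=> h.
have L t : a <= t < b -> exists a' b' u' q' d, [/\ 0 < d, jsol g A a' b' u' q', a' <= t < b',
   (forall k x, u' k x t = u k x t /\ q' k x t = q k x t) &
   forall s, a <= s < b -> `|s - t| < d -> a' <= s < b' /\ forall k x, u' k x s = u k x s /\ q' k x s = q k x s].
  move=> tab; have [a' [b' [u' [q' [d [d0 su e]]]]]] := h t tab.
  have [|ta eq] := e t tab; first by rewrite subrr normr0.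
  by exists a', b', u', q', d.
split=> [k x t tab|k x t tab|k x t tab|x t tab|k x t tab|x t tab|k x t e tab e0];
  have [a' [b' [u' [q' [d [d0 su tab' E e']]]]]] := L t tab.
- rewrite -(E k.+1 x).1.
  have <- : u' k ^~ t = u k ^~ t by apply/funext => y; exact: (E k y).1.
  exact: js_dx su k x t tab'.
- rewrite -(E k x).2; apply: der_loc d0 (E k x).1 _ (js_dt su k x tab') => s sab st.
  by have [s' es] := e' s sab st; split => //; exact: (es k x).1.
- rewrite -(E k.+1 x).2; have <- : q' k ^~ t = q k ^~ t by apply/funext => y; exact: (E k y).2.
  exact: js_qx su k x t tab'.
- by rewrite -(E 0%N x).2 -(E 0%N x).1 -(E 1%N x).1 -(E 2%N x).1; exact: js_eq su x t tab'.
- by rewrite -(E k x).1 -(E k (x + pi *+ 2)).1; exact: js_per su k x t tab'.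
- by rewrite -(E 0%N x).1; exact: js_bd su x t tab'.
- have [d' d'0 hd] := js_cont su k x tab' e0; exists (Num.min d d'); first by rewrite lt_min d0.
  move=> y s sab; rewrite !lt_min => /andP[_ yx] /andP[sd sd'].
  have [s' es] := e' s sab sd; rewrite -(es k y).1 -(E k x).1; exact: hd.
Qed.

Lemma jsol_restrict a b a' b' u q : a <= a' -> b' <= b -> jsol g A a b u q -> jsol g A a' b' u q.
Proof.
move=> aa bb su; apply: jsol_local => t tab; exists a, b, u, q, 1; split=> // s /andP[s1 s2] _.
by rewrite (le_trans aa s1) (lt_le_trans s2 bb).
Qed.

Lemma jsol_shift a b c u q : jsol g A a b u q ->
  jsol g A (a + c) (b + c) (fun k x t => u k x (t - c)) (fun k x t => q k x (t - c)).
Proof.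
move=> su; have W t : a + c <= t < b + c -> a <= t - c < b by rewrite lerBrDr ltrBlDr.
split=> [k x t /W tab|k x t tab|k x t /W tab|x t /W tab|k x t /W tab|x t /W tab|k x t e /W tab e0].
- exact: (js_dx su).
- apply: der_eq; last exact: mulr1.
  apply: (der_comp (B := [set s | a <= s < b]) (f := fun s => s - c)); first by move=> s /W.
    by apply: der_eq (der_add (der_id _ _) (der_cst _ _ _)) _; rewrite addr0.
  by apply: (js_dt su); exact: W.
- exact: (js_qx su).
- exact: (js_eq su).
- exact: (js_per su).
- exact: (js_bd su).
- have [d d0 hd] := js_cont su k x tab e0; exists d => // y s /W sab yx st; apply: hd => //.
  by rewrite opprB addrA subrK.
Qed.

(** The two pieces overlap on [a, b), where uniqueness identifies them together with all
    derivatives; thus near each time one of the two is available on a whole neighbourhood. *)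
Lemma jsol_glue a b c u q u' q' : 0 <= a -> a < b -> jsol g A 0 b u q -> jsol g A a c u' q' ->
  (forall x, u' 0%N x a = u 0%N x a) ->
  exists v w, jsol g A 0 c v w /\ forall k x t, t < b -> v k x t = u k x t.
Proof.
move=> a0 ab su su' e0.
pose v k x t := if t < b then u k x t else u' k x t; pose w k x t := if t < b then q k x t else q' k x t.
exists v, w; split; last by move=> k x t tb; rewrite /v tb.
have su2 : jsol g A a b u q by exact: jsol_restrict su.
apply: jsol_local => t /andP[t0 tc]; have [tb|bt] := ltP t b.
  exists 0, b, u, q, (b - t); rewrite subr_gt0; split=> // s /andP[s0 sc].
  rewrite ltr_norml => /andP[_]; rewrite ltrD2r => sb; rewrite s0 sb; split=> // k x.
  by rewrite /v /w sb.
exists a, c, u', q', (t - a); split=> //; first by rewrite subr_gt0 (lt_le_trans ab).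
move=> s /andP[s0 sc]; rewrite ltr_norml => /andP[h _].
have as_ : a <= s by move: h; rewrite opprB ltrD2r => /ltW.
rewrite as_ sc; split=> // k x; rewrite /v /w; case: ifP => // sb.
exact: (jsol_jet_uniq dg Aeta bg g0 su2 su' e0 k x as_ sb sc).
Qed.

(** A slope bound controls three derivatives up to time [b] by the Bernstein estimates, so a restart
    shortly before [b] has a lifespan that does not depend on how close to [b] it takes place. *)
Lemma jsol_extend b u q M : 0 < b -> jsol g A 0 b u q ->
  (forall x t, 0 <= t < b -> `|u 1%N x t| <= M) ->
  exists c v w, [/\ b < c, jsol g A 0 c v w & forall x, v 0%N x 0 = u 0%N x 0].
Proof.
move=> b0 su hM.
have [K2 h2] := second_derivative_bound dg Aeta bg gmin0 ming maxg b0 su hM.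
have [K3 h3] := third_derivative_bound dg Aeta bg gmin0 ming maxg b0 su hM.
pose B := Num.max 0 (Num.max M (Num.max K2 K3)).
have B0 : 0 <= B by rewrite le_max lexx.
have [T T0 hT] := local_existence dg Aeta A0 bg gmin0 ming maxg B0.
(* Restart at most T / 2 before [b], so that the new piece reaches beyond [b]. *)
pose a := Num.max 0 (b - T / 2).
have a0 : 0 <= a by rewrite le_max lexx.
have ab : a < b by rewrite gt_max b0 gtrBl divr_gt0.
have aab : 0 <= a < b by rewrite a0.
have aT : b < a + T.
  have : b - T / 2 <= a by rewrite le_max lexx orbT.
  rewrite -(lerD2r T); apply: lt_le_trans.
  by rewrite -addrA ltrDl addrC subr_gt0 ltr_pdivrMr// mulr_natr mulr2n ltrDl.
have da k x := js_dx su k x aab.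
have na : nice (u 0%N ^~ a).
  apply: (@jet_nice _ (fun k => u k ^~ a) da) => k.
  by have [C hC] := jsol_bounded k su a0 ab; exists C => x; apply: hC; rewrite a0 lexx.
have je k := @jet_uniq _ (u 0%N ^~ a) (fun k => u k ^~ a) erefl da k.
have [|||v [w [sv ve]]] := hT _ na.
- by move=> x; exact: (js_per su).
- by move=> x; exact: (js_bd su).
- move=> k x; rewrite je; case: k => [//|[|[|[|//]]]] _; rewrite !le_max.
  + by rewrite hM ?orbT.
  + by rewrite h2 ?orbT.
  + by rewrite h3 ?orbT.
have := jsol_shift a sv; rewrite add0r => sv'.
have [|v' [w' [sv2 ev]]] := jsol_glue a0 ab su sv'.
  by move=> x; rewrite subrr ve.
exists (T + a), v', w'; split => //; first by rewrite addrC.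
by move=> x; rewrite ev.
Qed.

(** The supremum of all lifespans, finite by the last hypothesis, is itself attained by gluing; with
    a bounded slope [jsol_extend] would exceed it. *)
Theorem maximal_existence r T1 : nice r -> (forall x, r (x + pi *+ 2) = r x) -> (forall x, `|r x| <= A) ->
  (forall b u q, jsol g A 0 b u q -> (forall x, u 0%N x 0 = r x) -> b <= T1) ->
  exists T u q, [/\ 0 < T, jsol g A 0 T u q, forall x, u 0%N x 0 = r x &
    forall M, exists x t, 0 <= t < T /\ M < `|u 1%N x t|].
Proof.
move=> nr rP rA hT1.
have [B hB] : exists B, forall k x, (0 < k <= 3)%N -> `|derive1n k r x| <= B.
  have H k := nice_bounded (nice_jet nr k).1.
  have [C1 h1] := H 1%N; have [C2 h2] := H 2%N; have [C3 h3] := H 3%N.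
  exists (Num.max C1 (Num.max C2 C3)) => -[//|[|[|[|//]]]] x _; rewrite !le_max.
  - by rewrite h1.
  - by rewrite h2 orbT.
  - by rewrite h3 !orbT.
have B0 : 0 <= B := le_trans (normr_ge0 _) (hB 1%N 0 isT).
have [T0 T00 hT] := local_existence dg Aeta A0 bg gmin0 ming maxg B0.
pose S := [set b | 0 < b /\ exists u q, jsol g A 0 b u q /\ forall x, u 0%N x 0 = r x].
have [u0 [q0 [su0 eu0]]] := hT r nr rP rA hB.
have ST0 : S T0 by split=> //; exists u0, q0; split => // x; rewrite eu0.
have ubS : ubound S T1 by move=> b [b0 [u [q [su eu]]]]; exact: hT1 su eu.
have supS : has_sup S by split; [exists T0|exists T1].
pose T := sup S; have TT0 : T0 <= T by exact: ub_le_sup supS.2 _ ST0.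
have T_gt0 : 0 < T := lt_le_trans T00 TT0.
(* For each t < T one solution living past t is selected. Uniqueness makes the value at time t
   independent of the selection, so the diagonal choice is again a solution. *)
have [F hF] : exists F : R -> R * ((nat -> R -> R -> R) * (nat -> R -> R -> R)), forall t, t < T ->
    [/\ 0 < (F t).1, t < (F t).1, jsol g A 0 (F t).1 (F t).2.1 (F t).2.2 & forall x, (F t).2.1 0%N x 0 = r x].
  have H t : exists p : R * ((nat -> R -> R -> R) * (nat -> R -> R -> R)), t < T ->
    [/\ 0 < p.1, t < p.1, jsol g A 0 p.1 p.2.1 p.2.2 & forall x, p.2.1 0%N x 0 = r x].
    have [tT|Tt] := ltP t T; last by exists (0, (u0, q0)).
    have [b [b0 [u [q [su eu]]]] tb] := sup_gt supS.1 tT.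
    by exists (b, (u, q)).
  by have [F hF] := choice H; exists F.
pose U k x t := (F t).2.1 k x t; pose Q k x t := (F t).2.2 k x t.
have UE b u q : jsol g A 0 b u q -> (forall x, u 0%N x 0 = r x) -> forall t, 0 <= t -> t < b -> t < T ->
    forall k x, u k x t = U k x t /\ Q k x t = q k x t.
  move=> su eu t t0 tb tT k x; have [_ tF sF eF] := hF t tT.
  have [|h1 h2] := jsol_jet_uniq dg Aeta bg g0 su sF _ k x t0 tb tF.
    by move=> z; rewrite eF.
  by rewrite /U /Q h1 h2.
have sU : jsol g A 0 T U Q.
  apply: jsol_local => t /andP[t0 tT]; have [F0 tF sF eF] := hF t tT.
  exists 0, (F t).1, (F t).2.1, (F t).2.2, ((F t).1 - t); split=> //; first by rewrite subr_gt0.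
  move=> s /andP[s0 sT]; rewrite ltr_norml => /andP[_]; rewrite ltrD2r => sF'.
  by rewrite s0 sF'; split=> // k x; have [-> ->] := UE _ _ _ sF eF s s0 sF' sT k x.
have eU x : U 0%N x 0 = r x by have [_ _ _] := hF 0 T_gt0; apply.
exists T, U, Q; split=> // M; apply: contrapT => nM.
have [|c [v [w [Tc sv ev]]]] := @jsol_extend T U Q M T_gt0 sU.
  move=> x t tT; rewrite leNgt; apply/negP => h; apply: nM; by exists x, t.
have : c <= T.
  apply: ub_le_sup supS.2 _ _; split; first exact: lt_trans Tc.
  by exists v, w; split=> // x; rewrite ev.
by rewrite leNgt Tc.
Qed.

End continuation.

(** * Barriers and the bound on the lifespan *)

Section barrier.
Variable R : realType.

(** The sign on the lateral boundary forces a positive maximum into the open interval, where the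
    first and second derivative tests apply. *)
Lemma max_principle_interior a b (c d T : R) (y y1 y2 yt : R -> R -> R) :
  jcont a b y -> c < d -> a <= T -> T < b ->
  (forall x t, a < t <= T -> der setT (y ^~ t) x (y1 x t)) ->
  (forall x t, a < t <= T -> der setT (y1 ^~ t) x (y2 x t)) ->
  (forall x t, a < t <= T -> der [set s | a <= s < b] (y x) t (yt x t)) ->
  (forall x, c <= x <= d -> y x a <= 0) ->
  (forall t, a < t <= T -> y c t <= 0 /\ y d t <= 0) ->
  (forall x t, c < x < d -> a < t <= T -> 0 < y x t -> y1 x t = 0 -> y2 x t <= 0 -> yt x t < 0) ->
  forall x t, c <= x <= d -> a <= t <= T -> y x t <= 0.
Proof.
move=> cy cd aT Tb d1 d2 dt y0 yb hy; apply: (max_principle cy (ltW cd) aT Tb y0) => x t /andP[cx xd] tT yp ym.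
have [yc yd] := yb t tT; exists (yt x t); last exact: dt.
have {}cx : c < x by rewrite lt_neqAle cx andbT; apply/eqP => e; move: yp; rewrite -e ltNge yc.
have {}xd : x < d by rewrite lt_neqAle xd andbT; apply/eqP => e; move: yp; rewrite e ltNge yd.
have e0 : 0 < Num.min (x - c) (d - x) by rewrite lt_min !subr_gt0 cx.
have lm z : `|z - x| < Num.min (x - c) (d - x) -> y z t <= y x t.
  rewrite lt_min !ltr_norml => /andP[/andP[h1 _] /andP[_ h2]]; apply: ym.
  by rewrite opprB ltrD2r in h1; rewrite ltrD2r in h2; rewrite !ltW.
apply: hy => //; first by rewrite cx.
  exact: der_max e0 lm (d1 x t tT).
exact: der2_max e0 lm (fun z => d1 z t tT) (d2 x t tT).
Qed.

Lemma cubic_barrier_sign (c gM g r m K K' w P : R) : 0 < c -> 0 < g -> g <= gM -> 0 < r -> 0 <= m <= 1 / 2 ->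
  1 <= K -> 24 * gM * (K * m) <= c -> (18 * gM + 3 * c) * K ^+ 2 <= K' -> P = m + 3 * K * r ^+ 2 ->
  0 < w -> w ^+ 2 * (1 + P ^+ 2) = 1 ->
  0 < - (c / 4) * r + K' * r ^+ 3 + w * (c * r) - w ^+ 3 * P * g * (6 * K * r).
Proof.
move=> c0 g0 gg r0 /andP[m0 m2] K1 Km K'b PE w0 wP.
have K0 : 0 < K by lra.
have gM0 : 0 < gM by lra.
have r2 : 0 < r ^+ 2 by rewrite exprn_gt0.
have P0 : 0 <= P by rewrite PE addr_ge0// mulr_ge0 ?(ltW r2)// mulr_ge0// ltW.
have w1 : w <= 1.
  by rewrite -(@ler_pXn2r _ 2) ?nnegrE ?(ltW w0)// expr1n -wP ler_peMr ?sqr_ge0// lerDl sqr_ge0.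
have E : - (c / 4) * r + K' * r ^+ 3 + w * (c * r) - w ^+ 3 * P * g * (6 * K * r) =
   r * (- (c / 4) + K' * r ^+ 2 + w * c - w ^+ 3 * g * (6 * K * P)) by ring.
rewrite E mulr_gt0//.
have h1 : w ^+ 3 * g * (6 * K * P) <= gM * (6 * K * P).
  rewrite ler_wpM2r ?mulr_ge0 ?(ltW K0)// -[gM]mul1r; apply: ler_pM => //; rewrite ?exprn_ge0 ?(ltW w0) ?(ltW g0)//.
  by rewrite exprn_ile1// ltW.
have h2 : gM * (6 * K * P) <= c / 4 + 18 * gM * K ^+ 2 * r ^+ 2 by rewrite PE; nra.
have h3 : (18 * gM + 3 * c) * K ^+ 2 * r ^+ 2 <= K' * r ^+ 2 by rewrite ler_pM2r.
have [P1|P1] := leP P 1.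
  have w2 : 1 / 2 < w.
    rewrite ltNge; apply/negP => w2; have : w ^+ 2 <= (1 / 2) ^+ 2 by rewrite lerXn2r// nnegrE// ltW.
    have : P ^+ 2 <= 1 by rewrite expr_le1.
    by have := sqr_ge0 P; have := sqr_ge0 w; nra.
  have : 0 <= 3 * c * K ^+ 2 * r ^+ 2 by rewrite !mulr_ge0 ?sqr_ge0 ?ltW.
  have : c / 2 < w * c by nra.
  by lra.
have h4 : 1 <= 6 * K * r ^+ 2 by lra.
have : c / 2 <= 3 * c * K ^+ 2 * r ^+ 2.
  have : K * r ^+ 2 <= K * (K * r ^+ 2) by rewrite ler_peMl// mulr_ge0// ltW.
  by nra.
have := mulr_gt0 w0 c0; lra.
Qed.

(** Translates [cubic_barrier_sign] back to r. At an interior minimum of Z = m r + K r^3 - x one has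
    P v = 1, hence v zeta v = (1 + P^2)^(-1/2), and Z_xx >= 0 bounds P r_xx below by - 6 K r v^2. *)
Lemma lifespan_sign (c g g1 r v r2 zt P m K k : R) : 0 < g -> P * v = 1 ->
  - (6 * K * r * v ^+ 2 + P * r2) <= 0 -> g1 <= - c * r -> zt ^+ 2 * (1 + v ^+ 2) = 1 -> 0 < v -> 0 < zt -> 0 < P ->
  ((v * zt) ^+ 2 * (1 + P ^+ 2) = 1 ->
   0 < - (c / 4) * r + k * r ^+ 3 + v * zt * (c * r) - (v * zt) ^+ 3 * P * g * (6 * K * r)) ->
  - (- (c / 4) * r + k * r ^+ 3 + P * (g * zt ^+ 3 * r2 + - g1 * v ^+ 2 * zt)) < 0.
Proof.
move=> g0 Pv h1 h2 zz v0 z0 P0.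
have -> : (v * zt) ^+ 2 * (1 + P ^+ 2) = zt ^+ 2 * (1 + v ^+ 2) + zt ^+ 2 * ((P * v) ^+ 2 - 1) by ring.
rewrite Pv zz expr1n subrr mulr0 addr0 => /(_ erefl).
have -> : (v * zt) ^+ 3 * P * g * (6 * K * r) = g * zt ^+ 3 * (6 * K * r * v ^+ 2) * (P * v) by ring.
have -> : P * (g * zt ^+ 3 * r2 + - g1 * v ^+ 2 * zt) = g * zt ^+ 3 * (P * r2) - v * zt * g1 * (P * v) by ring.
rewrite Pv !mulr1.
have e1 : 0 <= g * zt ^+ 3 * (6 * K * r * v ^+ 2 + P * r2).
  by rewrite mulr_ge0 -?oppr_le0// oppr_le0 mulr_ge0 ?exprn_ge0 ?ltW.
have e2 : v * zt * g1 <= v * zt * (- c * r) by rewrite ler_pM2l ?mulr_gt0.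
by move: e1 e2; rewrite mulrDr !mulNr mulrN; clear; lra.
Qed.

Variables (g : nat -> R -> R) (eta A : R).
Hypothesis dg : forall k y, `|y| < eta -> der setT (g k) y (g k.+1 y).
Hypothesis Aeta : A < eta.
Hypothesis A0 : 0 <= A.
Hypothesis bg : forall k, exists C, forall y, `|y| <= A -> `|g k y| <= C.
Variables (gmax G1 c : R).
Hypothesis g0 : forall y, `|y| <= A -> 0 < g 0%N y.
Hypothesis maxg : forall y, `|y| <= A -> g 0%N y <= gmax.
Hypothesis bg1 : forall y, `|y| <= A -> `|g 1%N y| <= G1.
Hypothesis c0 : 0 < c.
Hypothesis g1c : forall y, 0 <= y <= A -> g 1%N y <= - c * y.
Hypothesis g_even : forall y, `|y| <= A -> g 0%N (- y) = g 0%N y.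
Hypothesis g1_odd : forall y, `|y| <= A -> g 1%N (- y) = - g 1%N y.
Variables (b : R) (u q : nat -> R -> R -> R).
Hypothesis su : jsol g A 0 b u q.
Hypothesis b0 : 0 < b.

(** Evenness of [g] makes - r(- x, t) another solution with the same initial values. *)
Lemma jsol_odd : (forall x, u 0%N (- x) 0 = - u 0%N x 0) ->
  forall x t, 0 <= t < b -> u 0%N (- x) t = - u 0%N x t.
Proof.
move=> odd0 x t /andP[t0 tb]; apply/eqP; rewrite -eqr_oppLR; apply/eqP.
have W s : 0 < s < b -> 0 <= s < b by move=> /andP[/ltW->].
apply: (jsol_uniq dg Aeta bg g0 (b' := b) (r := fun x t => - u 0%N (- x) t) (r1 := fun x t => u 1%N (- x) t)
   (r2 := fun x t => - u 2%N (- x) t) (rt := fun x t => - q 0%N (- x) t) su) => //.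
- have dN (z : R) : der setT (fun y : R => - y) z (- 1) by exact: der_opp (der_id _ _).
  split=> [z s sb|z s sb|z s sb|z s sb|].
  + apply: der_eq (der_opp (der_comp (B := setT) (fun _ _ => I) (dN z) (js_dx su 0%N (- z) sb))) _; ring.
  + apply: der_eq (der_comp (B := setT) (fun _ _ => I) (dN z) (js_dx su 1%N (- z) sb)) _; ring.
  + exact: der_opp (js_dt su 0%N (- z) (W _ sb)).
  + by rewrite opprD -[in RHS](subrK (pi *+ 2) (- z)) (js_per su).
  + apply/jcontP => z s e sb e0; have [d d0 hd] := js_cont su 0%N (- z) sb e0.
    exists d => // z' s' sb' zz ss; rewrite -opprD normrN; apply: hd => //.
    by rewrite -opprD normrN.
- by move=> z s sb; rewrite normrN; exact: (js_bd su).
- move=> z s /W sb; rewrite (js_eq su)// /ca /cb g_even ?g1_odd ?(js_bd su)//; ring.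
- by move=> z; rewrite odd0 opprK.
Qed.

Hypothesis odd0 : forall x, u 0%N (- x) 0 = - u 0%N x 0.

Lemma jsol_odd_zero t : 0 <= t < b -> u 0%N 0 t = 0 /\ u 0%N pi t = 0.
Proof.
move=> tb; have o x := jsol_odd odd0 x tb; split.
  by have := o 0; rewrite oppr0 => h; lra.
have := o pi; rewrite -(js_per su 0%N (- pi) tb) mulr2n addrA addNr add0r => h; lra.
Qed.

Variable T : R.
Hypothesis T0 : 0 <= T.
Hypothesis Tb : T < b.

Let Wb t : 0 < t <= T -> 0 <= t < b.
Proof. by move=> /andP[/ltW-> /le_lt_trans]; apply. Qed.

Let Wb' t : 0 <= t <= T -> 0 <= t < b.
Proof. by move=> /andP[-> /le_lt_trans]; apply. Qed.

(** At a negative minimum the slope vanishes, so only diffusion is left and it pushes upwards; the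
    factor exp(- t) makes the sign strict. *)
Lemma jsol_nonneg : (forall x, 0 <= x <= pi -> 0 <= u 0%N x 0) ->
  forall x t, 0 <= x <= pi -> 0 <= t <= T -> 0 <= u 0%N x t.
Proof.
move=> p0 x t xpi tT.
suff : - u 0%N x t * expR (- t) <= 0 by rewrite mulNr oppr_le0 pmulr_lge0// expR_gt0.
have ju : jcont 0 b (u 0%N) := jsol_jcont (k := 0%N) su.
apply: (@max_principle_interior 0 b 0 pi T (fun x t => - u 0%N x t * expR (- t)) (fun x t => - u 1%N x t * expR (- t))
  (fun x t => - u 2%N x t * expR (- t)) (fun x t => (- q 0%N x t + u 0%N x t) * expR (- t))) => //.
- apply: jcont_mul; first exact: jcont_opp.
  apply: (jcont_t (G := fun t => expR (- t))) => z.
  by apply: continuous_comp; [exact: opp_continuous|exact: continuous_expR].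
- exact: pi_gt0.
- move=> z s /Wb sb; have h := js_dx su 0%N z sb; der_ring.
- move=> z s /Wb sb; have h := js_dx su 1%N z sb; der_ring.
- move=> z s /Wb sb; have h := js_dt su 0%N z sb.
  have h' : der [set s0 | 0 <= s0 < b] (fun s : R => expR (- s)) s (- expR (- s)).
    apply: (@der_eq _ _ _ _ (expR (- s) * - 1)); last by ring.
    apply: (der_comp (B := setT) (f := fun t => - t)) => //; first exact: der_opp (der_id _ _).
    by apply/der_is_derive; exact: is_derive_expR.
  by der_ring.
- by move=> z zpi; rewrite mulNr oppr_le0 mulr_ge0 ?expR_ge0// p0.
- by move=> s /Wb sb; have [-> ->] := jsol_odd_zero sb; rewrite oppr0 mul0r.
- move=> z s zpi sT; have sb := Wb sT.
  rewrite pmulr_lgt0 ?expR_gt0// oppr_gt0 => un /eqP; rewrite mulf_eq0 oppr_eq0 [expR _ == 0]gt_eqF ?expR_gt0// orbF => /eqP u1.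
  rewrite pmulr_lle0 ?expR_gt0// oppr_le0 => u2.
  rewrite pmulr_llt0 ?expR_gt0// (js_eq su)// u1 /cb /ca expr0n/= mulr0 mul0r addr0.
  have : 0 <= g 0%N (u 0%N z s) * zeta 0 ^+ 3 * u 2%N z s.
    rewrite mulr_ge0// mulr_ge0 ?exprn_ge0 ?(ltW (zeta_gt0 _))// ltW// g0//; exact: (js_bd su).
  by move: un; lra.
Qed.

(** The lower barrier is h - L (1 - sin x) - s t. Where its excess over r is maximal, r has slope at
    most L in absolute value and second derivative at least - L, so r_t >= - (gmax + G1) L > - s. At
    0 and pi the barrier is nonpositive because h <= L. *)
Lemma jsol_sine_barrier h L s : 0 <= h -> h <= L -> (gmax + G1) * L < s ->
  (forall x, 0 <= x <= pi -> h - L * (1 - sin x) <= u 0%N x 0) ->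
  forall t, 0 <= t <= T -> h - s * t <= u 0%N (pi / 2) t.
Proof.
move=> h0 hL sL p0 t tT; have L0 : 0 <= L by exact: le_trans hL.
have s0 : 0 <= s.
  apply: ltW; apply: le_lt_trans sL; rewrite mulr_ge0// addr_ge0//.
    by have := maxg (y := 0); have := g0 (y := 0); rewrite normr0 => /(_ A0) h1 /(_ A0); exact: le_trans (ltW h1).
  by have := bg1 (y := 0); rewrite normr0 => /(_ A0); exact: le_trans.
have ju : jcont 0 b (u 0%N) := jsol_jcont (k := 0%N) su.
have pp : 0 < pi :> R := pi_gt0 R.
suff : h - L * (1 - sin (pi / 2)) - s * t - u 0%N (pi / 2) t <= 0.
  by rewrite sin_pihalf subrr mulr0 subr0 subr_le0.
have ds z : der setT (@sin R) z (cos z) by apply/der_is_derive; exact: is_derive_sin.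
have dc z : der setT (@cos R) z (- sin z) by apply/der_is_derive; exact: is_derive_cos.
apply: (@max_principle_interior 0 b 0 pi T (fun x t => h - L * (1 - sin x) - s * t - u 0%N x t)
  (fun x t => L * cos x - u 1%N x t) (fun x t => - L * sin x - u 2%N x t) (fun x t => - s - q 0%N x t)) => //.
- apply: jcont_add; last exact: jcont_opp.
  apply: jcont_add.
    apply: (jcont_x (G := fun x => h - L * (1 - sin x))) => z.
    have dz := ds z; apply: (@der_continuous _ _ _ (L * cos z)); der_ring.
  apply: (jcont_t (G := fun t => - (s * t))) => z.
  by apply: (@der_continuous _ _ _ (- s)); der_ring.
- move=> z w /Wb wb; have h1 := js_dx su 0%N z wb; have h2 := ds z; der_ring.
- move=> z w /Wb wb; have h1 := js_dx su 1%N z wb; have h2 := dc z; der_ring.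
- move=> z w /Wb wb; have h1 := js_dt su 0%N z wb; der_ring.
- by move=> z zpi; rewrite mulr0 subr0 subr_le0; exact: p0.
- move=> w wT; have wb := Wb wT; have [-> ->] := jsol_odd_zero wb; rewrite sin0 sinpi !subr0 mulr1.
  have : 0 <= s * w by rewrite mulr_ge0//; case/andP: wb.
  by lra.
- move=> z w /andP[z0 zp] wT; have wb := Wb wT; move=> _ e1 e2.
  have uA := js_bd su z wb.
  have v1 : u 1%N z w = L * cos z by apply/eqP; rewrite eq_sym -subr_eq0 e1.
  have v2 : - L <= u 2%N z w.
    have : L * sin z <= L by rewrite -[leRHS]mulr1 ler_wpM2l// sin_le1.
    by lra.
  have vL : `|u 1%N z w| <= L.
    rewrite v1 normrM ger0_norm// -[leRHS]mulr1 ler_wpM2l// ler_norml cos_geN1 cos_le1//.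
  have bb : `|cb g (u 0%N z w) (u 1%N z w)| <= G1 * L.
    rewrite /cb (_ : _ * zeta _ = - g 1%N (u 0%N z w) * (u 1%N z w * (u 1%N z w * zeta (u 1%N z w)))); last by ring.
    rewrite !normrM normrN -normrM; apply: ler_pM => //; first exact: bg1.
    by rewrite -[L]mulr1; apply: ler_pM => //; exact: norm_vzeta.
  have z0' := zeta_gt0 (u 1%N z w); have z1 := zeta_le1 (u 1%N z w).
  have ca1 : 0 <= ca g (u 0%N z w) (u 1%N z w) <= gmax.
    rewrite /ca mulr_ge0 ?(ltW (g0 uA)) ?exprn_ge0 ?(ltW z0')//= -[gmax]mulr1; apply: ler_pM; rewrite ?maxg//.
    + exact/ltW/g0.
    + by rewrite exprn_ge0// ltW.
    + by rewrite exprn_ile1// ltW.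
  have : - (gmax * L) <= ca g (u 0%N z w) (u 1%N z w) * u 2%N z w.
    apply: (@le_trans _ _ (ca g (u 0%N z w) (u 1%N z w) * - L)); last by rewrite ler_wpM2l//; case/andP: ca1.
    by rewrite mulrN lerN2 ler_wpM2r//; case/andP: ca1.
  rewrite (js_eq su)//; move: bb; rewrite ler_norml => /andP[bb _].
  by move: sL bb; rewrite mulrDl; lra.
- by rewrite ltW ?divr_gt0//= ler_pdivrMr// mulr_natr mulr2n lerDl ltW.
Qed.

(* The comparison function is [m r + K r^3] with [m] decreasing to [0] at time [T]; once [m] vanishes,
   [K r^3 >= x] is incompatible with a finite slope of [r] at the origin. *)
Lemma jsol_lifespan m0 K0 h L s : 0 < m0 <= 1 / 2 -> 1 <= K0 -> T = 4 * m0 / c ->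
  48 * gmax * (K0 * m0) <= c -> 16 * (18 * gmax + 3 * c) * (K0 * m0) <= c ->
  0 <= h -> h <= L -> (gmax + G1) * L < s -> 2 * (s * T) <= h -> 16 <= K0 * h ^+ 3 ->
  (forall x, 0 <= x <= pi -> h - L * (1 - sin x) <= u 0%N x 0) ->
  (forall x, 0 <= x <= pi -> 0 <= u 0%N x 0) ->
  (forall x, 0 <= x <= pi / 2 -> x <= m0 * u 0%N x 0 + K0 * u 0%N x 0 ^+ 3) -> False.
Proof.
have qh (k p p' : R) : 2 * p <= k -> p' <= p -> k / 2 <= k - p' by lra.
have qk (k : R) : 16 <= k -> 2 * 8 <= k by lra.
have qz (p p' : R) : 2 <= p' -> 0 <= p -> pi / 2 < 2 :> R -> - (p + p' - pi / 2) <= 0 by lra.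
have qy (z y : R) : 0 < y -> 0 <= z -> z - -1 * y <= 1 / 2 * y -> False by lra.
move=> /andP[m00 m02] K01 TE Km1 Km2 h0 hL sL sT Kh pL pp pK.
have p0 : 0 < pi :> R := pi_gt0 R.
have p20 : 0 < pi / 2 :> R by rewrite divr_gt0.
have p2p : pi / 2 <= pi :> R by rewrite ler_pdivrMr// mulr_natr mulr2n lerDl ltW.
have Tp : 0 < T by rewrite TE divr_gt0// mulr_gt0.
have gm0 : 0 < gmax by apply: lt_le_trans (maxg (y := 0) _); [apply: g0|]; rewrite normr0.
have G10 : 0 <= G1 by apply: le_trans (bg1 (y := 0) _); rewrite ?normr_ge0 ?normr0.
have s0 : 0 <= s by apply: ltW; apply: le_lt_trans sL; exact: mulr_ge0 (addr_ge0 (ltW gm0) G10) (le_trans h0 hL).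
(* The growth rate K0 kap of K has to dominate (18 gmax + 3 c) K^2 while K <= 2 K0, whence the
   factor 4; kap T <= 1 keeps K below 2 K0. *)
pose kap := 4 * (18 * gmax + 3 * c) * K0.
have K00 : 0 < K0 by exact: lt_le_trans K01.
have kap0 : 0 < kap by rewrite !mulr_gt0// addr_gt0// mulr_gt0.
have kT : kap * T <= 1.
  rewrite /kap TE mulrA ler_pdivrMr// mul1r; apply: le_trans Km2.
  by rewrite le_eqVlt; apply/orP; left; apply/eqP; ring.
pose m t := m0 - c / 4 * t; pose K t := K0 * (1 + kap * t).
have mT t : 0 <= t <= T -> 0 <= m t <= m0.
  move=> /andP[t0 tT]; rewrite /m gerBl mulr_ge0 ?divr_ge0 ?(ltW c0)// andbT subr_ge0.
  apply: (@le_trans _ _ (c / 4 * T)); first by rewrite ler_pM2l ?divr_gt0.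
  by rewrite TE le_eqVlt; apply/orP; left; apply/eqP; field; rewrite gt_eqF.
have KT t : 0 <= t <= T -> K0 <= K t <= 2 * K0.
  move=> /andP[t0 tT]; have kt0 : 0 <= kap * t := mulr_ge0 (ltW kap0) t0.
  rewrite /K ler_peMr ?(ltW K00) ?lerDl//=.
  rewrite mulrC ler_pM2r//.
  have : kap * t <= kap * T by rewrite ler_pM2l.
  by move=> h1; rewrite lerD2l (le_trans h1).
pose Z x t := m t * u 0%N x t + K t * u 0%N x t ^+ 3 - x.
have ju : jcont 0 b (u 0%N) := jsol_jcont (k := 0%N) su.
have jm : jcont 0 b (fun _ t => m t).
  apply: jcont_t => z; apply: (@der_continuous _ _ _ (- (c / 4))); rewrite /m; der_ring.
have jK : jcont 0 b (fun _ t => K t).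
  apply: jcont_t => z; apply: (@der_continuous _ _ _ (K0 * kap)); rewrite /K; der_ring.
have ju3 : jcont 0 b (fun x t => u 0%N x t ^+ 3).
  by under eq_fun do under eq_fun do rewrite exprS expr2; exact: jcont_mul ju (jcont_mul ju ju).
have Zpos x t : 0 <= x <= pi / 2 -> 0 <= t <= T -> 0 <= Z x t.
  move=> xp tT; rewrite -oppr_le0.
  apply: (@max_principle_interior 0 b 0 (pi / 2) T (fun x t => - Z x t)
    (fun x t => - ((m t + 3 * K t * u 0%N x t ^+ 2) * u 1%N x t - 1))
    (fun x t => - ((6 * K t * u 0%N x t) * u 1%N x t ^+ 2 + (m t + 3 * K t * u 0%N x t ^+ 2) * u 2%N x t))
    (fun x t => - (- (c / 4) * u 0%N x t + K0 * kap * u 0%N x t ^+ 3 + (m t + 3 * K t * u 0%N x t ^+ 2) * q 0%N x t))) => //.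
  - apply: jcont_opp; rewrite /Z; apply: jcont_add; last by apply: jcont_opp; apply: (jcont_x (G := id)) => z; exact: cvg_id.
    by apply: jcont_add; exact: jcont_mul.
  - by move=> z w /Wb wb; have h1 := js_dx su 0%N z wb; rewrite /Z; der_ring.
  - by move=> z w /Wb wb; have h1 := js_dx su 0%N z wb; have h2 := js_dx su 1%N z wb; der_ring.
  - by move=> z w /Wb wb; have h1 := js_dt su 0%N z wb; rewrite /Z /m /K; der_ring.
  - move=> z zp; rewrite oppr_le0 /Z /m /K !mulr0 subr0 addr0 mulr1 subr_ge0; exact: pK.
  - move=> w wT; have wb := Wb wT; have wT' : 0 <= w <= T by case/andP: wT => /ltW->.
    split; first by rewrite /Z (jsol_odd_zero wb).1 expr0n/= !mulr0 !addr0 subrr oppr0.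
    have hh : h / 2 <= u 0%N (pi / 2) w.
      apply: le_trans (jsol_sine_barrier h0 hL sL pL wT').
      have : s * w <= s * T.
        by rewrite ler_wpM2l//; case/andP: wT.
      exact: qh.
    have h3 : (h / 2) ^+ 3 <= u 0%N (pi / 2) w ^+ 3 by rewrite lerXn2r ?nnegrE ?divr_ge0// (le_trans _ hh)// divr_ge0.
    have [K1 _] := andP (KT w wT'); have [m1 _] := andP (mT w wT').
    (* At x = pi/2 the cubic term alone suffices, as pi/2 < 2. *)
    have : 2 <= K w * u 0%N (pi / 2) w ^+ 3.
      apply: (@le_trans _ _ (K0 * (h / 2) ^+ 3)); last by apply: ler_pM => //; [exact: ltW|rewrite exprn_ge0// divr_ge0].
      by rewrite (_ : (h / 2) ^+ 3 = h ^+ 3 / 8); [rewrite mulrA ler_pdivlMr//; exact: qk|field].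
    have : 0 <= m w * u 0%N (pi / 2) w by rewrite mulr_ge0// (le_trans _ hh)// divr_ge0.
    have := pihalf_lt2 R.
    by move=> h1 h2 h3'; exact: qz h3' h2 h1.
  - move=> z w /andP[z0 zp] wT Zn e1 e2; have wb := Wb wT; have wT' : 0 <= w <= T by case/andP: wT => /ltW->.
    have zpi : 0 <= z <= pi by rewrite ltW//= (le_trans (ltW zp)).
    have r0 : 0 <= u 0%N z w by exact: jsol_nonneg.
    have uA := js_bd su z wb.
    have [K1 K2] := andP (KT w wT'); have [m1 m2] := andP (mT w wT').
    have {}e1 : (m w + 3 * K w * u 0%N z w ^+ 2) * u 1%N z w = 1 by apply/eqP; rewrite -subr_eq0 -oppr_eq0 e1.
    (* If r vanished here it would be minimal with slope 0, contradicting [e1]. *)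
    have {}r0 : 0 < u 0%N z w.
      rewrite lt_neqAle r0 andbT; apply/eqP => r00.
      have e0 : 0 < Num.min z (pi - z) by rewrite lt_min z0 subr_gt0 (lt_le_trans zp).
      have lm y : `|y - z| < Num.min z (pi - z) -> u 0%N z w <= u 0%N y w.
        rewrite lt_min !ltr_norml => /andP[/andP[h1 _] /andP[_ h2]]; rewrite -r00; apply: jsol_nonneg => //.
        rewrite ltrD2r in h2; rewrite (ltW h2) andbT; apply: ltW; move: h1; rewrite -{1}[- z]add0r ltrD2r//.
      by move: e1; rewrite (der_min e0 lm (js_dx su 0%N z wb)) mulr0 => /eqP; rewrite eq_sym oner_eq0.
    have P0 : 0 < m w + 3 * K w * u 0%N z w ^+ 2.
      by rewrite ltr_wpDl// (mulr_gt0 (mulr_gt0 _ (lt_le_trans K00 K1)) (exprn_gt0 2 r0)).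
    have v0 : 0 < u 1%N z w by rewrite -(pmulr_rgt0 _ P0) e1.
    have z0' := zeta_gt0 (u 1%N z w).
    have zz := zeta2 (u 1%N z w).
    have g1' : g 1%N (u 0%N z w) <= - c * u 0%N z w.
      by apply: g1c; rewrite ltW//=; apply: le_trans uA; exact: ler_norm.
    have := @cubic_barrier_sign c gmax (g 0%N (u 0%N z w)) (u 0%N z w) (m w) (K w) (K0 * kap)
       (u 1%N z w * zeta (u 1%N z w)) (m w + 3 * K w * u 0%N z w ^+ 2) c0 (g0 uA) (maxg uA) r0.
    rewrite m1 (le_trans m2 m02) (le_trans K01 K1) => /(_ isT isT).
    have -> : 24 * gmax * (K w * m w) <= c.
      apply: le_trans Km1; rewrite (_ : 48 * gmax * (K0 * m0) = 24 * gmax * (2 * K0 * m0)); last by ring.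
      by rewrite ler_wpM2l ?mulr_ge0 ?(ltW gm0)//; apply: ler_pM => //; rewrite (le_trans (ltW K00)).
    have -> : (18 * gmax + 3 * c) * K w ^+ 2 <= K0 * kap.
      rewrite (_ : K0 * kap = (18 * gmax + 3 * c) * (2 * K0) ^+ 2); last by rewrite /kap; ring.
      apply: ler_wpM2l; first by rewrite addr_ge0// mulr_ge0// ltW.
      by apply: lerXn2r => //; rewrite nnegrE; [exact: ltW (lt_le_trans K00 K1)|exact: mulr_ge0 (ltW K00)].
    move=> /(_ isT isT erefl (mulr_gt0 v0 z0')).
    rewrite (js_eq su)// /ca /cb; move: e1 e2 g1' zz v0 z0' P0; have := g0 uA.
    set r := u 0%N z w; set v := u 1%N z w; set r2 := u 2%N z w; set P := m w + _; set zt := zeta v.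
    exact: lifespan_sign.
have TT : 0 <= T <= T by rewrite T0 lexx.
have Tb' : 0 <= T < b by exact: Wb'.
have mT0 : m T = 0 by rewrite /m TE; field; rewrite gt_eqF.
(* At time T the linear term is gone, so Z = K r^3 - x has slope -1 at the origin and is negative
   just to the right of it. *)
have dZ : der setT (Z ^~ T) 0 (-1).
  have h1 := js_dx su 0%N 0 Tb'; rewrite /Z mT0; eapply der_eq; [der_t|].
  by rewrite /= (jsol_odd_zero Tb').1; ring.
have [d d0 hd] := dZ (1 / 2) (divr_gt0 ltr01 (ltr0Sn R 1)).
pose y := Num.min d (pi / 2) / 2; have y0 : 0 < y by rewrite divr_gt0// lt_min d0.
have yd : `|y - 0| < d.
  by rewrite subr0 gtr0_norm// ltr_pdivrMr// gt_min mulr_natr mulr2n ltrDl d0.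
have yp : 0 <= y <= pi / 2.
  by rewrite (ltW y0)/= ler_pdivrMr// ge_min; apply/orP; right; rewrite mulr_natr mulr2n lerDl ltW.
have := hd y I yd; have := Zpos y T yp TT.
have -> : Z 0 T = 0 by rewrite /Z mT0 (jsol_odd_zero Tb').1 expr0n/= !mulr0 addr0 subr0.
rewrite !subr0 (gtr0_norm y0) ler_norml => h1 /andP[_ h2].
exact: qy y0 h1 h2.
Qed.

End barrier.

(** * The regularised power y (ep^2 + y^2)^(-p) *)

Section profile.
Variables (R : realType) (ep p : R).
Hypothesis ep0 : 0 < ep.
Hypothesis ep1 : ep <= 1 / 2.
Hypothesis p0 : 1 / 4 < p.
Hypothesis p1 : p <= 1 / 3.

Definition profile (y : R) := y * (ep ^+ 2 + y ^+ 2) `^ (- p).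

Let e0 y : 0 < ep ^+ 2 + y ^+ 2.
Proof. by rewrite ltr_pwDl ?sqr_ge0 ?exprn_gt0. Qed.

Let p_ge0 : 0 <= p. Proof. by move: p0; lra. Qed.
Let p_le1 : p <= 1. Proof. by move: p1; lra. Qed.
Let q_gt0 : 0 < 1 - 2 * p. Proof. by move: p1; lra. Qed.

Lemma profileN y : profile (- y) = - profile y.
Proof. by rewrite /profile sqrrN mulNr. Qed.

Lemma profile_ge0 y : 0 <= y -> 0 <= profile y.
Proof. by move=> y0; rewrite mulr_ge0// powR_ge0. Qed.

(** The quotient increases in y and stays below 1; monotonicity and the bound by y^(1 - 2 p) are
    read off this form. *)
Lemma profileE y : 0 <= y -> profile y = (y ^+ 2 / (ep ^+ 2 + y ^+ 2)) `^ p * y `^ (1 - 2 * p).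
Proof.
rewrite le_eqVlt => /predU1P[<-|y0].
  by rewrite /profile mul0r [_ `^ (1 - _)]powR0 ?mulr0// (gt_eqF q_gt0).
rewrite powRM ?sqr_ge0 ?invr_ge0 ?(ltW (e0 y))//.
have -> : (ep ^+ 2 + y ^+ 2)^-1 `^ p = (ep ^+ 2 + y ^+ 2) `^ (- p).
  by rewrite -powR_inv1 ?(ltW (e0 y))// -powRrM mulN1r.
have -> : (y ^+ 2) `^ p = y `^ (2 * p) by rewrite -(powR_mulrn 2 (ltW y0)) -powRrM.
rewrite mulrAC -powRD; last by rewrite (gt_eqF y0) implybT.
by rewrite (_ : 2%:R * p + (1 - 2 * p) = 1) ?powRr1 ?(ltW y0)//; ring.
Qed.

Lemma profile_le y : 0 <= y -> profile y <= y `^ (1 - 2 * p).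
Proof.
move=> y0; rewrite profileE// ler_piMl ?powR_ge0//.
have <- : 1 `^ p = 1 :> R by rewrite powR1.
apply: ge0_ler_powR; rewrite ?nnegrE ?ler01//.
  by rewrite divr_ge0 ?sqr_ge0 ?(ltW (e0 y)).
by rewrite ler_pdivrMr// mul1r lerDr sqr_ge0.
Qed.

Lemma profile_homo y z : 0 <= z -> z <= y -> profile z <= profile y.
Proof.
move=> z0 zy; have y0 : 0 <= y by exact: le_trans zy.
have y2 : z ^+ 2 <= y ^+ 2 by rewrite lerXn2r.
rewrite !profileE//; apply: ler_pM; rewrite ?powR_ge0//; apply: ge0_ler_powR; rewrite ?nnegrE//.
- by rewrite divr_ge0 ?sqr_ge0 ?(ltW (e0 z)).
- by rewrite divr_ge0 ?sqr_ge0 ?(ltW (e0 y)).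
- rewrite ler_pdivrMr// mulrAC ler_pdivlMr// !mulrDr [y ^+ 2 * z ^+ 2]mulrC lerD2r.
  by rewrite ler_wpM2r// sqr_ge0.
- exact: ltW.
Qed.

Lemma profile_factor_anti y z : 0 <= z -> z <= y -> (ep ^+ 2 + y ^+ 2) `^ (- p) <= (ep ^+ 2 + z ^+ 2) `^ (- p).
Proof.
move=> z0 zy; rewrite !powRN lef_pV2 ?posrE ?powR_gt0//.
apply: ge0_ler_powR; rewrite ?nnegrE ?(ltW (e0 _))//.
by rewrite lerD2l lerXn2r// nnegrE (le_trans z0).
Qed.

(** The factor (ep^2 + y^2)^(-p) decreases for y >= 0, so splitting y into z and y - z can only
    increase each summand. *)
Lemma profile_subadd y z : 0 <= z -> z <= y -> profile y <= profile z + profile (y - z).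
Proof.
move=> z0 zy; rewrite {1}/profile -{1}[y](subrK z) mulrDl addrC; apply: lerD.
  by rewrite ler_wpM2l// profile_factor_anti.
by rewrite ler_wpM2l ?subr_ge0// profile_factor_anti ?subr_ge0// gerBl.
Qed.

(** For arguments of equal sign subadditivity gives the constant 1; opposite signs cost the factor
    2. *)
Lemma profile_holder y z : `|profile y - profile z| <= 2 * `|y - z| `^ (1 - 2 * p).
Proof.
wlog zy : y z / z <= y.
  by move=> h; have [zy|/ltW yz] := leP z y; [exact: h|rewrite distrC [`|y - z|]distrC; exact: h].
have pos z' y' : 0 <= z' -> z' <= y' -> `|profile y' - profile z'| <= 2 * `|y' - z'| `^ (1 - 2 * p).
  move=> z0 zy'; have d0 : 0 <= y' - z' by rewrite subr_ge0.
  rewrite ger0_norm ?subr_ge0 ?profile_homo// (ger0_norm d0).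
  have := profile_subadd z0 zy'; have := profile_le d0; have := powR_ge0 (y' - z') (1 - 2 * p); lra.
have [z0|z0] := leP 0 z; first exact: pos.
have [y0|y0] := leP y 0.
  have := pos (- y) (- z); rewrite oppr_ge0 lerN2 !profileN !opprK => /(_ y0 zy).
  by rewrite [- _ + _]addrC [- z + _]addrC.
have nz : 0 <= - z by rewrite oppr_ge0 ltW.
have d0 : 0 <= y - z by rewrite subr_ge0.
have h1 : profile y <= (y - z) `^ (1 - 2 * p).
  apply: le_trans (profile_le d0); apply: profile_homo; rewrite ?(ltW y0)//; lra.
have h2 : profile (- z) <= (y - z) `^ (1 - 2 * p).
  apply: le_trans (profile_le d0); apply: profile_homo => //; lra.
have h3 := profile_ge0 (ltW y0); have h4 := profile_ge0 nz.
rewrite -[profile z]opprK -profileN opprK ger0_norm ?addr_ge0// (ger0_norm d0); lra.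
Qed.

Lemma der_powR (z q : R) : 0 < z -> der setT (fun z => z `^ q) z (q * z `^ (q - 1)).
Proof. by move=> z0; apply/der_is_derive; exact: is_derive1_powR. Qed.

Lemma profile_sin_nice : nice (fun x => profile (sin x)).
Proof.
have hz (z : R) : 0 <= z -> z <= 1 -> `|z - 1 / 2| <= 1 / 2 by move=> h1 h2; rewrite ler_norml; lra.
(* Each derivative of the sine is a shift by pi/2, so one formula covers all of them. *)
pose S (k : nat) : R -> R := fun x => sin (x + k%:R * (pi / 2)).
have dS k x : der setT (S k) x (S k.+1 x).
  have h : der setT (fun x : R => x + k%:R * (pi / 2)) x 1 by der_ring.
  have h2 : der setT (@sin R) (x + k%:R * (pi / 2)) (cos (x + k%:R * (pi / 2))).
    by apply/der_is_derive; exact: is_derive_sin.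
  apply: der_eq (der_comp (fun _ _ => I) h h2) _.
  have -> : S k.+1 x = sin (x + k%:R * (pi / 2) + pi / 2) by rewrite /S -[k.+1%:R]natr1; congr sin; ring.
  by rewrite mulr1 sinDpihalf.
have nS : nice (S 0%N).
  by apply: jet_nice dS _ => k; exists 1 => x; exact: sin_max.
have S0 : S 0%N = @sin R by apply/funext => x; rewrite /S mul0r addr0.
rewrite S0 in nS.
pose cc := fix cc k : R := if k is k'.+1 then cc k' * (- p - k'%:R) else 1.
(* Successive derivatives of (ep^2 + 1/2 + z)^(-p). Centring sin^2 x at 1/2 puts the argument in
   [-1/2, 1/2], inside a symmetric ball on which the base stays positive, as [tame_comp]
   requires. *)
pose G k z := cc k * (ep ^+ 2 + 1 / 2 + z) `^ (- p - k%:R).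
have dG k y : `|y| < ep ^+ 2 + 1 / 2 -> der setT (G k) y (G k.+1 y).
  rewrite ltr_norml => /andP[h _]; have y0 : 0 < ep ^+ 2 + 1 / 2 + y by lra.
  have h1 : der setT (fun z => ep ^+ 2 + 1 / 2 + z) y 1 by der_ring.
  have h2 := der_comp (fun _ _ => I) h1 (der_powR (- p - k%:R) y0).
  rewrite /G; apply: der_eq (der_scale _ h2) _; rewrite mulr1 /= mulrA.
  by congr (_ * _ `^ _); rewrite -[k.+1%:R]natr1; ring.
have bG k : exists C, forall y, `|y| <= 1 / 2 -> `|G k y| <= C.
  exists (`|cc k| * (ep ^+ 2) `^ (- p - k%:R)) => y; rewrite ler_norml => /andP[h _].
  have e2 : 0 < ep ^+ 2 by rewrite exprn_gt0.
  rewrite /G normrM ler_wpM2l// ger0_norm ?powR_ge0//.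
  rewrite -[- p - _]opprK !(powRN _ (- (- p - _))) lef_pV2 ?posrE ?powR_gt0//; last by lra.
  apply: ge0_ler_powR; rewrite ?nnegrE; [|lra..].
  by rewrite opprB opprK addr_ge0.
have A12 : 1 / 2 < ep ^+ 2 + 1 / 2 by rewrite ltrDr exprn_gt0.
have nI : forall i : unit, 0 <= (fun _ : unit => 0 : R) i by [].
move=> m; apply: (tameS nI).
have t1 : tame (fun _ : unit => 0 : R) m.+1 (fun _ x => sin x) by exact: nS.
have t2 : tame (fun _ : unit => 0 : R) m.+1 (fun _ x => sin x ^+ 2 + - (1 / 2)).
  by apply: tame_add; [exact: tame_exp|exact: tame_cst].
have t3 := @tame_comp _ unit _ nI G (1 / 2) (ep ^+ 2 + 1 / 2) m.+1 (fun _ x => sin x ^+ 2 + - (1 / 2)) 0%N A12 dG bG.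
have : tame (fun _ : unit => 0 : R) m.+1 (fun _ x => sin x * G 0%N (sin x ^+ 2 + - (1 / 2))).
  apply: tame_mulS => //; apply: t3 => //.
  move=> i x.
  have s1 : sin x ^+ 2 <= 1.
    by rewrite -[sin x ^+ 2]real_normK ?num_real// exprn_ile1// sin_max.
  exact: hz (sqr_ge0 _) s1.
have E : (fun (_ : unit) (x : R) => sin x * G 0%N (sin x ^+ 2 + - (1 / 2))) = (fun _ x => profile (sin x)).
  apply/funext => _; apply/funext => x; rewrite /G /profile /= mul1r subr0.
  by congr (_ * _ `^ _); ring.
by rewrite E.
Qed.

Lemma powRNle1 (z : R) : 0 < z -> z <= 2 -> 1 / 2 <= z `^ (- p).
Proof.
move=> z0 z2; rewrite powRN -[1 / 2]invrK lef_pV2 ?posrE ?powR_gt0// ?invr_gt0 ?divr_gt0//.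
have [z1|z1] := leP z 1.
  apply: (@le_trans _ _ 1); last by rewrite ?div1r ?invrK ?invf_div; lra.
  have <- : 1 `^ p = 1 :> R by rewrite powR1.
  by apply: ge0_ler_powR; rewrite ?nnegrE ?(ltW z0) ?ler01.
by apply: (le_trans (ler1_powR (ltW z1) p_le1)); rewrite div1r invrK.
Qed.

(** Made for the sine barrier: a / 2 - 3 a (1 - sin x) is nonpositive when sin x <= 5/6, so the data
    needs a lower bound only above that value. *)
Lemma profile_near_one y : 5 / 6 <= y -> y <= 1 -> 1 / 2 <= profile y.
Proof.
move=> y1 y2; have z0 := e0 y; have : 2 / 3 <= (ep ^+ 2 + y ^+ 2) `^ (- p).
  rewrite powRN -[2 / 3]invrK lef_pV2 ?posrE ?powR_gt0// ?invr_gt0 ?divr_gt0//.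
  have z2 : ep ^+ 2 + y ^+ 2 <= 3 / 2 by have := ep1; have := ep0; nra.
  have [z1|z1] := leP (ep ^+ 2 + y ^+ 2) 1.
    apply: (@le_trans _ _ 1); last by rewrite ?div1r ?invrK ?invf_div; lra.
    have <- : 1 `^ p = 1 :> R by rewrite powR1.
    by apply: ge0_ler_powR; rewrite ?nnegrE ?(ltW z0) ?ler01.
  by apply: (le_trans (ler1_powR (ltW z1) p_le1)); rewrite invf_div.
rewrite /profile; nra.
Qed.

(* Below [ep] the profile is essentially linear, above [ep] its cube is comparable to [y^(3 - 6 p)]. *)
Lemma profile_cubic y : 0 <= y -> 2 * y <= 4 * ep `^ (2 * p) * profile y + 16 * ep `^ (- (2 - 6 * p)) * profile y ^+ 3.
Proof.
move=> y0; have [ye|/ltW ey] := leP y ep.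
  apply: ler_wpDr; first by rewrite !mulr_ge0 ?powR_ge0// exprn_ge0// profile_ge0.
  have -> : 4 * ep `^ (2 * p) * profile y = y * (4 * (ep `^ (2 * p) * (ep ^+ 2 + y ^+ 2) `^ (- p))) by rewrite /profile; ring.
  rewrite mulrC ler_wpM2l//; apply: (@le_trans _ _ (4 * (1 / 2))); first by lra.
  rewrite ler_pM2l//.
  have h : (2 * ep ^+ 2) `^ (- p) <= (ep ^+ 2 + y ^+ 2) `^ (- p).
    rewrite !(powRN _ p) lef_pV2 ?posrE ?powR_gt0 ?mulr_gt0 ?exprn_gt0//.
    apply: ge0_ler_powR; rewrite ?nnegrE ?(ltW (e0 _)) ?(mulr_ge0 (ler0n _ 2) (sqr_ge0 _))//.
    by rewrite mulr_natl mulr2n lerD2l lerXn2r// nnegrE ltW.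
  apply: (@le_trans _ _ (ep `^ (2 * p) * (2 * ep ^+ 2) `^ (- p))); last by rewrite ler_wpM2l// powR_ge0.
  rewrite powRM ?sqr_ge0// -powR_mulrn ?(ltW ep0)// -powRrM mulrCA -powRD; last by rewrite (gt_eqF ep0) implybT.
  rewrite (_ : 2 * p + 2%:R * - p = 0) ?powRr0 ?mulr1; last by ring.
  exact: powRNle1.
apply: ler_wpDl; first by rewrite !mulr_ge0 ?powR_ge0// profile_ge0.
have y0' : 0 < y := lt_le_trans ep0 ey.
have h : (2 * y ^+ 2) `^ (- p) <= (ep ^+ 2 + y ^+ 2) `^ (- p).
  rewrite !(powRN _ p) lef_pV2 ?posrE ?powR_gt0 ?mulr_gt0 ?exprn_gt0//.
  apply: ge0_ler_powR; rewrite ?nnegrE ?(ltW (e0 _)) ?(mulr_ge0 (ler0n _ 2) (sqr_ge0 _))//.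
  by rewrite mulr_natl mulr2n lerD2r lerXn2r// nnegrE ltW.
have h2 : 1 / 2 * y `^ (1 - 2 * p) <= profile y.
  have -> : y `^ (1 - 2 * p) = y * y `^ (- (2 * p)).
    by rewrite powRD ?powRr1//; rewrite (gt_eqF y0') implybT.
  rewrite mulrCA /profile ler_wpM2l//; apply: le_trans h.
  rewrite powRM ?sqr_ge0// -powR_mulrn// -powRrM mulrN ler_wpM2r ?powR_ge0//.
  exact: powRNle1.
apply: (@le_trans _ _ (16 * ep `^ (- (2 - 6 * p)) * (1 / 2 * y `^ (1 - 2 * p)) ^+ 3)); last first.
  rewrite ler_wpM2l ?mulr_ge0 ?powR_ge0//; apply: lerXn2r => //; rewrite nnegrE.
    by rewrite mulr_ge0 ?powR_ge0.
  exact: profile_ge0.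
rewrite exprMn -[_ `^ (1 - 2 * p) ^+ 3]powR_mulrn ?powR_ge0// -powRrM.
have -> : (1 - 2 * p) * 3%:R = 1 + (2 - 6 * p) by ring.
rewrite powRD ?powRr1//; last by rewrite (gt_eqF y0') implybT.
have -> : 16 * ep `^ (- (2 - 6 * p)) * ((1 / 2) ^+ 3 * (y * y `^ (2 - 6 * p)))
  = 2 * y * (ep `^ (- (2 - 6 * p)) * y `^ (2 - 6 * p)) by field.
rewrite ler_peMr ?mulr_ge0// powRN mulrC ler_pdivlMr ?powR_gt0// mul1r.
by apply: ge0_ler_powR; rewrite ?nnegrE ?(ltW ep0)//; move: p1; lra.
Qed.

End profile.

(** * Initial data adapted to the barriers *)

Section initial_data.
Variable R : realType.

(** Since sin x = 2 cos(x/2) sin(x/2) and sin(x/2) >= cos(x/2) x/2, one gets 2 sin x >= (1 + cos x)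
    x. *)
Lemma half_le_sin (x : R) : 0 <= x <= pi / 2 -> x <= 2 * sin x.
Proof.
move=> /andP[x0 xp]; have [->|xn0] := eqVneq x 0; first by rewrite sin0 mulr0.
have {}x0 : 0 < x by rewrite lt_neqAle eq_sym xn0.
have y0 : 0 < x / 2 by rewrite divr_gt0.
have [c /andP[c0 cx] sc] : exists2 c, 0 < c < x / 2 & sin (x / 2) = cos c * (x / 2).
  have [|c [c0 cx]] := @mvt _ (@sin R) (@cos R) 0 (x / 2) y0.
    by move=> z _; apply/der_is_derive; exact: is_derive_sin.
  by rewrite sin0 !subr0 => ->; exists c; rewrite ?c0.
have pp := pi_gt0 R.
have cc : cos (x / 2) <= cos c.
  by rewrite leNgt ltr_cos ?in_itv/= -?leNgt; lra.
have c2 : 0 <= cos (x / 2) by apply: cos_ge0_pihalf; lra.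
have e : x = x / 2 *+ 2 by rewrite mulr2n; field.
have cx0 : 0 <= cos x by apply: cos_ge0_pihalf; lra.
have c22 : 2 * cos (x / 2) ^+ 2 = 1 + cos x by rewrite {2}e cos_mulr2n mulr2n; ring.
have -> : sin x = 2 * (cos (x / 2) * sin (x / 2)) by rewrite {1}e sin_mulr2n mulr2n; ring.
rewrite sc.
have : cos (x / 2) * cos (x / 2) <= cos (x / 2) * cos c by rewrite ler_wpM2l.
rewrite -expr2; nra.
Qed.

(* Here [m0] is of order [ep^(1 - s)] and [K0] of order [ep^(1 - 3 s)], so that [K0 * m0] tends to [0] with [ep]
   exactly when [s < 1/2]. *)
Lemma initial_data (s a delta : R) : 1 / 3 <= s < 1 / 2 -> 0 < a <= 1 -> 0 < delta -> exists (r : R -> R) (m0 K0 : R),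
  nice r /\ (forall x, r (x + pi *+ 2) = r x) /\ (forall x, r (- x) = - r x) /\ (forall x, `|r x| <= a) /\
  (forall x y, `|r x - r y| <= 2 * a * `|sin x - sin y| `^ s) /\
  0 < m0 <= delta /\ 1 <= K0 /\ 16 <= K0 * (a / 2) ^+ 3 /\ K0 * m0 <= delta /\
  (forall x, 0 <= x <= pi -> a / 2 - 3 * a * (1 - sin x) <= r x) /\
  (forall x, 0 <= x <= pi -> 0 <= r x) /\
  (forall x, 0 <= x <= pi / 2 -> x <= m0 * r x + K0 * r x ^+ 3).
Proof.
move=> /andP[s1 s2] /andP[a0 a1] d0.
pose p := (1 - s) / 2; have p0 : 1 / 4 < p by rewrite /p; lra.
have p1 : p <= 1 / 3 by rewrite /p; lra.
have sE : 1 - 2 * p = s by rewrite /p; field.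
(* Exponent of [ep] in K0 m0, equal to 2 - 4 s and positive because s < 1/2; [dd] is the value of
   ep^w at which K0 m0 equals [delta]. *)
pose w := 8 * p - 2; have w0 : 0 < w by rewrite /w; lra.
pose dd := a ^+ 4 * delta / 2 ^+ 9; have dd0 : 0 < dd by rewrite divr_gt0 ?exprn_gt0// mulr_gt0// exprn_gt0.
pose ep := Num.min (1 / 2) (dd `^ w^-1).
have ep0 : 0 < ep by rewrite lt_min divr_gt0//= powR_gt0.
have ep1 : ep <= 1 / 2 by rewrite ge_min lexx.
have epw : ep `^ w <= dd.
  apply: (@le_trans _ _ ((dd `^ w^-1) `^ w)).
    by apply: ge0_ler_powR; rewrite ?nnegrE ?(ltW w0) ?(ltW ep0) ?powR_ge0// ge_min lexx orbT.
  by rewrite -powRrM mulVf ?powRr1 ?(ltW dd0)// gt_eqF.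
pose r x := a * profile ep p (sin x).
(* The coefficients of [profile_cubic] rescaled by the amplitude [a]. In [K0] the constant 16 is
   raised to 2^7 so that K0 (a / 2)^3 >= 16. *)
pose m0 := 4 / a * ep `^ (2 * p); pose K0 := 2 ^+ 7 / a ^+ 3 * ep `^ (- (2 - 6 * p)).
have q0 : 0 <= 2 - 6 * p by lra.
have e1 : 1 <= ep `^ (- (2 - 6 * p)).
  rewrite powRN invf_ge1 ?powR_gt0//; apply: (@le_trans _ _ (1 `^ (2 - 6 * p))); last by rewrite powR1.
  by apply: ge0_ler_powR; rewrite ?nnegrE ?(ltW ep0)//; lra.
have a3 : 0 < a ^+ 3 by rewrite exprn_gt0.
have a31 : a ^+ 3 <= 1 by rewrite exprn_ile1// ltW.
have s1' x : `|sin x| <= 1 :> R := sin_max x.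
have rp x : 0 <= x <= pi -> 0 <= r x.
  by move=> xp; rewrite mulr_ge0 ?(ltW a0)// profile_ge0// sin_ge0_pi.
have epw' : ep `^ (2 * p) <= ep `^ w by apply: ger_powR; rewrite /w; lra.
exists r, m0, K0; do ![split].
- have nI (i : unit) : 0 <= (fun _ : unit => 0 : R) i by [].
  by move=> m; apply: (tameS nI); apply: (tame_mulS nI); [exact: tame_cst|exact: (profile_sin_nice ep0 p0)].
- by move=> x; rewrite /r sinD2pi.
- by move=> x; rewrite /r sinN profileN mulrN.
- move=> x; rewrite /r normrM gtr0_norm// ler_piMr ?(ltW a0)//.
  have H y : 0 <= y <= 1 -> profile ep p y <= 1.
    move=> /andP[y0 y1]; apply: (le_trans (profile_le ep0 p0 p1 y0)).
    rewrite sE; apply: (@le_trans _ _ (1 `^ s)); last by rewrite powR1.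
    by apply: ge0_ler_powR; rewrite ?nnegrE//; lra.
  have := s1' x; rewrite ler_norml => /andP[h1 h2].
  have [y0|y0] := leP 0 (sin x).
    by rewrite ger0_norm ?profile_ge0//; apply: H; rewrite y0.
  rewrite -normrN -profileN ger0_norm ?profile_ge0 ?oppr_ge0 ?(ltW y0)//; apply: H; lra.
- move=> x y; rewrite /r -mulrBr normrM (gtr0_norm a0) [2 * a]mulrC -mulrA ler_pM2l//.
  by rewrite -sE; exact: profile_holder.
- apply/andP; split; first by rewrite mulr_gt0 ?powR_gt0// divr_gt0.
  apply: (@le_trans _ _ (4 / a * dd)); first by rewrite ler_wpM2l ?divr_ge0 ?(ltW a0)// (le_trans epw').
  rewrite (_ : 4 / a * dd = a ^+ 3 * (delta / 2 ^+ 7)); last by rewrite /dd; field; rewrite gt_eqF.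
  by apply: (@le_trans _ _ (1 * (delta / 2 ^+ 7))); [rewrite ler_wpM2r// divr_ge0// ltW|lra].
- have h : 1 <= 2 ^+ 7 / a ^+ 3 by rewrite ler_pdivlMr// mul1r (le_trans a31)// exprn_ege1// ler1n.
  by rewrite /K0 (le_trans h)// ler_peMr// (le_trans ler01).
- rewrite (_ : K0 * _ = 16 * ep `^ (- (2 - 6 * p))); first by rewrite ler_peMr.
  by rewrite /K0; field; rewrite gt_eqF.
- have -> : K0 * m0 = 2 ^+ 9 / a ^+ 4 * ep `^ w.
    rewrite /w (_ : 8 * p - 2 = - (2 - 6 * p) + 2 * p); last by ring.
    rewrite powRD ?(gt_eqF ep0) ?implybT// /K0 /m0; field; rewrite gt_eqF//.
  apply: (@le_trans _ _ (2 ^+ 9 / a ^+ 4 * dd)); first by rewrite ler_wpM2l// divr_ge0// exprn_ge0// ltW.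
  by rewrite /dd le_eqVlt; apply/orP; left; apply/eqP; field; rewrite gt_eqF.
- move=> x xp; have := s1' x; rewrite ler_norml => /andP[_ sx].
  have [h|h] := leP (sin x) (5 / 6); first by apply: le_trans (rp x xp); nra.
  have := profile_near_one ep0 ep1 p0 p1 (ltW h) sx; rewrite /r => h2; nra.
- exact: rp.
- move=> x xp; apply: (le_trans (half_le_sin xp)).
  have sx : 0 <= sin x.
    apply: sin_ge0_pi; case/andP: xp => -> /= /le_trans; apply.
    by rewrite ler_pdivrMr// mulr_natr mulr2n lerDl ltW// pi_gt0.
  apply: (le_trans (profile_cubic ep0 p0 p1 sx)).
  have -> : m0 * r x = 4 * ep `^ (2 * p) * profile ep p (sin x) by rewrite /m0 /r; field; rewrite gt_eqF.
  have -> : K0 * r x ^+ 3 = 2 ^+ 7 * (ep `^ (- (2 - 6 * p)) * profile ep p (sin x) ^+ 3).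
    by rewrite /K0 /r; field; rewrite gt_eqF.
  rewrite lerD2l -mulrA ler_wpM2r ?mulr_ge0 ?powR_ge0 ?exprn_ge0 ?profile_ge0//; lra.
Qed.

End initial_data.

(** * Smoothness on a ball and inverse functions *)

Section smooth_near_zero.
Variable R : realType.
Implicit Types (f : R -> R) (D : R).

(** Does not name the derivatives in advance, so products, inverses and compositions are short
    inductions; [smooth_upto_jet] recovers the sequence of derivatives. *)
Fixpoint smooth_upto D n f : Prop :=
  if n is n'.+1 then exists2 f', (forall z, `|z| < D -> der setT f z (f' z)) & smooth_upto D n' f' else True.

Lemma ball_room D (z : R) : `|z| < D -> exists2 d, 0 < d & forall y, `|y - z| < d -> `|y| < D.
Proof.
move=> zD; exists (D - `|z|); first by rewrite subr_gt0.
move=> y yz; rewrite -[y](subrK z); apply: (le_lt_trans (ler_normD _ _)).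
by rewrite -ltrBrDr.
Qed.

Lemma der_ball_ext D f f1 z l : `|z| < D -> (forall y, `|y| < D -> f y = f1 y) ->
  der setT f z l -> der setT f1 z l.
Proof.
move=> zD e; have [d d0 hd] := ball_room zD.
by apply: der_loc d0 (e z zD) _ => y _ /hd yD; split=> //; exact: e.
Qed.

Lemma smooth_uptoS D n f : smooth_upto D n.+1 f -> smooth_upto D n f.
Proof. by elim: n f => [//|n ih] f [f' df /ih]; exists f'. Qed.

Lemma smooth_upto_ext D n f f1 : (forall y, `|y| < D -> f y = f1 y) -> smooth_upto D n f -> smooth_upto D n f1.
Proof.
case: n => [//|n] e [f' df sf']; exists f' => // z zD.
exact: der_ball_ext zD e (df z zD).
Qed.

Lemma smooth_upto_mul D n f f1 : smooth_upto D n f -> smooth_upto D n f1 -> smooth_upto D n (fun z => f z * f1 z).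
Proof.
have add m g h : smooth_upto D m g -> smooth_upto D m h -> smooth_upto D m (fun z => g z + h z).
  elim: m g h => [//|m ih] g h [g' dg sg] [h' dh sh].
  exists (fun z => g' z + h' z); last exact: ih.
  by move=> z zD; exact: der_add (dg z zD) (dh z zD).
elim: n f f1 => [//|n ih] f f1 sf sf1; have [f' df sf'] := sf; have [f1' df1 sf1'] := sf1.
exists (fun z => f' z * f1 z + f z * f1' z).
  by move=> z zD; exact: der_mul (df z zD) (df1 z zD).
by apply: add; apply: ih => //; exact: smooth_uptoS.
Qed.

Lemma der_ball_inv D f z l : `|z| < D -> (forall y, `|y| < D -> 0 < f y) -> der setT f z l ->
  der setT (fun y => (f y)^-1) z (- l * ((f z)^-1 * (f z)^-1)).
Proof.
move=> zD f0 df; have [d d0 hd] := ball_room zD.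
apply: (@der_loc _ [set y | `|y| < D] _ (fun y => (f y)^-1) _ z _ d d0) => //.
  by move=> y _ /hd.
have h := der_inv (A := [set y | `|y| < D]) (f := f) (x := z) (l := l).
apply: der_eq (h _ zD _) _.
- by move=> y /f0 h0; rewrite gt_eqF.
- exact: der_sub df.
- by rewrite -expr2 exprVn.
Qed.

Lemma smooth_upto_inv D n f : (forall y, `|y| < D -> 0 < f y) -> smooth_upto D n f ->
  smooth_upto D n (fun z => (f z)^-1).
Proof.
move=> f0; elim: n => [//|n ih] sf; have [f' df sf'] := sf.
exists (fun z => - f' z * ((f z)^-1 * (f z)^-1)).
  by move=> z zD; exact: der_ball_inv zD f0 (df z zD).
have si : smooth_upto D n (fun z => (f z)^-1) by apply: ih; exact: smooth_uptoS.
apply: smooth_upto_mul; last exact: smooth_upto_mul.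
apply: (@smooth_upto_ext _ _ (fun z => -1 * f' z)); first by move=> y _; rewrite mulN1r.
apply: smooth_upto_mul => //; elim: n {ih sf sf' si} => [//|n ih]; exists (fun _ => 0); first by move=> *; exact: der_cst.
by elim: n {ih} => [//|n ih]; exists (fun _ => 0) => // *; exact: der_cst.
Qed.

(** Because psi' = phi(psi), the derivative of f(psi) is (f' phi)(psi), again a composition with
    [psi]. *)
Lemma smooth_upto_comp D E f phi psi n : (forall m, smooth_upto D m phi) ->
  (forall y, `|y| < E -> `|psi y| < D /\ der setT psi y (phi (psi y))) ->
  smooth_upto D n f -> smooth_upto E n (fun y => f (psi y)).
Proof.
move=> sphi dpsi; elim: n f => [//|n ih] f [f' df sf'].
exists (fun y => f' (psi y) * phi (psi y)).
  by move=> y /dpsi[yD dy]; apply: (der_comp (B := setT)) => //; exact: df.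
by apply: (ih (fun z => f' z * phi z)); apply: smooth_upto_mul.
Qed.

Lemma smooth_upto_jet D f : (forall n, smooth_upto D n f) ->
  forall k z, `|z| < D -> der setT (derive1n k f) z (derive1n k.+1 f z).
Proof.
move=> sf k; elim: k f sf => [|k ih] f sf.
  move=> z zD; have [f' df _] := sf 1%N.
  by rewrite derive1n1 (der_derive1 (df z zD)); exact: df.
rewrite !(derive1Sn f); apply: ih => n; have [f' df sf'] := sf n.+1.
by apply: smooth_upto_ext sf' => y yD; rewrite (der_derive1 (df y yD)).
Qed.

Lemma der_bounded f f' a b : a <= b -> (forall z, a <= z <= b -> der setT f z (f' z)) ->
  exists2 c, a <= c <= b & forall z, a <= z <= b -> f z <= f c.
Proof.
move=> ab df; have [|c cab hc] := @EVT_max R f a b ab.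
  apply/subspace_continuousP => z /=; rewrite in_itv/= => zab.
  by apply: cvg_within_filter; exact: der_continuous (df z zab).
by exists c; [move: cab; rewrite in_itv|move=> z zab; apply: hc; rewrite in_itv].
Qed.

Lemma jet_bounded D (F : nat -> R -> R) A : A < D -> (forall k y, `|y| < D -> der setT (F k) y (F k.+1 y)) ->
  forall k, exists C, forall y, `|y| <= A -> `|F k y| <= C.
Proof.
move=> AD dF k; have [A0|A0] := ltP A 0.
  by exists 0 => y /le_lt_trans/(_ A0); rewrite normr_lt0.
have aa : - A <= A by rewrite lerNl (le_trans _ A0)// oppr_le0.
have W z : - A <= z <= A -> `|z| < D by rewrite -ler_norml => /le_lt_trans; apply.
have [c _ hc] := der_bounded aa (fun z zA => dF k z (W z zA)).
have [d _ hd] := der_bounded aa (fun z zA => der_opp (dF k z (W z zA))).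
exists (Num.max (F k c) (- F k d)) => y; rewrite ler_norml => yA.
rewrite ler_norml lerNl !le_max; apply/andP; split; apply/orP; [right|left].
  exact: hd.
exact: hc.
Qed.

Lemma positive_bounds D f f' A : 0 <= A -> A < D -> (forall y, `|y| < D -> der setT f y (f' y)) ->
  (forall y, `|y| < D -> 0 < f y) ->
  exists m M, 0 < m /\ forall y, `|y| <= A -> m <= f y <= M.
Proof.
move=> A0 AD df f0; have aa : - A <= A by rewrite lerNl (le_trans _ A0)// oppr_le0.
have W z : - A <= z <= A -> `|z| < D by rewrite -ler_norml => /le_lt_trans; apply.
have [c _ hc] := der_bounded aa (fun z zA => df z (W z zA)).
have [d dA hd] := der_bounded aa (fun z zA => der_opp (df z (W z zA))).
exists (f d), (f c); split; first exact: f0 (W d dA).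
by move=> y; rewrite ler_norml => yA; rewrite hc// andbT -lerN2 hd.
Qed.

(** The positive lower bound on [h] makes the primitive H strictly increasing and onto, with a
    Lipschitz inverse; this Lipschitz bound turns the first order expansion of H into one of its
    inverse. *)
Lemma inverse_function (h : R -> R) m M : continuous h -> 0 < m -> (forall x, m <= h x <= M) ->
  exists H psi : R -> R, [/\ H 0 = 0, cancel H psi, cancel psi H, (forall x, der setT H x (h x)) &
    forall y, der setT psi y (h (psi y))^-1] /\ {mono H : x y / x <= y}.
Proof.
move=> ch m0 hm; have [F dF] := primitive ch.
pose H x := F x - F 0; have H0 : H 0 = 0 by rewrite /H subrr.
have dH x : der setT H x (h x) by apply: der_eq (der_add (dF x) (der_cst _ _ _)) _; rewrite addr0.
have Hm x y : x <= y -> m * (y - x) <= H y - H x.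
  rewrite le_eqVlt => /predU1P[->|xy]; first by rewrite !subrr mulr0.
  have [z [_ _ ->]] := mvt xy (fun x _ => dH x).
  by rewrite ler_wpM2r ?subr_ge0 ?(ltW xy)//; case/andP: (hm z).
have mH : {mono H : x y / x <= y}.
  apply: le_mono => x y xy; rewrite -subr_gt0; apply: lt_le_trans (Hm _ _ (ltW xy)).
  by rewrite mulr_gt0 ?subr_gt0.
have surj y : exists x, H x = y.
  pose B := `|y| / m; have B0 : 0 <= B by rewrite divr_ge0// ltW.
  have mB : m * B = `|y| by rewrite mulrC divfK// gt_eqF.
  have [|||x _ <-] := @IVT R H (- B) B y; last by exists x.
  - by rewrite lerNl (le_trans _ B0)// oppr_le0.
  - by apply: continuous_subspaceT => x; exact: der_continuous (dH x).
  - have h1 := Hm 0 B B0; have h2 := Hm (- B) 0; rewrite oppr_le0 sub0r opprK in h2.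
    have {}h2 := h2 B0; rewrite H0 !subr0 sub0r mB in h1 h2.
    have h3 := ler_norm y; have h4 := ler_norm (- y); rewrite normrN in h4.
    by rewrite ge_min le_max; apply/andP; split; apply/orP; [left|right]; lra.
have [psi Hpsi] := choice surj.
have iH : injective H by exact: inc_inj.
exists H, psi; split; last exact: mH.
split=> // [x|y]; first by apply: iH; rewrite Hpsi.
have L a b : `|psi a - psi b| <= m^-1 * `|a - b|.
  wlog ab : a b / psi b <= psi a.
    move=> w; have [ab|/ltW ab] := leP (psi b) (psi a); first exact: w.
    by rewrite distrC [`|a - b|]distrC; exact: w.
  have := Hm _ _ ab; rewrite !Hpsi => h1.
  rewrite ger0_norm ?subr_ge0// mulrC ler_pdivlMr// mulrC; apply: le_trans (ler_norm _); exact: h1.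
have hy : 0 < h (psi y) by apply: lt_le_trans m0 _; case/andP: (hm (psi y)).
move=> e e0; have [d d0 hd] := dH (psi y) _ (mulr_gt0 (mulr_gt0 e0 hy) m0).
exists (d * m); first by rewrite mulr_gt0.
move=> z _ zy; have := hd (psi z) I; rewrite !Hpsi.
have zy' : `|psi z - psi y| < d.
  by apply: (le_lt_trans (L _ _)); rewrite mulrC ltr_pdivrMr.
move=> /(_ zy') h1.
have -> : psi z - psi y - (h (psi y))^-1 * (z - y) = - (h (psi y))^-1 * (z - y - h (psi y) * (psi z - psi y)).
  by field; rewrite gt_eqF.
rewrite normrM normrN [`|(h _)^-1|]gtr0_norm ?invr_gt0// ler_pdivrMl//; apply: (le_trans h1).
rewrite [X in _ <= X]mulrA [h _ * e]mulrC -[X in X <= _]mulrA; apply: ler_wpM2l; first by rewrite mulr_ge0 ?ltW.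
by rewrite -ler_pdivlMl.
Qed.

End smooth_near_zero.

(** * The change of coordinate rho = psi(r) *)

Section coordinate.
Variables (R : realType) (I : set R) (phi : R -> R).
Hypothesis I_interval : is_interval I.
Hypothesis I_interior : interior I !=set0.
Hypothesis phi_smooth : smooth_on I phi.
Hypothesis phi_gt0 : forall s, I s -> 0 < phi s.
Hypothesis I_sym : forall s, I s -> I (- s).
Hypothesis phi_even : forall s, I s -> phi (- s) = phi s.
Hypothesis phi2_gt0 : 0 < iter 2 (derive_within I) phi 0.

Lemma symmetric_interval_nbhs : exists2 D, 0 < D & forall z, `|z| <= D -> I z.
Proof.
have [x /nbhs_ballP[e /= e0 xe]] := I_interior.
suff : exists2 D, 0 < D & I D.
  move=> [D D0 ID]; exists D => // z; rewrite ler_norml => zD.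
  by apply: (I_interval (I_sym ID) ID).
have e20 : 0 < e / 2 by rewrite divr_gt0.
have e2 : e / 2 < e by rewrite ltr_pdivrMr// mulr_natr mulr2n ltrDl.
have [x0|x0] := leP 0 x.
  exists (x + e / 2); first by rewrite ltr_wpDl.
  by apply: xe; rewrite /ball/= opprD addrA subrr sub0r normrN gtr0_norm.
exists (- (x - e / 2)); first by rewrite oppr_gt0 subr_lt0 (lt_trans x0).
by apply: I_sym; apply: xe; rewrite /ball/= opprB addrCA subrr addr0 gtr0_norm.
Qed.

Lemma phi_jet k s : I s -> der I (iter k (derive_within I) phi) s (iter k.+1 (derive_within I) phi s).
Proof. by move=> Is; apply/der_quotient; exact: phi_smooth k s Is. Qed.

Lemma coordinate_change : exists (D Phi A1 c : R) (H psi : R -> R) (g : nat -> R -> R),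
  [/\ 0 < D /\ (forall z, `|z| <= D -> I z),
      [/\ 0 < A1, `|psi A1| < D, 0 < c & 0 < Phi],
      [/\ cancel H psi, cancel psi H, {mono H : x y / x <= y}, forall z, H (- z) = - H z &
         forall a b, `|psi a - psi b| <= Phi * `|a - b|],
      [/\ forall z, `|z| <= D -> der setT H z (phi z)^-1, forall y, `|psi y| <= D -> der setT psi y (phi (psi y)) &
         forall k y, `|y| < H D -> der setT (derive1n k psi) y (derive1n k.+1 psi y)] &
      [/\ forall k y, `|y| < H D -> der setT (g k) y (g k.+1 y),
         forall y, g 0%N y = (phi (psi y))^-1,
         forall y, `|y| < H D -> g 1%N y = - derive_within I phi (psi y) / phi (psi y),
         forall y, 0 <= y <= A1 -> g 1%N y <= - c * y &
         (forall y, `|y| < H D -> g 0%N (- y) = g 0%N y) /\ (forall y, `|y| < H D -> g 1%N (- y) = - g 1%N y)]].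
Proof.
have [D0 D00 ID0] := symmetric_interval_nbhs.
(* Half of the available room, so that [- D, D] lies in an open ball on which derivatives relative
   to I are ordinary ones. *)
pose D := D0 / 2; have Dp : 0 < D by rewrite divr_gt0.
have DD : D < D0 by rewrite ltr_pdivrMr// mulr_natr mulr2n ltrDl.
have dphi k z : `|z| < D0 -> der setT (iter k (derive_within I) phi) z (iter k.+1 (derive_within I) phi z).
  move=> zD; have [d d0 hd] := ball_room zD.
  by apply: der_loc d0 _ _ (phi_jet k (ID0 _ (ltW zD))) => // y _ /hd/ltW/ID0.
have sphi n : smooth_upto D0 n phi.
  rewrite -[phi]/(iter 0 (derive_within I) phi); elim: n 0%N => [//|n ih] k.
  by exists (iter k.+1 (derive_within I) phi); [exact: dphi|exact: ih].
have phi0 z : `|z| < D0 -> 0 < phi z by move=> /ltW/ID0/phi_gt0.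
have [m [M [m0 hm]]] := positive_bounds (ltW Dp) DD (fun z zD => dphi 0%N z zD) phi0.
(* The truncation of [z] to [[-D, D]]. *)
pose clamp z := (`|z + D| - `|z - D|) / 2.
have clampD z : `|clamp z| <= D.
  rewrite /clamp normrM [`|2^-1|]ger0_norm ?invr_ge0// ler_pdivrMr//.
  apply: (le_trans (ler_dist_dist _ _)); rewrite (_ : z + D - (z - D) = D * 2); last by ring.
  by rewrite gtr0_norm ?mulr_gt0.
have clampE z : `|z| <= D -> clamp z = z.
  rewrite ler_norml => /andP[h1 h2].
  by rewrite /clamp ger0_norm ?ler0_norm; [field|rewrite subr_le0|rewrite -lerBlDr sub0r].
have clampN z : clamp (- z) = - clamp z.
  rewrite /clamp (_ : - z - D = - (z + D)); last by ring.
  by rewrite (_ : - z + D = - (z - D)) ?normrN; [ring|ring].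
have cclamp : continuous clamp.
  move=> z; apply: cvgM; last exact: cvg_cst.
  by apply: cvgB; apply: cvg_norm; [apply: cvgD|apply: cvgB]; by [exact: cvg_id|exact: cvg_cst].
pose h z := (phi (clamp z))^-1.
have clampD0 z : `|clamp z| < D0 := le_lt_trans (clampD z) DD.
have ch : continuous h.
  move=> z; apply: continuousV; first by rewrite gt_eqF// phi0.
  by apply: continuous_comp; [exact: cclamp|exact: der_continuous (dphi 0%N _ (clampD0 z))].
have M0 : 0 < M.
  by have := hm 0; rewrite normr0 => /(_ (ltW Dp))/andP[h1 h2]; exact: lt_le_trans (le_trans h1 h2).
have hb z : M^-1 <= h z <= m^-1.
  by have /andP[h1 h2] := hm _ (clampD z); rewrite /h !lef_pV2 ?posrE ?phi0// h1 h2.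
have Mi : 0 < M^-1 by rewrite invr_gt0.
have [H [psi [[H0 HK psiK dH dpsi] mH]]] := inverse_function ch Mi hb.
have hE z : `|z| <= D -> h z = (phi z)^-1 by move=> zD; rewrite /h clampE.
have dpsi' y : der setT psi y (phi (clamp (psi y))) by apply: der_eq (dpsi y) _; rewrite invrK.
have hN z : h (- z) = h z by rewrite /h clampN phi_even//; exact: ID0 (ltW (clampD0 z)).
have Hodd z : H (- z) = - H z.
  have pos y : 0 <= y -> H (- y) = - H y.
    move=> y0; have := @der0_cst _ (fun t => H (- t) + H t) 0 y y0.
    rewrite oppr0 H0 addr0 => k; apply/eqP; rewrite -subr_eq0 opprK k// => t _.
    have dN : der setT (fun y : R => - y) t (- 1) by exact: der_opp (der_id _ _).
    apply: der_eq (der_add (der_comp (fun _ _ => Logic.I) dN (dH (- t))) (dH t)) _.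
    by rewrite hN; ring.
  have [z0|/ltW z0] := leP 0 z; first exact: pos.
  by rewrite -[in RHS](opprK z) (pos (- z)) ?oppr_ge0// opprK.
have psiN y : psi (- y) = - psi y by rewrite -[y in LHS]psiK -Hodd HK.
have phi'N z : `|z| < D0 -> derive_within I phi (- z) = - derive_within I phi z.
  move=> zD; have dN : der setT (fun y : R => - y) z (- 1) by exact: der_opp (der_id _ _).
  have zD' : `|- z| < D0 by rewrite normrN.
  have := der_comp (fun _ _ => Logic.I) dN (dphi 0%N _ zD').
  move=> /(der_ball_ext zD (f1 := phi)) h1.
  have := der_uniqT (dphi 0%N z zD) (h1 _); rewrite /= => -> //; first by rewrite mulrN1 opprK.
  by move=> y /ltW/ID0; exact: phi_even.
have psiD y : `|y| < H D -> `|psi y| < D.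
  rewrite !ltr_norml -Hodd => /andP[h1 h2]; have mH' := leW_mono mH.
  by rewrite -mH' psiK h1 -mH' psiK h2.
pose f y := (phi (psi y))^-1.
have dpsiD y : `|y| < H D -> `|psi y| < D0 /\ der setT psi y (phi (psi y)).
  move=> /psiD yD; split; first exact: lt_trans DD.
  by apply: der_eq (dpsi' y) _; rewrite clampE// ltW.
have sf n : smooth_upto (H D) n f.
  apply: (@smooth_upto_comp _ D0 (H D) (fun z => (phi z)^-1) phi psi n sphi dpsiD).
  exact: smooth_upto_inv phi0 (sphi n).
have df y : `|y| < H D -> der setT f y (- derive_within I phi (psi y) / phi (psi y)).
  move=> yD; have [yD0 dy] := dpsiD y yD.
  apply: der_eq (der_comp (fun _ _ => Logic.I) dy (der_ball_inv yD0 phi0 (dphi 0%N _ yD0))) _.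
  by rewrite /=; field; rewrite gt_eqF// phi0.
(* Evenness gives phi'(0) = 0, so phi'(z) >= b z for small z >= 0, with b half of phi''(0). As psi y
   >= m y and phi <= M, this yields g' <= - (b m / M) y. *)
pose b := iter 2 (derive_within I) phi 0 / 2; have b0 : 0 < b by rewrite divr_gt0.
have phi'0 : derive_within I phi 0 = 0.
  by have := phi'N 0; rewrite normr0 oppr0 => /(_ D00); lra.
have [d d0 hd] := dphi 1%N 0 (eq_ind_r (fun x => x < D0) D00 (normr0 R)) b b0.
have phi'b z : 0 <= z -> z < d -> b * z <= derive_within I phi z.
  move=> z0 zd; have := hd z Logic.I; rewrite subr0 ger0_norm// => /(_ zd).
  rewrite [iter 1 _ _]/= phi'0 subr0 ler_norml => /andP[h1 _]; move: h1.
  rewrite (_ : iter 2 _ _ _ = 2 * b); last by rewrite /b; field.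
  by lra.
have psib y z : `|psi y - psi z| <= M * `|y - z|.
  apply: (lip_der (f := psi) (f' := fun y => phi (clamp (psi y)))) => // w.
  have /andP[h1 h2] := hm _ (clampD (psi w)); rewrite ger0_norm//; exact: le_trans (ltW m0) h1.
have psi0 : psi 0 = 0 by rewrite -{1}H0 HK.
have psim y : 0 <= y -> m * y <= psi y.
  rewrite le_eqVlt => /predU1P[<-|y0]; first by rewrite psi0 mulr0.
  have [w [_ _]] := mvt y0 (fun x _ => dpsi' x).
  rewrite psi0 !subr0 => ->; rewrite ler_wpM2r ?(ltW y0)//.
  by case/andP: (hm _ (clampD (psi w))).
(* [M] is a Lipschitz constant of psi, so psi stays below min(d, D) on [0, A1]. *)
pose A1 := Num.min d D / (2 * M).
have A10 : 0 < A1 by rewrite divr_gt0 ?mulr_gt0// lt_min d0.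
have psiA1 y : 0 <= y <= A1 -> psi y < Num.min d D.
  move=> /andP[y0 yA]; have := psib y 0; rewrite psi0 !subr0 => h1.
  apply: (le_lt_trans (ler_norm _)); apply: (le_lt_trans h1); rewrite ger0_norm//.
  apply: (@le_lt_trans _ _ (M * A1)); first by rewrite ler_pM2l.
  have mn : 0 < Num.min d D by rewrite lt_min d0.
  rewrite /A1 (_ : M * _ = Num.min d D / 2); last by field; rewrite gt_eqF.
  by rewrite ltr_pdivrMr// mulr_natr mulr2n ltrDl.
have psi_ge0 y : 0 <= y -> 0 <= psi y by move=> y0; apply: le_trans (psim y y0); rewrite mulr_ge0// ltW.
have psiA1D y : 0 <= y <= A1 -> `|psi y| < D.
  move=> yA; have := psiA1 y yA; rewrite lt_min => /andP[_].
  by rewrite ger0_norm// psi_ge0//; case/andP: yA.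
have jf := smooth_upto_jet sf.
have g1E y : `|y| < H D -> derive1n 1 f y = - derive_within I phi (psi y) / phi (psi y).
  by move=> yD; exact: der_uniqT (jf 0%N y yD) (df y yD).
exists D, M, A1, (b * m / M), H, psi, (fun k => derive1n k f); split.
- by split=> // z zD; apply: ID0; apply: le_trans (ltW DD).
- split=> //; last by rewrite divr_gt0 ?mulr_gt0.
  by apply: psiA1D; rewrite (ltW A10) lexx.
- by split.
- split=> [z zD|y yD|]; [by apply: der_eq (dH z) _; exact: hE|by apply: der_eq (dpsi' y) _; rewrite clampE|].
  apply: smooth_upto_jet => -[//|n]; exists (fun y => phi (psi y)); first by move=> y /dpsiD[].
  exact: smooth_upto_comp sphi dpsiD (sphi n).
- split=> //.
  + move=> y yA; have yD := psiA1D y yA; have /andP[y0 _] := yA.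
    have yH : `|y| < H D.
      by rewrite ger0_norm// -[y]psiK (leW_mono mH) (le_lt_trans (ler_norm _)).
    rewrite g1E// !mulNr lerN2 ler_pdivlMr; last by apply: phi0; exact: lt_trans DD.
    have h1 : b * psi y <= derive_within I phi (psi y).
      by apply: phi'b; [exact: psi_ge0|have := psiA1 y yA; rewrite lt_min => /andP[]].
    have /andP[_ h2] := hm _ (ltW yD).
    apply: le_trans h1; apply: (@le_trans _ _ (b * (m * y))); last by rewrite ler_pM2l// psim.
    rewrite (_ : b * m / M * y * phi (psi y) = b * (m * y) * (phi (psi y) / M)); last by ring.
    by rewrite ler_piMr ?(mulr_ge0 (ltW b0) (mulr_ge0 (ltW m0) y0))// ler_pdivrMr// mul1r.
  + split=> y yD; have yD0 := (dpsiD y yD).1.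
      by rewrite /derive1n/= /f psiN phi_even//; exact: ID0 (ltW yD0).
    rewrite !g1E ?normrN// psiN phi'N// phi_even; last exact: ID0 (ltW yD0).
    by rewrite opprK mulNr opprK.
Qed.

End coordinate.

(** * Derivatives relative to half-open time intervals *)

Section relative_derivative.
Variable R : realType.
Implicit Types (A : set R) (f : R -> R).

Lemma der_derive_within A f x : derivable_within A f x -> der A f x (derive_within A f x).
Proof. by move=> h; apply/der_quotient. Qed.

Lemma derive_within_der A f x l : (forall d, 0 < d -> exists y, [/\ A y, y != x & `|y - x| < d]) ->
  der A f x l -> derivable_within A f x /\ derive_within A f x = l.
Proof.
move=> acc df; have dw : derivable_within A f x by apply/cvg_ex; exists l; apply/der_quotient.
by split=> //; exact: der_uniq acc (der_derive_within dw) df.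
Qed.

Lemma half_open_set (T : R) : `[0, T[%classic = [set s | 0 <= s < T].
Proof. by apply/seteqP; split=> t /=; rewrite in_itv. Qed.

Lemma half_open_acc (T t : R) : 0 <= t < T ->
  forall d, 0 < d -> exists y, [/\ [set s | 0 <= s < T] y, y != t & `|y - t| < d].
Proof.
move=> /andP[t0 tT] d d0; pose e := Num.min d (T - t) / 2.
have m0 : 0 < Num.min d (T - t) by rewrite lt_min d0 subr_gt0.
have e0 : 0 < e by rewrite divr_gt0.
have : e < Num.min d (T - t) by rewrite ltr_pdivrMr// mulr_natr mulr2n ltrDl.
rewrite lt_min => /andP[ed eT]; exists (t + e); split.
- by rewrite /= addr_ge0 ?(ltW e0)//= addrC -ltrBrDr.
- by rewrite -subr_eq0 addrC addKr gt_eqF.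
- by rewrite addrC addKr gtr0_norm.
Qed.

Lemma der_derivable f x l : der setT f x l -> derivable f x 1.
Proof. by move=> /der_is_derive[]. Qed.

Lemma derivable_der f x : derivable f x 1 -> der setT f x (derive1 f x).
Proof. by move=> df; apply/der_is_derive; rewrite derive1E; exact: derivableP. Qed.

End relative_derivative.

(** * Joint smoothness of the constructed solution *)

Section solution_algebra.
Variables (R : realType) (g p : nat -> R -> R) (eta A T : R).
Hypothesis dg : forall k y, `|y| < eta -> der setT (g k) y (g k.+1 y).
Hypothesis dp : forall k y, `|y| < eta -> der setT (p k) y (p k.+1 y).
Hypothesis Aeta : A < eta.
Variables u q : nat -> R -> R -> R.
Hypothesis su : jsol g A 0 T u q.

(* This algebra contains the solution and is stable under both partial derivatives. *)
Inductive jet_algebra : (R -> R -> R) -> Prop :=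
| alg_u k : jet_algebra (u k)
| alg_g k : jet_algebra (fun x t => g k (u 0%N x t))
| alg_p k : jet_algebra (fun x t => p k (u 0%N x t))
| alg_zeta : jet_algebra (fun x t => zeta (u 1%N x t))
| alg_cst c : jet_algebra (fun _ _ => c)
| alg_add f h : jet_algebra f -> jet_algebra h -> jet_algebra (fun x t => f x t + h x t)
| alg_mul f h : jet_algebra f -> jet_algebra h -> jet_algebra (fun x t => f x t * h x t)
| alg_ext f h : (forall x t, 0 <= t < T -> f x t = h x t) -> jet_algebra f -> jet_algebra h.

Let ueta x t : 0 <= t < T -> `|u 0%N x t| < eta.
Proof. by move=> tT; apply: le_lt_trans Aeta; exact: (js_bd su). Qed.

Lemma alg_exp f n : jet_algebra f -> jet_algebra (fun x t => f x t ^+ n).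
Proof.
move=> af; elim: n => [|n ih]; first exact: alg_cst.
by apply: (@alg_ext (fun x t => f x t * f x t ^+ n)); [move=> x t _; rewrite exprS|exact: alg_mul].
Qed.

Lemma alg_jcont f : jet_algebra f -> jcont 0 T f.
Proof.
have ju k : jcont 0 T (u k) := jsol_jcont (k := k) su.
elim=> {f} [k|k|k||c|f h _ cf _ ch|f h _ cf _ ch|f h e _ cf].
- exact: ju.
- by apply: jcont_comp => // x t /(ueta x) h; exact: der_continuous (dg k h).
- by apply: jcont_comp => // x t /(ueta x) h; exact: der_continuous (dp k h).
- by apply: jcont_comp => // x t _; exact: der_continuous (der_zeta _).
- by apply: (@jcont_x R 0 T (fun _ => c)) => z; exact: cvg_cst.
- exact: jcont_add.
- exact: jcont_mul.
- apply/jcontP => x t ep tT e0; have [d d0 hd] := (jcontP _ _ _).1 cf x t ep tT e0.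
  by exists d => // y s sT yx st; rewrite -!e//; exact: hd.
Qed.

Lemma alg_per f : jet_algebra f -> forall x t, 0 <= t < T -> f (x + pi *+ 2) t = f x t.
Proof.
elim=> {f} [k|k|k||c|f h _ cf _ ch|f h _ cf _ ch|f h e _ cf] x t tT; rewrite ?(js_per su)//.
- by rewrite cf// ch.
- by rewrite cf// ch.
- by rewrite -!e// cf.
Qed.

Lemma alg_dx f : jet_algebra f -> exists2 h, jet_algebra h &
  forall x t, 0 <= t < T -> der setT (f ^~ t) x (h x t).
Proof.
have dx k x t := @js_dx _ _ _ _ _ _ _ su k x t.
elim=> {f} [k|k|k||c|f h af [f' af' df] ah [h' ah' dh]|f h af [f' af' df] ah [h' ah' dh]|f h e af [f' af' df]].
- by exists (u k.+1); [exact: alg_u|exact: dx].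
- exists (fun x t => g k.+1 (u 0%N x t) * u 1%N x t); first by apply: alg_mul; [exact: alg_g|exact: alg_u].
  by move=> x t tT; apply: (der_gcomp dg); [exact: ueta|exact: dx].
- exists (fun x t => p k.+1 (u 0%N x t) * u 1%N x t); first by apply: alg_mul; [exact: alg_p|exact: alg_u].
  by move=> x t tT; apply: (der_gcomp dp); [exact: ueta|exact: dx].
- exists (fun x t => -1 * (u 1%N x t * (zeta (u 1%N x t) ^+ 3 * u 2%N x t))).
    apply: alg_mul; first exact: alg_cst.
    apply: alg_mul; first exact: alg_u.
    by apply: alg_mul; [apply: alg_exp; exact: alg_zeta|exact: alg_u].
  by move=> x t tT; apply: der_eq (der_zcomp (dx 1%N x t tT)) _; ring.
- by exists (fun _ _ => 0); [exact: alg_cst|move=> x t _; exact: der_cst].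
- exists (fun x t => f' x t + h' x t); first exact: alg_add.
  by move=> x t tT; apply: der_add; [exact: df|exact: dh].
- exists (fun x t => f' x t * h x t + f x t * h' x t); first by apply: alg_add; exact: alg_mul.
  by move=> x t tT; apply: der_mul; [exact: df|exact: dh].
- exists f' => // x t tT; have <- : f ^~ t = h ^~ t by apply/funext => y; exact: e.
  exact: df.
Qed.

(** The equation writes q_0 through the generators; the others follow by differentiating in x. *)
Lemma alg_q k : jet_algebra (q k).
Proof.
elim: k => [|k aq].
  apply: (@alg_ext (fun x t => g 0%N (u 0%N x t) * zeta (u 1%N x t) ^+ 3 * u 2%N x t
      + -1 * (g 1%N (u 0%N x t) * (u 1%N x t ^+ 2 * zeta (u 1%N x t))))).
    by move=> x t tT; rewrite (js_eq su)// /ca /cb; ring.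
  apply: alg_add.
    apply: alg_mul; last exact: alg_u.
    by apply: alg_mul; [exact: alg_g|apply: alg_exp; exact: alg_zeta].
  apply: alg_mul; first exact: alg_cst.
  apply: alg_mul; first exact: alg_g.
  by apply: alg_mul; [apply: alg_exp; exact: alg_u|exact: alg_zeta].
have [h ah dh] := alg_dx aq; apply: alg_ext ah => x t tT.
exact: der_uniqT (dh x t tT) (js_qx su k x tT).
Qed.

Lemma alg_dt f : jet_algebra f -> exists2 h, jet_algebra h &
  forall x t, 0 <= t < T -> der [set s | 0 <= s < T] (f x) t (h x t).
Proof.
have dt k x t := @js_dt _ _ _ _ _ _ _ su k x t.
elim=> {f} [k|k|k||c|f h af [f' af' df] ah [h' ah' dh]|f h af [f' af' df] ah [h' ah' dh]|f h e af [f' af' df]].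
- by exists (q k); [exact: alg_q|exact: dt].
- exists (fun x t => g k.+1 (u 0%N x t) * q 0%N x t); first by apply: alg_mul; [exact: alg_g|exact: alg_q].
  by move=> x t tT; apply: (der_gcomp dg); [exact: ueta|exact: dt].
- exists (fun x t => p k.+1 (u 0%N x t) * q 0%N x t); first by apply: alg_mul; [exact: alg_p|exact: alg_q].
  by move=> x t tT; apply: (der_gcomp dp); [exact: ueta|exact: dt].
- exists (fun x t => -1 * (u 1%N x t * (zeta (u 1%N x t) ^+ 3 * q 1%N x t))).
    apply: alg_mul; first exact: alg_cst.
    apply: alg_mul; first exact: alg_u.
    by apply: alg_mul; [apply: alg_exp; exact: alg_zeta|exact: alg_q].
  by move=> x t tT; apply: der_eq (der_zcomp (dt 1%N x t tT)) _; ring.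
- by exists (fun _ _ => 0); [exact: alg_cst|move=> x t _; exact: der_cst].
- exists (fun x t => f' x t + h' x t); first exact: alg_add.
  by move=> x t tT; apply: der_add; [exact: df|exact: dh].
- exists (fun x t => f' x t * h x t + f x t * h' x t); first by apply: alg_add; exact: alg_mul.
  by move=> x t tT; apply: der_mul; [exact: df|exact: dh].
- exists f' => // x t tT; exact: der_ext (e x) (df x t tT).
Qed.

(** The iterated partials of the statement agree with members of the algebra only for 0 <= t < T;
    [alg_ext] absorbs the difference. *)
Lemma alg_smooth f : jet_algebra f -> smooth_S1_time `[0, T[ f.
Proof.
move=> af; have aw w : jet_algebra (partials `[0, T[ w f).
  elim: w => [//|[] w aw] /=.
    have [h ah dh] := alg_dt aw; apply: alg_ext ah => x t tT.
    rewrite /partial_t half_open_set.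
    by have [_ ->] := derive_within_der (half_open_acc tT) (dh x t tT).
  have [h ah dh] := alg_dx aw; apply: alg_ext ah => x t tT.
  by rewrite /partial_x (der_derive1 (dh x t tT)).
split=> [t|w]; first by rewrite half_open_set => tT x; exact: alg_per.
split.
  by rewrite half_open_set; exact: alg_jcont (aw w).
rewrite half_open_set => x t tT; rewrite -half_open_set; split.
  by have [h _ dh] := alg_dx (aw w); exact: der_derivable (dh x t tT).
rewrite [X in derivable_within X]half_open_set; have [h _ dh] := alg_dt (aw w).
by have [] := derive_within_der (half_open_acc tT) (dh x t tT).
Qed.

End solution_algebra.

(** * Passage between the original and the transformed equation *)

Section solutions.
Variables (R : realType) (I : set R) (phi : R -> R).
Hypothesis phi_smooth : smooth_on I phi.
Hypothesis phi_gt0 : forall s, I s -> 0 < phi s.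

Local Notation dphi := (derive_within I phi).

Lemma sqrt_flux (a v : R) : 0 < a -> Num.sqrt (a ^+ 2 + (a * v) ^+ 2) = a / zeta v.
Proof.
move=> a0; rewrite /zeta invrK (_ : a ^+ 2 + _ = a ^+ 2 * (1 + v ^+ 2)); last by ring.
by rewrite sqrtrM ?sqr_ge0// sqrtr_sqr gtr0_norm.
Qed.

Lemma zetaE v : zeta v - v ^+ 2 * zeta v ^+ 3 = zeta v ^+ 3 :> R.
Proof. by rewrite -{1}[zeta v]mulr1 -(zeta2 v); ring. Qed.

(** With v = rho_x / phi the flux is v zeta v, whose x-derivative is zeta(v)^3 v_x by [zetaE]. The
    formula serves constructed and arbitrary solutions alike. *)
Lemma flux_form (rho : R -> R -> R) t (r1 : R -> R) x r2 :
  (forall y, I (rho y t)) -> (forall y, der setT (rho ^~ t) y (r1 y)) -> der setT r1 x r2 ->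
  let W := fun y s => Num.sqrt (phi (rho y s) ^+ 2 + partial_x rho y s ^+ 2) in
  let v := r1 x / phi (rho x t) in
  partial_x (fun y s => partial_x rho y s / W y s) x t + dphi (rho x t) / phi (rho x t) * (partial_x rho x t ^+ 2 / W x t) =
  zeta v ^+ 3 * (r2 / phi (rho x t) - dphi (rho x t) * r1 x ^+ 2 / phi (rho x t) ^+ 2) + dphi (rho x t) * v ^+ 2 * zeta v.
Proof.
move=> Ir dr dr1 W v.
have p0 y : 0 < phi (rho y t) := phi_gt0 (Ir y).
have pn0 y : phi (rho y t) != 0 by rewrite gt_eqF.
have rE y : partial_x rho y t = r1 y := der_derive1 (dr y).
have rv y : r1 y = phi (rho y t) * (r1 y / phi (rho y t)) by rewrite mulrC divfK.
have WE y : W y t = phi (rho y t) / zeta (r1 y / phi (rho y t)).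
  by rewrite /W rE {1}rv sqrt_flux.
have z0 w : zeta w != 0 :> R by rewrite gt_eqF// zeta_gt0.
rewrite WE rE /partial_x.
have -> : (fun y => derive1 (rho ^~ t) y / W y t) = (fun y => r1 y / phi (rho y t) * zeta (r1 y / phi (rho y t))).
  by apply/funext => y; rewrite -/(partial_x rho y t) rE WE; field; rewrite pn0 z0.
have dp : der setT (fun y => phi (rho y t)) x (dphi (rho x t) * r1 x).
  exact: (der_comp (B := I) (fun y _ => Ir y) (dr x)) (phi_jet phi_smooth 0 (Ir x)).
have dv : der setT (fun y => r1 y / phi (rho y t)) x (r2 / phi (rho x t) - dphi (rho x t) * r1 x ^+ 2 / phi (rho x t) ^+ 2).
  apply: der_eq (der_mul dr1 (der_inv (fun y _ => pn0 y) Logic.I dp)) _.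
  by field.
rewrite (der_derive1 (der_mul dv (der_zcomp dv))) -/v.
set w := r2 / _ - _.
rewrite (_ : w * zeta v + v * (- v * zeta v ^+ 3 * w) = w * (zeta v - v ^+ 2 * zeta v ^+ 3)); last by ring.
rewrite zetaE; move: (zeta v) (z0 v) => zv zv0; rewrite /v; field; rewrite pn0//.
Qed.

Lemma solution_jets rho0 T rho : is_solution I phi rho0 T rho -> exists r1 r2 rt : R -> R -> R,
  [/\ forall x t, 0 <= t < T -> der setT (rho ^~ t) x (r1 x t),
      forall x t, 0 <= t < T -> der setT (r1 ^~ t) x (r2 x t),
      forall x t, 0 <= t < T -> der [set s | 0 <= s < T] (rho x) t (rt x t),
      [/\ jcont 0 T rho, jcont 0 T r1, forall x t, 0 <= t < T -> rho (x + pi *+ 2) t = rho x t &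
          forall x t, 0 <= t < T -> r1 (x + pi *+ 2) t = r1 x t] &
      forall x t, 0 < t < T -> let a := phi (rho x t) in let v := r1 x t / a in
        rt x t = zeta v ^+ 3 * (r2 x t / a - dphi (rho x t) * r1 x t ^+ 2 / a ^+ 2) + dphi (rho x t) * v ^+ 2 * zeta v].
Proof.
move=> [[per sm] Ir pde _]; rewrite half_open_set in per.
have J t : 0 <= t < T -> `[0, T[%classic t by rewrite half_open_set.
have d0 x t (tT : 0 <= t < T) := derivable_der ((sm [::]).2 x t (J t tT)).1.
have d1 x t (tT : 0 <= t < T) := derivable_der ((sm [:: false]).2 x t (J t tT)).1.
have dt x t (tT : 0 <= t < T) := der_derive_within ((sm [::]).2 x t (J t tT)).2.
have e0 := (sm [::]).1; have e1 := (sm [:: false]).1.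
rewrite !half_open_set in e0 e1 dt.
exists (partial_x rho), (partial_x (partial_x rho)), (partial_t `[0, T[ rho); split=> //.
- split=> // x t tT; first exact: per.
  apply/esym; apply: der_uniqT (d0 x t tT) _.
  have h : der setT (fun y : R => y + pi *+ 2) x 1 by der_ring.
  have := der_comp (fun _ _ => Logic.I) h (d0 (x + pi *+ 2) t tT).
  rewrite mulr1 (_ : (fun y => _) = rho ^~ t)//.
  by apply/funext => y; exact: per.
- move=> x t /andP[t0 tT] a v; have tT' : 0 <= t < T by rewrite ltW.
  rewrite pde ?t0//; apply: flux_form; [by move=> y; exact: Ir|by move=> y; exact: d0|exact: d1].
Qed.

(** At an extremum rho_x = 0 and only diffusion is left. Being valid for every solution, the bound
    keeps competitors in the range where H has derivative 1 / phi. *)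
Lemma solution_bound rho0 T rho M : is_solution I phi rho0 T rho -> (forall x, `|rho0 x| <= M) ->
  forall x t, 0 <= t < T -> `|rho x t| <= M.
Proof.
move=> sr rM; have [r1 [r2 [rt [d0 d1 dt [c0 _ per _] pde]]]] := solution_jets sr.
have [_ Ir _ init] := sr.
suff side e : e = 1 \/ e = -1 -> forall x t, 0 <= t < T -> e * rho x t <= M.
  move=> x t tT; rewrite ler_norml lerNl; apply/andP; split.
    by have := side (-1) (or_intror erefl) x t tT; rewrite mulN1r.
  by have := side 1 (or_introl erefl) x t tT; rewrite mul1r.
move=> e1 x t /andP[t0 tT].
suff : (e * rho x t - M) * expR (- t) <= 0 by rewrite pmulr_lle0 ?expR_gt0// subr_le0.
have P0 : 0 < pi *+ 2 :> R by rewrite mulrn_wgt0// pi_gt0.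
apply: (@max_principle_periodic R 0 T (pi *+ 2) t (fun x t => (e * rho x t - M) * expR (- t)) P0) => //.
- have cc (c : R) : jcont 0 T (fun _ _ => c) by apply: (@jcont_x R 0 T (fun _ => c)) => z; exact: cvg_cst.
  apply: jcont_mul; first by apply: jcont_add => //; exact: jcont_mul.
  apply: (jcont_t (G := fun t => expR (- t))) => z.
  by apply: continuous_comp; [exact: opp_continuous|exact: continuous_expR].
- by move=> z s sT; rewrite per.
- move=> z; rewrite pmulr_lle0 ?expR_gt0// subr_le0 init.
  have := rM z; rewrite ler_norml => /andP[h1 h2]; case: e1 => ->; rewrite ?mul1r// mulN1r lerNl//.
- move=> z s /andP[s0 st] yp ym.
  have sT : 0 <= s < T by rewrite (ltW s0) (le_lt_trans st).
  have sT' : 0 < s < T by rewrite s0 (le_lt_trans st).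
  have E0 : 0 < expR (- s) by exact: expR_gt0.
  have p0 : 0 < phi (rho z s) by apply: phi_gt0; exact: Ir.
  have lm w : e * rho w s <= e * rho z s by have := ym w; rewrite ler_pM2r// lerD2r.
  have e0 := der_scale e (d0 z s sT); have e2 := fun w => der_scale e (d0 w s sT).
  have v0 := der_max ltr01 (fun w _ => lm w) e0.
  have w0 := der2_max ltr01 (fun w _ => lm w) e2 (der_scale e (d1 z s sT)).
  have {}v0 : r1 z s = 0.
    by move/eqP: v0; rewrite mulf_eq0; case: e1 => ->; rewrite ?oppr_eq0 oner_eq0 => /eqP.
  exists ((e * rt z s - (e * rho z s - M)) * expR (- s)).
    have -> : rt z s = zeta 0 ^+ 3 * (r2 z s / phi (rho z s)).
      by rewrite (pde z s sT') v0 mul0r !expr0n/=; ring.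
    rewrite pmulr_llt0//.
    have : e * (zeta 0 ^+ 3 * (r2 z s / phi (rho z s))) <= 0.
      rewrite (_ : _ * _ = (e * r2 z s) * (zeta 0 ^+ 3 / phi (rho z s))); last by ring.
      by rewrite mulr_le0_ge0// divr_ge0 ?exprn_ge0 ?(ltW (zeta_gt0 _)) ?ltW.
    by move: yp; rewrite pmulr_lgt0//; lra.
  have dE : der [set s0 | 0 <= s0 < T] (fun s : R => expR (- s)) s (- expR (- s)).
    apply: (@der_eq _ _ _ _ (expR (- s) * - 1)); last by ring.
    apply: (der_comp (B := setT) (f := fun t => - t)) => //; first exact: der_opp (der_id _ _).
    by apply/der_is_derive; exact: is_derive_expR.
  have h := dt z s sT; der_ring.
- by rewrite t0 lexx.
Qed.

Variables (D A : R) (H psi : R -> R) (g : nat -> R -> R).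
Hypothesis ID : forall z, `|z| <= D -> I z.
Hypothesis HK : cancel H psi.
Hypothesis psiK : cancel psi H.
Hypothesis mH : {mono H : x y / x <= y}.
Hypothesis HN : forall z, H (- z) = - H z.
Hypothesis dH : forall z, `|z| <= D -> der setT H z (phi z)^-1.
Hypothesis dpsi : forall y, `|psi y| <= D -> der setT psi y (phi (psi y)).
Hypothesis psi_jet : forall k y, `|y| < H D -> der setT (derive1n k psi) y (derive1n k.+1 psi y).
Hypothesis dg : forall k y, `|y| < H D -> der setT (g k) y (g k.+1 y).
Hypothesis g0E : forall y, g 0%N y = (phi (psi y))^-1.
Hypothesis g1E : forall y, `|y| < H D -> g 1%N y = - dphi (psi y) / phi (psi y).
Hypothesis AD : A < H D.

Lemma norm_le_H z y : (`|H z| <= H y) = (`|z| <= y).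
Proof. by rewrite !ler_norml -HN !mH. Qed.

Lemma psi_bound y : `|y| <= A -> `|psi y| <= psi A.
Proof. by move=> yA; rewrite -norm_le_H !psiK. Qed.

Lemma psiA_le : psi A <= D. Proof. by rewrite -mH psiK ltW. Qed.

Lemma I_psi y : `|y| <= A -> I (psi y).
Proof. by move=> /psi_bound h; apply: ID; apply: le_trans h psiA_le. Qed.

Lemma solution_of_jsol T u q : jsol g A 0 T u q ->
  is_solution I phi (fun x => psi (u 0%N x 0)) T (fun x t => psi (u 0%N x t)).
Proof.
move=> su; have uA x t (tT : 0 <= t < T) := js_bd su x tT.
have Iu x t : 0 <= t < T -> I (psi (u 0%N x t)) by move=> /(uA x)/I_psi.
have dpu x t : 0 <= t < T -> der setT psi (u 0%N x t) (phi (psi (u 0%N x t))).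
  by move=> tT; apply: dpsi; apply: le_trans (psi_bound (uA x t tT)) psiA_le.
split=> //.
- apply: (@alg_smooth _ g (fun k => derive1n k psi) (H D) A T dg psi_jet AD u q su).
  exact: (@alg_p _ g (fun k => derive1n k psi) T u 0).
- move=> x t /andP[t0 tT] W; have tT' : 0 <= t < T by rewrite ltW.
  have p0 : 0 < phi (psi (u 0%N x t)) by apply: phi_gt0; exact: Iu.
  have pn0 : phi (psi (u 0%N x t)) != 0 by rewrite gt_eqF.
  have dr y : der setT (fun y => psi (u 0%N y t)) y (phi (psi (u 0%N y t)) * u 1%N y t).
    exact: der_comp (fun _ _ => Logic.I) (js_dx su 0%N y tT') (dpu y t tT').
  have dp : der setT (fun y => phi (psi (u 0%N y t))) x (dphi (psi (u 0%N x t)) * (phi (psi (u 0%N x t)) * u 1%N x t)).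
    exact: (der_comp (B := I) (fun y _ => Iu y t tT') (dr x)) (phi_jet phi_smooth 0 (Iu x t tT')).
  have dr1 := der_mul dp (js_dx su 1%N x tT').
  rewrite (@flux_form (fun x t => psi (u 0%N x t)) t _ x _ (fun y => Iu y t tT') dr dr1).
  have -> : phi (psi (u 0%N x t)) * u 1%N x t / phi (psi (u 0%N x t)) = u 1%N x t by field.
  have dt : der [set s | 0 <= s < T] (fun s => psi (u 0%N x s)) t (phi (psi (u 0%N x t)) * q 0%N x t).
    exact: (der_comp (B := setT)) (fun _ _ => Logic.I) (js_dt su 0%N x tT') (dpu x t tT').
  rewrite /partial_t half_open_set; have [_ ->] := derive_within_der (half_open_acc tT') dt.
  rewrite (js_eq su)// /ca /cb g0E g1E; last exact: le_lt_trans (uA x t tT') AD.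
  by field.
Qed.

Hypothesis bg : forall k, exists C, forall y, `|y| <= A -> `|g k y| <= C.

(** The competitor, read as H(rho), is of class [c21] and stays in [- A, A] by [solution_bound], so
    [jsol_uniq] applies to it. *)
Lemma solution_uniq T u q T' rho : jsol g A 0 T u q -> 0 < T -> 0 < T' ->
  is_solution I phi (fun x => psi (u 0%N x 0)) T' rho ->
  forall x t, 0 <= t -> t < T -> t < T' -> rho x t = psi (u 0%N x t).
Proof.
move=> su T0 T'0 sr; have [r1 [r2 [rt [d0 d1 dt [c0 c1 per _] pde]]]] := solution_jets sr.
have [_ Ir _ init] := sr.
have uA x t (tT : 0 <= t < T) := js_bd su x tT.
have rb : forall x t, 0 <= t < T' -> `|rho x t| <= psi A.
  by apply: (solution_bound sr) => x; apply: psi_bound; apply: uA; rewrite lexx.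
have rD x t : 0 <= t < T' -> `|rho x t| <= D by move=> tT; apply: le_trans (rb x t tT) psiA_le.
have HA x t : 0 <= t < T' -> `|H (rho x t)| <= A by move=> /(rb x); rewrite -norm_le_H psiK.
have p0 x t : 0 <= t < T' -> 0 < phi (rho x t) by move=> tT; apply: phi_gt0; exact: Ir.
have g0 y : `|y| <= A -> 0 < g 0%N y.
  by move=> yA; rewrite g0E invr_gt0; apply: phi_gt0; exact: I_psi.
move=> x t t0 tT tT'; rewrite -[LHS]HK; congr psi.
apply: (jsol_uniq dg AD bg g0 (b' := T') (r := fun x t => H (rho x t)) (r1 := fun x t => r1 x t / phi (rho x t))
  (r2 := fun x t => r2 x t / phi (rho x t) - dphi (rho x t) * r1 x t ^+ 2 / phi (rho x t) ^+ 2)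
  (rt := fun x t => rt x t / phi (rho x t)) su) => //.
- split=> [z s sT|z s sT|z s /andP[s0 sT]|z s sT|].
  + apply: der_eq (der_comp (fun _ _ => Logic.I) (d0 z s sT) (dH (rD z s sT))) _; exact: mulrC.
  + have dp : der setT (fun y => phi (rho y s)) z (dphi (rho z s) * r1 z s).
      exact: (der_comp (B := I) (fun y _ => Ir y s sT) (d0 z s sT)) (phi_jet phi_smooth 0 (Ir z s sT)).
    have pn0 y : phi (rho y s) != 0 by rewrite gt_eqF// p0.
    apply: der_eq (der_mul (d1 z s sT) (der_inv (fun y _ => pn0 y) Logic.I dp)) _.
    by field.
  + have sT' : 0 <= s < T' by rewrite ltW.
    apply: der_eq (der_comp (B := setT) (fun _ _ => Logic.I) (dt z s sT') (dH (rD z s sT'))) _; exact: mulrC.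
  + by rewrite per.
  + by apply: jcont_comp => // z s sT; exact: der_continuous (dH (rD z s sT)).
- move=> z s /andP[s0 sT]; have sT' : 0 <= s < T' by rewrite ltW.
  have pn0 : phi (rho z s) != 0 by rewrite gt_eqF// p0.
  rewrite pde ?s0// /ca /cb g0E g1E ?HK; last exact: le_lt_trans (HA z s sT') AD.
  by field.
- by move=> z; rewrite init psiK.
Qed.

End solutions.

(** * Modulus of continuity on the circle, and blow-up *)

Section circle.
Variable R : realType.

(** The sine is 1-Lipschitz and insensitive to periods, so its increment is below every element of
    the set whose infimum is the distance. *)
Lemma sin_le_dist (x y : R) : `|sin x - sin y| <= dist_S1 x y.
Proof.
have sp n (z : R) : sin (z + (pi *+ 2) *+ n) = sin z by exact: periodicn (@sinD2pi R) n z.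
apply: lb_le_inf; first by exists `|x - y + 0%:~R * (pi *+ 2)|; exists 0.
move=> _ [k _ <-].
have <- : sin (x + k%:~R * (pi *+ 2)) = sin x.
  case: k => n; first by rewrite -[n%:~R]/(n%:R) mulr_natl sp.
  by rewrite NegzE mulrNz mulNr -[(n.+1)%:~R]/(n.+1%:R) mulr_natl -[LHS](sp n.+1) subrK.
have ds z : der setT (@sin R) z (cos z) by apply/der_is_derive; exact: is_derive_sin.
have := lip_der y (x + k%:~R * (pi *+ 2)) ds (@cos_max R); rewrite mul1r.
by rewrite addrAC.
Qed.

Lemma modulus_le (f : R -> R) (C s th : R) : 0 <= C -> 0 <= s -> 0 <= th ->
  (forall x y, `|f x - f y| <= C * `|sin x - sin y| `^ s) -> modulus_S1 f th <= C * th `^ s.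
Proof.
move=> C0 s0 th0 hf; rewrite /modulus_S1; set S := [set r | _].
have ub r : S r -> r <= C * th `^ s.
  move=> [x [y [<- ->]]]; apply: (le_trans (hf y x)); rewrite ler_wpM2l// distrC.
  by apply: ge0_ler_powR; rewrite ?nnegrE// ?(le_trans _ (sin_le_dist x y))// sin_le_dist.
have [[r Sr]|S0] := pselect (exists r, S r).
  by apply: ge_sup; [exists r|exact: ub].
(* No pair lies at this distance: the supremum of the empty set is 0 by convention. *)
have -> : S = set0 by apply/seteqP; split=> // r Sr; case: S0; exists r.
by rewrite sup0 mulr_ge0// powR_ge0.
Qed.

(** The exponent s - sigma lies in [0, 1] and theta <= pi <= 4. *)
Lemma powR_exponent_le (th s sigma : R) : 0 <= th <= pi -> 0 < s -> sigma <= s -> s <= sigma + 1 ->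
  th `^ s <= 4 * th `^ sigma.
Proof.
move=> /andP[th0 thpi] s0 h1 h2; have [->|tn0] := eqVneq th 0.
  by rewrite powR0 ?mulr_ge0 ?powR_ge0// gt_eqF.
rewrite -{1}(subrK sigma s) powRD ?tn0 ?implybT// ler_wpM2r ?powR_ge0//.
have p4 : pi <= 4 :> R.
  by have := pihalf_lt2 R; rewrite ltr_pdivrMr// => /ltW/le_trans; apply; rewrite -natrM.
have a0 : 0 <= s - sigma by rewrite subr_ge0.
apply: (@le_trans _ _ (4 `^ (s - sigma))).
  by apply: ge0_ler_powR; rewrite ?nnegrE// (le_trans thpi).
by apply: ler1_powR; [rewrite ler1n|rewrite lerBlDl].
Qed.

(** The supremum in [gradient_blows_up] omits time 0; the bound on the initial slope forces large
    slopes to occur at positive times, and each is counted once t has passed it. *)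
Lemma unbounded_blow_up (rho : R -> R -> R) (T : R) : 0 < T ->
  (exists B, forall x, `|partial_x rho x 0| <= B) ->
  (forall M, exists x t, 0 <= t < T /\ M < `|partial_x rho x t|) -> gradient_blows_up T rho.
Proof.
move=> T0 [B hB] h; apply/cvgeyPge => M.
have [x [s [/andP[s0 sT] hs]]] := h (Num.max M B).
have {}s0 : 0 < s.
  rewrite lt_neqAle s0 andbT; apply/eqP => s00; move: hs; rewrite -s00 gt_max => /andP[_].
  by rewrite ltNge hB.
near=> t; have st : s < t by near: t; exact: nbhs_left_gt.
apply: (@le_trans _ _ (`|partial_x rho x s|)%:E).
  by rewrite lee_fin; move: hs; rewrite gt_max => /andP[/ltW].
by apply: ereal_sup_ubound; exists x, s; rewrite s0 st.
Unshelve. all: by end_near. Qed.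

End circle.

(** * Choice of the parameters and assembly *)

Unset Implicit Arguments.

Theorem theorem1p3 (R : realType) (I : set R) (phi : R -> R)
    (I_interval : is_interval I) (I_closed : closed I)
    (I_interior : interior I !=set0) (I_0 : I 0)
    (phi_smooth : smooth_on I phi)
    (phi_gt0 : forall s, I s -> 0 < phi s)
    (I_sym : forall s, I s -> I (- s))
    (phi_even : forall s, I s -> phi (- s) = phi s)
    (phi2_gt0 : 0 < iter 2 (derive_within I) phi 0)
    (sigma lambda : R) (sigma_itv : 0 < sigma < 1 / 2)
    (lambda_gt0 : 0 < lambda) :
  exists rho0 : R -> R,
    [/\ smooth_S1 rho0,
        forall x, I (rho0 x),
        forall theta : R, 0 <= theta <= pi ->
          modulus_S1 rho0 theta <= lambda * theta `^ sigma
      & exists (T : R) (rho : R -> R -> R),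
          [/\ 0 < T, is_maximal_solution I phi rho0 T rho
            & gradient_blows_up T rho]].
Proof.
have [D [Phi [A1 [c [H [psi [g [[D0 ID] [A10 psiA1 c0 Phi0] [HK psiK mH HN psiL] [dH dpsi psi_jet]
  [dg g0E g1E g1c [g_even g1_odd]]]]]]]]]] :=
  coordinate_change I_interval I_interior phi_smooth phi_gt0 I_sym phi_even phi2_gt0.
(* [A1] is the range where g' <= - c r. The last bound fixes the Hoelder constant: Phi from psi, 2
   from the data and 4 from the change of exponent give 8 Phi A <= lambda. *)
pose A := Num.min 1 (Num.min A1 (lambda / (8 * Phi))).
have A0 : 0 < A by rewrite !lt_min ltr01 A10 divr_gt0// mulr_gt0.
have A_1 : A <= 1 by rewrite ge_min lexx.
have AA1 : A <= A1 by rewrite !ge_min lexx orbT.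
have Alam : 8 * Phi * A <= lambda.
  by rewrite mulrC -ler_pdivlMr ?mulr_gt0// !ge_min lexx !orbT.
have A1D : A1 < H D by rewrite -[A1]psiK (leW_mono mH) (le_lt_trans (ler_norm _)).
have AD : A < H D := le_lt_trans AA1 A1D.
have HD y : `|y| <= A -> `|y| < H D by move=> /le_lt_trans; apply.
have bg := jet_bounded AD dg.
have Ipsi y : `|y| <= A -> I (psi y) by exact: (I_psi ID psiK mH HN AD).
have g0pos y : `|y| < H D -> 0 < g 0%N y.
  move=> yD; rewrite g0E invr_gt0; apply: phi_gt0; apply: ID.
  by rewrite -(norm_le_H mH HN) psiK ltW.
have [gmin [gmax [gmin0 gb]]] := positive_bounds (ltW A0) AD (dg 0%N) g0pos.
have ming y : `|y| <= A -> gmin <= g 0%N y by move=> /gb/andP[].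
have maxg y : `|y| <= A -> g 0%N y <= gmax by move=> /gb/andP[].
have gmax0 : 0 < gmax.
  have := gb 0; rewrite normr0 => /(_ (ltW A0))/andP[h1 h2].
  exact: lt_le_trans gmin0 (le_trans h1 h2).
have [G1 hG1] := bg 1%N.
have G10 : 0 <= G1 by apply: le_trans (hG1 0 _); rewrite ?normr_ge0 ?normr0 ?ltW.
(* The sine barrier sinks at a speed that must exceed (gmax + G1) L with L = 3 A. *)
pose sb := (gmax + G1) * (3 * A) + 1.
have sb0 : 0 < sb by rewrite ltr_wpDl// (mulr_ge0 (addr_ge0 (ltW gmax0) G10))// (mulr_ge0 (ler0n _ 3) (ltW A0)).
(* Smallness required by [jsol_lifespan]: [d2] and [d3] bound K0 m0, and [d4] bounds m0 so that the
   sine barrier loses at most half of its height A / 2 by time T1. *)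
pose d2 := c / (48 * gmax); pose d3 := c / (16 * (18 * gmax + 3 * c)); pose d4 := A / 2 * c / (8 * sb).
have gc0 : 0 < 18 * gmax + 3 * c by rewrite addr_gt0 ?mulr_gt0.
pose delta := Num.min (1 / 2) (Num.min d2 (Num.min d3 d4)).
have delta0 : 0 < delta.
  by rewrite !lt_min; apply/and4P; split; rewrite ?divr_gt0 ?mulr_gt0 ?divr_gt0.
(* The profile estimates need s >= 1/3; raising the exponent costs only the factor of
   [powR_exponent_le]. *)
pose s := Num.max sigma (1 / 3).
have /andP[sig0 sig1] := sigma_itv.
have s12 : 1 / 3 <= s < 1 / 2 by rewrite le_max lexx orbT gt_max sig1/=; lra.
have a01 : 0 < A <= 1 by rewrite A0.
have [r0 [m0 [K0 [nr [rP [rN [rA [rH [/andP[m00 m0d] [K01 [K0h [K0m [rsin [rpos rcub]]]]]]]]]]]]]] :=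
  initial_data s12 a01 delta0.
have dd x : x <= delta -> [/\ x <= 1 / 2, x <= d2, x <= d3 & x <= d4].
  by rewrite !le_min => /and4P[].
have [m1 _ _ m4] := dd _ m0d; have [_ k2 k3 _] := dd _ K0m.
pose T1 := 4 * m0 / c.
(* The remaining premise, that no solution outlives T1, is [jsol_lifespan] at T = T1. *)
have [|T [U [Q [T0 sU U0 Uinf]]]] := maximal_existence dg AD (ltW A0) bg gmin0 ming maxg (T1 := T1) nr rP rA.
  move=> b u q su u0; rewrite leNgt; apply/negP => Tb.
  have T10 : 0 <= T1 by rewrite divr_ge0 ?mulr_ge0 ?ltW.
  have sl : (gmax + G1) * (3 * A) < sb by rewrite ltrDl.
  have gpos y : `|y| <= A -> 0 < g 0%N y by move=> /HD; exact: g0pos.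
  have gc y : 0 <= y <= A -> g 1%N y <= - c * y.
    by move=> /andP[y0 yA]; apply: g1c; rewrite y0 (le_trans yA).
  have ge y : `|y| <= A -> g 0%N (- y) = g 0%N y by move=> /HD; exact: g_even.
  have go y : `|y| <= A -> g 1%N (- y) = - g 1%N y by move=> /HD; exact: g1_odd.
  have uN x : u 0%N (- x) 0 = - u 0%N x 0 by rewrite !u0.
  apply: (jsol_lifespan dg AD (ltW A0) bg gpos maxg hG1 c0 gc ge go su uN T10 Tb (m0 := m0) (K0 := K0)
    (h := A / 2) (L := 3 * A) (s := sb)) => //.
  - by rewrite m00.
  - by move: k2; rewrite ler_pdivlMr ?mulr_gt0// mulrC.
  - by move: k3; rewrite ler_pdivlMr ?mulr_gt0// mulrC.
  - by rewrite divr_ge0// ltW.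
  - by lra.
  - rewrite /T1 (_ : 2 * (sb * (4 * m0 / c)) = m0 * (8 * sb) / c); last by ring.
    by rewrite ler_pdivrMr// -ler_pdivlMr// mulr_gt0.
  - by move=> x xp; rewrite u0; exact: rsin.
  - by move=> x xp; rewrite u0; exact: rpos.
  - by move=> x xp; rewrite u0; exact: rcub.
pose rho x t := psi (U 0%N x t); exists (fun x => psi (r0 x)).
have E : (fun x => psi (U 0%N x 0)) = (fun x => psi (r0 x)) by apply/funext => x; rewrite U0.
have sr : is_solution I phi (fun x => psi (r0 x)) T rho.
  by rewrite -E; exact: (solution_of_jsol phi_smooth phi_gt0 ID psiK mH HN dpsi psi_jet dg g0E g1E AD sU).
have UA x t (tT : 0 <= t < T) := js_bd sU x tT.
have drho x t : 0 <= t < T -> der setT (rho ^~ t) x (phi (rho x t) * U 1%N x t).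
  move=> tT; apply: (der_comp (B := setT)) => //; first exact: (js_dx sU).
  apply: dpsi; apply: le_trans (psiA_le psiK mH AD).
  exact: (psi_bound psiK mH HN (UA x t tT)).
have px x t : 0 <= t < T -> partial_x rho x t = phi (rho x t) * U 1%N x t.
  by move=> tT; exact: der_derive1 (drho x t tT).
have phip x t : 0 <= t < T -> 0 < phi (rho x t) by move=> tT; apply: phi_gt0; apply: Ipsi; exact: UA.
have phig x t : 0 <= t < T -> gmax^-1 <= phi (rho x t) <= gmin^-1.
  move=> tT; have := gb _ (UA x t tT); rewrite g0E => /andP[h1 h2].
  have p0 := phip x t tT; rewrite -[phi _]invrK !lef_pV2 ?posrE ?invr_gt0//.
  by rewrite h1 h2.
(* On the range in use phi >= 1 / gmax, so unboundedness passes from r_x to rho_x. *)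
have unb M : exists x t, 0 <= t < T /\ M < `|partial_x rho x t|.
  have [x [t [tT h]]] := Uinf (gmax * M); exists x, t; split=> //.
  rewrite px// normrM gtr0_norm ?phip//.
  have /andP[h1 _] := phig x t tT.
  apply: (@lt_le_trans _ _ (gmax^-1 * `|U 1%N x t|)); first by rewrite ltr_pdivlMl.
  by rewrite ler_wpM2r.
split.
- split=> [x|n x]; first by rewrite rP.
  have nI (i : unit) : 0 <= (fun _ : unit => 0 : R) i by [].
  have np : nice (fun x => psi (r0 x)).
    move=> m; apply: (tameS nI).
    exact: (@tame_comp _ unit _ nI (fun k => derive1n k psi) A (H D) m.+1 (fun _ => r0) 0%N AD psi_jet
      (jet_bounded AD psi_jet) (fun _ => rA) (nr m.+1) isT).
  exact: der_derivable ((nice_jet np n).2 x).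
- by move=> x; exact: Ipsi.
- move=> theta thpi; have /andP[th0 _] := thpi.
  have s0 : 0 < s by case/andP: s12; lra.
  have C0 : 0 <= Phi * (2 * A) by rewrite !mulr_ge0 ?ltW.
  apply: (le_trans (@modulus_le _ _ (Phi * (2 * A)) s theta C0 (ltW s0) th0 _)).
    move=> x y; apply: (le_trans (psiL _ _)); rewrite -mulrA ler_pM2l//.
  have ss : sigma <= s by rewrite le_max lexx.
  have s1 : s <= sigma + 1 by case/andP: s12; lra.
  apply: (@le_trans _ _ (Phi * (2 * A) * (4 * theta `^ sigma))).
    by rewrite ler_wpM2l// powR_exponent_le.
  rewrite (_ : Phi * (2 * A) * (4 * theta `^ sigma) = 8 * Phi * A * theta `^ sigma); last by ring.
  by rewrite ler_wpM2r// powR_ge0.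
- exists T, rho; split=> //.
    split=> // T' rho' T'0 sr'.
    (* A longer solution would have bounded slope on the closed interval [0, T]; before T it
       coincides with [rho], whose slope is unbounded. *)
    have TT' : T' <= T.
      rewrite leNgt; apply/negP => TT'.
      have [r1 [r2 [rt [d0 _ _ [_ c1 _ per1] _]]]] := solution_jets phi_smooth phi_gt0 sr'.
      have P0 : 0 < pi *+ 2 :> R by rewrite mulrn_wgt0// pi_gt0.
      have [M hM] := jcont_periodic_bounded P0 c1 (ltW T0) TT' per1.
      have [x [t [/andP[t0 tT] ]]] := unb M; apply/negP; rewrite -leNgt.
      have tT' : 0 <= t < T' by rewrite t0 (lt_trans tT).
      have -> : partial_x rho x t = r1 x t.
        apply: der_derive1; have <- : rho' ^~ t = rho ^~ t; last exact: d0.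
        apply/funext => y; rewrite -E in sr'.
        exact: (solution_uniq phi_smooth phi_gt0 ID HK psiK mH HN dH dg g0E g1E AD bg sU T0 T'0 sr' y t0 tT (lt_trans tT TT')).
      by apply: hM; rewrite t0 ltW.
    split=> // x t /andP[t0 tT']; rewrite -E in sr'.
    exact: (solution_uniq phi_smooth phi_gt0 ID HK psiK mH HN dH dg g0E g1E AD bg sU T0 T'0 sr' x t0 (lt_le_trans tT' TT') tT').
  apply: unbounded_blow_up => //.
  have [B hB] := jsol_bounded 1%N sU (lexx 0) T0.
  exists (gmin^-1 * B) => x; have t00 : 0 <= (0 : R) < T by rewrite lexx.
  rewrite px// normrM gtr0_norm ?phip//; have /andP[_ h] := phig x 0 t00.
  by apply: ler_pM => //; [exact/ltW/phip|apply: hB; rewrite lexx].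
Qed.
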